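(* Let $a,b,c,d,e$ be complex numbers and $z=\frac{bcde}{aq}$ with $\left|\frac{aq}{z}\right|<1$. Then \begin{align*} &{}_{8}\psi_{8}\left[a;b,c,d,e,\tfrac az,z;q,\tfrac{aq}{z}\right]\\ &=\left(1-\tfrac1z\right)\frac{(q,q,aq,q/a;q)_\infty}{(zq/a,\,q/z,\,aq/z;q)_\infty}\, \frac{\Omega(aq;\,bc,bd,be,cd,ce,de,z^2)}{\Omega(aq;b,c,d,e)\,\Omega\!\left(\tfrac1z;\tfrac1b,\tfrac1c,\tfrac1d,\tfrac1e\right)}\; {}_{8}W_{7}\left[\tfrac1z;\tfrac bz,\tfrac cz,\tfrac dz,\tfrac ez,\tfrac za;q,q\right]\\ &\quad+\frac1z\,\frac{(q,q,aq,q/a,b,c,d,e;q)_\infty}{(q/z,\,zq/a,\,zq,\,aq/z;q)_\infty}\, \frac{\Omega\!\left(\tfrac{aq}{z};b,c,d,e\right)}{\Omega(aq;b,c,d,e)\,\Omega\!\left(\tfrac1z;\tfrac1b,\tfrac1c,\tfrac1d,\tfrac1e\right)}. \end{align*}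
   Context: Fix a complex number $q$ with $0<|q|<1$. Set $(x;q)_\infty=\prod_{n\ge 0}(1-xq^n)$, $(x;q)_n=(x;q)_\infty/(xq^n;q)_\infty$ for every integer $n$ (positive, zero or negative), and $(x_1,\dots,x_m;q)_n=\prod_i (x_i;q)_n$ (also for $n=\infty$). Notation: $\Omega(x_1,\dots,x_n;a_1,\dots,a_m)=\prod_{i=1}^n\prod_{j=1}^m (x_i/a_j;q)_\infty$. Very-well-poised bilateral series: ${}_8\psi_8[a;a_3,\dots,a_8;q,Z]=\sum_{n=-\infty}^{\infty}\frac{1-aq^{2n}}{1-a}\prod_{i=3}^{8}\frac{(a_i;q)_n}{(aq/a_i;q)_n}\,Z^n$. Very-well-poised unilateral series: ${}_8W_7[a_1;a_4,\dots,a_8;q,Z]=\sum_{n=0}^{\infty}\frac{1-a_1q^{2n}}{1-a_1}\frac{(a_1;q)_n}{(q;q)_n}\prod_{i=4}^{8}\frac{(a_i;q)_n}{(a_1q/a_i;q)_n}\,Z^n$. Convention: all parameters are nonzero and such that no denominator appearing (in coefficients or in terms of series) vanishes. *)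

(* Defs.v *)
From HB Require Import structures.
From mathcomp Require Import all_boot all_order all_algebra.
From mathcomp Require Import complex.
From mathcomp Require Import all_classical all_reals all_analysis.
From mathcomp Require Import ring lra.

Set Implicit Arguments.
Unset Strict Implicit.
Unset Printing Implicit Defensive.

Import Order.TTheory GRing.Theory Num.Theory.
Import numFieldNormedType.Exports.

Local Open Scope classical_set_scope.
Local Open Scope ring_scope.

(* Everything is defined over an arbitrary numFieldType K, so that it inherits
   the norm topology of K; the intended instance is K = R[i], R : realType. *)
Section QSeries.
Variable K : numFieldType.
Implicit Types (q x a Z : K) (s xs ys : seq K).

Definition qfac q x (n : nat) : K := \prod_(0 <= k < n) (1 - x * q ^+ k).

(* (x;q)_oo *)
Definition qinf q x : K := limn (qfac q x).

(* (x;q)_n for n : int.  Where (x q^n;q)_oo <> 0 this is the quotient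
   (x;q)_oo / (x q^n;q)_oo (lemma qpochE below); the finite products also give
   the usual value when both infinite products vanish, as for x = q^-m, n >= 0.
   Note that Negz m is the integer - m.+1. *)
Definition qpoch q x (n : int) : K :=
  match n with
  | Posz m => qfac q x m
  | Negz m => (qfac q (x * q ^- m.+1) m.+1)^-1
  end.

(* (x_1, ..., x_m; q)_oo *)
Definition qinfs q s : K := \prod_(x <- s) qinf q x.

Definition Omega q xs ys : K := \prod_(x <- xs) \prod_(y <- ys) qinf q (x / y).

(* Sum over all n : int; the two halves are summed separately. *)
Definition bisum (f : int -> K) : K :=
  limn (series (fun n : nat => f n%:Z)) +
  limn (series (fun n : nat => f (- n.+1%:Z))).

(* Very-well-poised bilateral and unilateral series; the free parameters
   (a_3, ..., resp. a_4, ...) are given by the list s. *)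
Definition vwp_psi q a s Z : K :=
  bisum (fun n : int =>
    (1 - a * q ^ (2 * n)) / (1 - a) *
    (\prod_(x <- s) (qpoch q x n / qpoch q (a * q / x) n)) * Z ^ n).

Definition vwp_W q a s Z : K :=
  limn (series (fun n : nat =>
    (1 - a * q ^+ (2 * n)) / (1 - a) *
    (qpoch q a n / qpoch q q n) *
    (\prod_(x <- s) (qpoch q x n / qpoch q (a * q / x) n)) * Z ^+ n)).

Definition psi88 q a a3 a4 a5 a6 a7 a8 Z : K :=
  vwp_psi q a [:: a3; a4; a5; a6; a7; a8] Z.

Definition W87 q a1 a4 a5 a6 a7 a8 Z : K :=
  vwp_W q a1 [:: a4; a5; a6; a7; a8] Z.

(* No denominator occurring in the terms of the series vanishes.  In the term
   of index n >= 0 of vwp_psi the denominator is (a q/x;q)_n, in the term of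
   index - n it is that of (x;q)_(-n) = 1 / (x q^-n;q)_n.  A zero of
   (a q^(1-n)/x;q)_n = 1 / (a q/x;q)_(-n) only makes the term of index - n
   vanish (as it does in Rocq, where 0^-1 = 0), and is allowed.  In vwp_W the
   denominators (q;q)_n never vanish for 0 < |q| < 1. *)
Definition vwp_psi_defined q a s : Prop :=
  1 - a != 0 /\
  forall x, x \in s -> forall n : nat,
    qfac q (a * q / x) n != 0 /\ qfac q (x * q ^- n) n != 0.

Definition vwp_W_defined q a s : Prop :=
  1 - a != 0 /\
  forall x, x \in s -> forall n : nat, qfac q (a * q / x) n != 0.

Lemma qfacD q x m n : qfac q x (m + n) = qfac q x m * qfac q (x * q ^+ m) n.
Proof.
rewrite /qfac (big_cat_nat (n := m)) ?leq_addr //=; congr (_ * _).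
rewrite -{1}[m]add0n big_addn addKn; apply: eq_bigr => k _.
by rewrite -mulrA -exprD addnC.
Qed.

Lemma qinf_shift q x (n : nat) : cvgn (qfac q (x * q ^+ n)) ->
  qinf q x = qfac q x n * qinf q (x * q ^+ n).
Proof.
move=> cx; rewrite /qinf; apply: cvg_lim; first exact: norm_hausdorff.
rewrite -(cvg_shiftn n).
have -> : [sequence qfac q x (k + n)]_k =
    (fun k => qfac q x n * qfac q (x * q ^+ n) k).
  by apply/funext => k; rewrite /= addnC qfacD.
exact: (cvgM (cvg_cst _) cx).
Qed.

End QSeries.

Section Convergence.
Variable R : realType.
Local Notation C := (R[i]).
Implicit Types q x : C.

Lemma cvg_complex (u : nat -> C) (v w : nat -> R) :
  (forall n, u n = (v n +i* w n)%C) -> cvgn v -> cvgn w ->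
  cvgn (u : nat -> (C : numFieldType)).
Proof.
move=> uE /cvgrPdist_lt cv /cvgrPdist_lt cw.
apply/cvg_ex; exists (limn v +i* limn w)%C.
apply/cvgrPdist_lt => -[e e']; rewrite ltcE /= => /andP[/eqP -> e0].
have e2 : 0 < e / 2 by rewrite divr_gt0.
near=> n.
have hv : `|limn v - v n| < e / 2 by near: n; exact: cv.
have hw : `|limn w - w n| < e / 2 by near: n; exact: cw.
rewrite uE.
have -> : (((limn v +i* limn w) - (v n +i* w n)) : C)%C =
  ((limn v - v n) +i* 0 + 0 +i* (limn w - w n))%C by simpc.
apply: (le_lt_trans (ler_normD _ _)).
rewrite !normc_def /= !expr0n /= !addr0 !add0r !sqrtr_sqr ltcE /= addr0 eqxx /=.
lra.
Unshelve. all: by end_near. Qed.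


Lemma cvg_series_complex (t : nat -> C) (c r : R) :
  0 <= r -> r < 1 -> (forall n, `|t n| <= (c * r ^+ n)%:C%C) ->
  cvgn (series t : nat -> (C : numFieldType)).
Proof.
move=> r0 r1 tb.
have geo : cvgn (series (geometric c r)).
  by apply: is_cvg_geometric_series; rewrite ger0_norm.
have abs (f : nat -> R) : (forall n, `|f n| <= c * r ^+ n) -> cvgn (series f).
  move=> fb; apply: normed_cvg.
  apply: (@series_le_cvg _ (fun n => `|f n|) _ _ _ _ geo) => //= n.
  exact: (le_trans (normr_ge0 (f n)) (fb n)).
have tR n : `|complex.Re (t n)| <= c * r ^+ n.
  by rewrite -lecR; apply: le_trans (tb n); exact: normc_ge_Re.
have tI n : `|complex.Im (t n)| <= c * r ^+ n.
  rewrite -lecR; apply: le_trans (tb n).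
  case: (t n) => x y; rewrite normc_def lecR /= -sqrtr_sqr.
  by rewrite ler_wsqrtr // lerDr sqr_ge0.
apply: (@cvg_complex _ (series (fun n => complex.Re (t n)))
                       (series (fun n => complex.Im (t n)))).
- move=> n; rewrite /series /=.
  elim: n => [|n IH]; first by rewrite !big_geq.
  by rewrite !big_nat_recr //= IH; case: (t n) => x y; simpc.
- exact: abs.
- exact: abs.
Qed.

Lemma is_cvg_qfac q x : `|q| < 1 -> cvgn (qfac q x : nat -> (C : numFieldType)).
Proof.
move=> q1.
have [r [r0 r1 qE]] : exists r : R, [/\ 0 <= r, r < 1 & `|q| = r%:C%C].
  exists (Num.sqrt (complex.Re q ^+ 2 + complex.Im q ^+ 2)); split.
  - exact: sqrtr_ge0.
  - by move: q1; case: (q) => u v; rewrite normc_def -ltcR.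
  - by case: (q) => u v; rewrite normc_def.
have [s [s0 xE]] : exists s : R, 0 <= s /\ `|x| = s%:C%C.
  exists (Num.sqrt (complex.Re x ^+ 2 + complex.Im x ^+ 2)); split.
  - exact: sqrtr_ge0.
  - by case: (x) => u v; rewrite normc_def.
pose M := expR (s / (1 - r)).
have qb n : `|qfac q x n| <= M%:C%C.
  suff [_ h] : 0 <= \sum_(0 <= k < n) s * r ^+ k /\
     `|qfac q x n| <= (expR (\sum_(0 <= k < n) s * r ^+ k))%:C%C.
    apply: (le_trans h); rewrite lecR ler_expR.
    have r1' : 0 < 1 - r by rewrite subr_gt0.
    rewrite -mulr_sumr ler_wpM2l // -[leRHS]mul1r ler_pdivlMr //.
    have -> : (\sum_(0 <= k < n) r ^+ k) * (1 - r) = 1 - r ^+ n.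
      elim: n {h} => [|n IH]; first by rewrite big_geq // mul0r expr0 subrr.
      by rewrite big_nat_recr //= mulrDl IH exprS; ring.
    by rewrite lerBlDr lerDl exprn_ge0.
  split; first by apply: sumr_ge0 => k _; rewrite mulr_ge0 // exprn_ge0.
  rewrite /qfac; elim: n => [|n IH]; first by rewrite !big_geq // normr1 expR0.
  rewrite !big_nat_recr //= normrM expRD rmorphM /=.
  apply: ler_pM => //; apply: (le_trans (ler_normB _ _)).
  rewrite normr1 normrM normrX qE xE -rmorphXn -rmorphM /=.
  by rewrite -[1](rmorph1 (real_complex R)) -rmorphD lecR expR_ge1Dx.
pose t n := - (x * q ^+ n) * qfac q x n.
have qS : qfac q x = (fun n => 1 + series t n).
  apply/funext => n; rewrite /series /=.
  elim: n => [|n IH]; first by rewrite /qfac !big_geq // addr0.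
  by rewrite big_nat_recr //= addrA -IH {1}/qfac big_nat_recr //= /t /qfac; ring.
rewrite qS; apply: is_cvgD; first exact: is_cvg_cst.
apply: (@cvg_series_complex t (s * M) r) => // n.
rewrite /t normrM normrN normrM normrX qE xE.
have -> : s * M * r ^+ n = s * r ^+ n * M by ring.
rewrite !rmorphM rmorphXn /= ler_wpM2l //.
by rewrite mulr_ge0 ?exprn_ge0 // -?xE -?qE.
Qed.

Lemma qpochE q x (n : int) : q != 0 -> `|q| < 1 ->
  qinf q (x * q ^ n) != 0 -> qpoch q x n = qinf q x / qinf q (x * q ^ n).
Proof.
move=> q0 q1; case: n => n h /=.
  by rewrite (qinf_shift (@is_cvg_qfac q (x * q ^+ n) q1)) mulfK.
have e : x * q ^- n.+1 * q ^+ n.+1 = x by rewrite mulfVK ?expf_neq0.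
have := @qinf_shift _ q (x * q ^- n.+1) n.+1; rewrite e => E.
have {}E := E (@is_cvg_qfac q _ q1).
have h' : qinf q (x * q ^- n.+1) != 0 by exact: h.
change (x * q ^ Negz n) with (x * q ^- n.+1).
move: h'; rewrite E mulf_eq0 negb_or => /andP[h1 h2].
by rewrite invfM mulrCA mulfV // mulr1.
Qed.

End Convergence.

(* Main.v *)
Require Import Defs.
From mathcomp Require Import all_boot all_order all_algebra.
From mathcomp Require Import complex.
From mathcomp Require Import all_classical all_reals all_analysis.
From mathcomp Require Import ring lra.
Import Order.TTheory GRing.Theory Num.Theory.
Import numFieldNormedType.Exports.
Local Open Scope ring_scope.

(** Fix [a], [z], [d], [e] and move [(b, c)] along [(b q^N, c q^-N)].  The factors
    [(1 - x q^n) (1 - a q^n / x)] for [x = b, c, z] are linearly dependent, so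
    contiguous values of the 8psi8 differ by a 6psi6, which Bailey's formula sums;
    the balanced 8W7 obeys the same contiguous relation by telescoping (its
    boundary term at infinity is that 6psi6), and the last product obeys the
    homogeneous one.  Hence the difference of the two sides is multiplied at each
    step by an explicit rational factor, and it vanishes as soon as its limit for
    [N -> oo] does.  In the limit the 8psi8 becomes a 6psi6, the 8W7 a 6phi5, and
    what is left is Weierstrass' three-term theta relation.  The limit needs
    [|a q / (d e)| < 1]; otherwise exchange [(b, c)] and [(d, e)], because
    [(a q / (b c)) (a q / (d e)) = a q / z].  All this requires generic parameters;
    the general case follows by continuity.

    Bailey's 6psi6 sum satisfies a first-order recurrence under [b -> b / q].  Letting
    the four parameters tend to infinity one after the other determines it up to a
    factor depending on [a] only, which is read off at [b = a], [c = 1], where a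
    single term survives.  Weierstrass' relation is Bailey's sum with parameters
    [w, A/w, s, A/s]. *)

Set Implicit Arguments.
Unset Strict Implicit.
Unset Printing Implicit Defensive.

(** * Dominated convergence of series *)

Section Tannery.
Local Open Scope classical_set_scope.
Variable R : realType.
Local Notation C := (R[i]).
Implicit Types (x y : C) (r s : R).

(** A bilateral series is handled as two unilateral ones: reversing the sign of n turns the half
    over n < 0 into a very-well-poised series at base 1/a with each parameter x replaced by x/a.
    Every bilateral relation is a unilateral relation used at both bases, the contributions of n = 0
    cancelling. The contiguous step starts from a point with b c d e = a z, off the balanced surface
    by one factor q: its two neighbours (b q, c) and (b, c q) are balanced, and the 6psi6 at the
    starting point has the same argument a q/z. Two obstacles shape the limits. Along (b q^N, c
    q^-N) single products such as (c q^-N/z;q)_oo diverge, so factors are grouped into quotients in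
    which the growth cancels. And Bailey's sum needs parameters at infinity, so its series is
    written in the reciprocals of the parameters, where infinity is 0. Generic parameters close to
    given ones are found by multiplying with powers of a real t > 1: the moduli then avoid the
    powers of |q|, for a choice of exponents compatible with b c d e = a q z. *)

Definition cabs x : R := complex.Re `|x|.

Lemma cabsE x : `|x| = (cabs x)%:C%C.
Proof. by rewrite /cabs normc_def. Qed.

Lemma cabs_ge0 x : 0 <= cabs x.
Proof. by rewrite -lecR -cabsE normr_ge0. Qed.

Lemma cabsM x y : cabs (x * y) = cabs x * cabs y.
Proof. by apply: (@complexI R); rewrite rmorphM /= -!cabsE normrM. Qed.

Lemma cabs0 : cabs 0 = 0.
Proof. by apply: (@complexI R); rewrite -cabsE normr0. Qed.

Lemma cabs1 : cabs 1 = 1.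
Proof. by apply: (@complexI R); rewrite -cabsE normr1. Qed.

Lemma cabsX x n : cabs (x ^+ n) = cabs x ^+ n.
Proof. by apply: (@complexI R); rewrite rmorphXn /= -!cabsE normrX. Qed.

Lemma cabsV x : cabs x^-1 = (cabs x)^-1.
Proof. by apply: (@complexI R); rewrite fmorphV /= -!cabsE normfV. Qed.

Lemma cabsN x : cabs (- x) = cabs x.
Proof. by apply: (@complexI R); rewrite -!cabsE normrN. Qed.

Lemma cabsD x y : cabs (x + y) <= cabs x + cabs y.
Proof. by rewrite -lecR rmorphD /= -!cabsE ler_normD. Qed.

Lemma cabsB x y : cabs (x - y) <= cabs x + cabs y.
Proof. by rewrite -(cabsN y) cabsD. Qed.

Lemma cabs_eq0 x : (cabs x == 0) = (x == 0).
Proof.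
rewrite -(normr_eq0 x) cabsE; apply/eqP/eqP => [->//|].
by move=> /(@complexI R).
Qed.

Lemma cabs_gt0 x : (0 < cabs x) = (x != 0).
Proof. by rewrite lt_def cabs_ge0 andbT cabs_eq0. Qed.

Lemma cabs_lt x r : (`|x| < r%:C%C) = (cabs x < r).
Proof. by rewrite cabsE ltcR. Qed.

Lemma cvg_cabsP (u : nat -> C) (l : C) :
  (u : nat -> (C : numFieldType)) @ \oo --> (l : (C : numFieldType)) <->
  (forall e : R, 0 < e -> \forall m \near \oo, cabs (l - u m) < e).
Proof.
split=> [/cvgrPdist_lt h e e0|h].
  have e0' : 0 < e%:C%C by rewrite ltcR.
  by apply: filterS (h _ e0') => m; rewrite cabs_lt.
apply/cvgrPdist_lt => -[e e']; rewrite ltcE /= => /andP[/eqP -> e0].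
by apply: filterS (h _ e0) => m; rewrite -ltcR -cabsE.
Qed.

(* Wrapped in a Variant to shield the unifier from the topology of R[i]. *)
Variant tends (u : nat -> C) (l : C) : Prop := Tends of
  (u : nat -> (C : numFieldType)) @ \oo --> (l : (C : numFieldType)).

Lemma tends_lim u l : tends u l -> limn (u : nat -> (C : numFieldType)) = l.
Proof. by move=> [h]; apply: cvg_lim => //; exact: norm_hausdorff. Qed.

Lemma tendsP u l : tends u l <->
  (forall e : R, 0 < e -> \forall m \near \oo, cabs (l - u m) < e).
Proof. by split=> [[/cvg_cabsP]//|h]; constructor; apply/cvg_cabsP. Qed.

Lemma tends_unique u l l' : tends u l -> tends u l' -> l = l'.
Proof. by move=> h h'; rewrite -(tends_lim h) -(tends_lim h'). Qed.

Lemma eq_tends u v l : tends u l -> u =1 v -> tends v l.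
Proof. by move=> + /funext <-. Qed.

Lemma tends_cst l : tends (fun=> l) l.
Proof. by apply/tendsP => e e0; exists 0%N => // m _ /=; rewrite subrr cabs0. Qed.

Lemma tendsD u v l l' : tends u l -> tends v l' -> tends (fun m => u m + v m) (l + l').
Proof. by move=> [h] [h']; constructor; exact: cvgD h h'. Qed.

Lemma tendsN u l : tends u l -> tends (fun m => - u m) (- l).
Proof. by move=> [h]; constructor; exact: cvgN h. Qed.

Lemma tendsM u v l l' : tends u l -> tends v l' -> tends (fun m => u m * v m) (l * l').
Proof. by move=> [h] [h']; constructor; exact: cvgM h h'. Qed.

Lemma tendsV u l : l != 0 -> tends u l -> tends (fun m => (u m)^-1) l^-1.
Proof. by move=> l0 [h]; constructor; exact: cvgV. Qed.

Lemma tendsX u l n : tends u l -> tends (fun m => u m ^+ n) (l ^+ n).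
Proof.
move=> h; elim: n => [|n IH]; first exact: tends_cst.
by rewrite exprS; apply: eq_tends (tendsM h IH) _ => m; rewrite exprS.
Qed.

Lemma tendsB u v l l' : tends u l -> tends v l' -> tends (fun m => u m - v m) (l - l').
Proof. by move=> h h'; apply: tendsD h (tendsN h'). Qed.

Lemma tends_prod (I : Type) (s : seq I) (u : I -> nat -> C) (l : I -> C) :
  (forall i, tends (u i) (l i)) ->
  tends (fun m => \prod_(i <- s) u i m) (\prod_(i <- s) l i).
Proof.
move=> h; elim: s => [|i s IH].
  by rewrite big_nil; apply: eq_tends (tends_cst _) _ => m; rewrite big_nil.
rewrite big_cons; apply: eq_tends (tendsM (h i) IH) _ => m.
by rewrite big_cons.
Qed.

Lemma tends_shift u l : tends (fun n => u n.+1) l <-> tends u l.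
Proof.
by split=> -[h]; constructor; [rewrite -cvg_shiftS|rewrite cvg_shiftS].
Qed.

Lemma cvg_cabs_le (u : nat -> C) (l : C) r :
  tends u l -> (\forall m \near \oo, cabs (u m) <= r) -> cabs l <= r.
Proof.
move=> /tendsP ul ur; rewrite leNgt; apply/negP => rl.
have e0 : 0 < cabs l - r by rewrite subr_gt0.
near \oo => m.
have h1 : cabs (l - u m) < cabs l - r by near: m; exact: ul.
have h2 : cabs (u m) <= r by near: m; exact: ur.
have := cabsD (l - u m) (u m); rewrite subrK => h3.
lra.
Unshelve. all: by end_near. Qed.

Lemma cabs_sum (f : nat -> C) m n :
  cabs (\sum_(m <= i < n) f i) <= \sum_(m <= i < n) cabs (f i).
Proof.
elim/big_ind2 : _ => //; first by rewrite cabs0.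
by move=> x a y b h1 h2; apply: (le_trans (cabsD _ _)); apply: lerD.
Qed.

Lemma geometric_tail_le (r K : R) m n : 0 <= r < 1 -> 0 <= K ->
  \sum_(m <= i < n) K * r ^+ i <= K * r ^+ m / (1 - r).
Proof.
move=> /andP[r0 r1] K0; have r1' : 0 < 1 - r by rewrite subr_gt0.
have [nm|mn] := leqP n m.
  by rewrite big_geq // divr_ge0 ?mulr_ge0 ?exprn_ge0 // ltW.
rewrite -(subnKC (ltnW mn)); elim: (n - m)%N => [|k IH].
  by rewrite addn0 big_geq // divr_ge0 ?mulr_ge0 ?exprn_ge0 // ltW.
rewrite -mulr_sumr ler_pdivlMr // -mulrA ler_wpM2l //.
suff -> : (\sum_(m <= i < m + k.+1) r ^+ i) * (1 - r) = r ^+ m - r ^+ (m + k.+1).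
  by rewrite lerBlDr lerDl exprn_ge0.
elim: (k.+1) => [|j IHj]; first by rewrite addn0 big_geq // mul0r subrr.
by rewrite addnS big_nat_recr ?leq_addr //= mulrDl IHj exprS; ring.
Qed.

Lemma geometric_small (r e : R) : 0 <= r < 1 -> 0 < e ->
  \forall n \near \oo, r ^+ n < e.
Proof.
move=> /andP[r0 r1] e0.
have h : (fun n => r ^+ n) @ \oo --> (0 : R).
  by apply: cvg_expr; rewrite ger0_norm.
move/cvgrPdist_lt : h => /(_ _ e0); apply: filterS => n.
by rewrite sub0r normrN ger0_norm ?exprn_ge0.
Qed.

Definition dominated r (g : nat -> C) :=
  exists K : R, 0 <= K /\ forall n, cabs (g n) <= K * r ^+ n.

Lemma dominated_cvg_series r g : 0 <= r < 1 -> dominated r g ->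
  cvgn (series g : nat -> (C : numFieldType)).
Proof.
move=> /andP[r0 r1] [K [K0 h]]; apply: (@cvg_series_complex R g K r) => // n.
by rewrite cabsE lecR.
Qed.

Lemma dominated_cvg0 r g : 0 <= r < 1 -> dominated r g ->
  tends g 0.
Proof.
move=> r01 [K [K0 h]]; apply/tendsP => e e0.
have eK : 0 < e / (K + 1) by rewrite divr_gt0 // ltr_wpDl.
apply: filterS (geometric_small r01 eK) => n hn.
rewrite sub0r cabsN; apply: le_lt_trans (h n) _.
have K1 : 0 < K + 1 by rewrite ltr_wpDl.
rewrite ltr_pdivlMr // in hn; apply: le_lt_trans hn.
have/andP[r0 _] := r01.
by rewrite mulrC ler_wpM2l ?exprn_ge0 // lerDl.
Qed.

Lemma series_tail (r K : R) (g : nat -> C) k : 0 <= r < 1 -> 0 <= K ->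
  (forall n, cabs (g n) <= K * r ^+ n) ->
  cabs (limn (series g : nat -> (C : numFieldType)) - series g k)
    <= K * r ^+ k / (1 - r).
Proof.
move=> r01 K0 h.
have cg : cvgn (series g : nat -> (C : numFieldType)).
  by apply: (dominated_cvg_series r01); exists K.
have cB := cvgB cg (cvg_cst (series g k : (C : numFieldType))).
apply: (cvg_cabs_le (Tends (cB _ _))).
exists k => //= n /= kn.
have -> : (series g - (fun=> series g k)) n = \sum_(k <= i < n) g i.
  by rewrite -(sub_series_geq g kn).
apply: le_trans (cabs_sum _ _ _) _.
apply: le_trans (geometric_tail_le k n r01 K0).
by apply: ler_sum => i _.
Qed.

(** The hypotheses of Tannery's theorem: a geometric majorant uniform in large m, and termwise
    convergence. The ratio r may be 1 or more, because factors are estimated separately and their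
    ratios multiply in [tameM]; only the final ratio must be below 1. *)
Definition tame r (f : nat -> nat -> C) (g : nat -> C) :=
  (exists K : R, 0 <= K /\ \forall m \near \oo, forall n, cabs (f m n) <= K * r ^+ n)
  /\ forall n, tends (f ^~ n) (g n).

Lemma tame_dominated r f g : tame r f g -> dominated r g.
Proof.
move=> [[K [K0 h]] c]; exists K; split=> // n.
by apply: cvg_cabs_le (c n) _; apply: filterS h => m; exact.
Qed.

Lemma tame_cst r g : dominated r g -> tame r (fun _ => g) g.
Proof.
move=> [K [K0 h]]; split; first by exists K; split=> //; near=> m.
by move=> n; exact: tends_cst.
Unshelve. all: by end_near. Qed.

Lemma tameM r s f f' g g' : 0 <= r -> 0 <= s -> tame r f g -> tame s f' g' ->
  tame (r * s) (fun m n => f m n * f' m n) (fun n => g n * g' n).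
Proof.
move=> r0 s0 [[K [K0 h]] c] [[K' [K0' h']] c']; split; last first.
  by move=> n; exact: tendsM (c n) (c' n).
exists (K * K'); split; first exact: mulr_ge0.
near=> m => n; rewrite cabsM exprMn mulrACA ler_pM ?cabs_ge0 //.
- by move: n; near: m.
- by move: n; near: m.
Unshelve. all: by end_near. Qed.

Lemma tame_ext r f g f' g' : (forall m n, f m n = f' m n) ->
  (forall n, g n = g' n) -> tame r f g -> tame r f' g'.
Proof.
move=> ff gg; have -> : f' = f by apply/funext => m; apply/funext => n; rewrite ff.
by have -> : g' = g by apply/funext => n; rewrite gg.
Qed.

(** Tannery's theorem. Both tails beyond k are at most K r^k/(1 - r) <= e/3, uniformly in large m;
    with k fixed, the k-th partial sums converge. *)
Lemma tame_series r f g : 0 <= r < 1 -> tame r f g ->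
  tends (fun m => limn (series (f m) : nat -> (C : numFieldType)))
    (limn (series g : nat -> (C : numFieldType))).
Proof.
move=> r01 [[K [K0 h]] c].
have hg n : cabs (g n) <= K * r ^+ n.
  by apply: cvg_cabs_le (c n) _; apply: filterS h => m; exact.
have /andP[r0 r1] := r01; have r1' : 0 < 1 - r by rewrite subr_gt0.
apply/tendsP => e e0.
have e3 : 0 < e / 3 * (1 - r) / (K + 1).
  by rewrite !(divr_gt0, mulr_gt0) // ltr_wpDl.
near \oo => k.
have hk : K * r ^+ k / (1 - r) <= e / 3.
  rewrite ler_pdivrMr //.
  have : r ^+ k < e / 3 * (1 - r) / (K + 1) by near: k; exact: geometric_small.
  rewrite ltr_pdivlMr ?ltr_wpDl // => /ltW; apply: le_trans.
  by rewrite mulrC ler_wpM2l ?exprn_ge0 // lerDl.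
have ck j : tends (fun m => series (f m) j) (series g j).
  rewrite /series /=; elim: j => [|j IH].
    rewrite big_geq //; apply: eq_tends (tends_cst _) _ => m.
    by rewrite big_geq.
  rewrite big_nat_recr //=; apply: eq_tends (tendsD IH (c j)) _ => m.
  by rewrite big_nat_recr.
move: (ck k) => /tendsP/(_ (e / 3)) {}ck.
near=> m.
have h1 : cabs (series g k - series (f m) k) < e / 3.
  by near: m; apply: ck; rewrite divr_gt0.
have hm : forall n, cabs (f m n) <= K * r ^+ n by near: m.
have h2 := series_tail k r01 K0 hg.
have h3 := series_tail k r01 K0 hm.
set a := limn _; set b := limn _.
have -> : a - b = (a - series g k) + (series g k - series (f m) k)
                  - (b - series (f m) k) by ring.
apply: le_lt_trans (cabsB _ _) _.
have := cabsD (a - series g k) (series g k - series (f m) k).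
rewrite -/a -/b in h2 h3; lra.
Unshelve. all: by end_near. Qed.

End Tannery.

(** * The q-Pochhammer symbol *)

Section QFactorial.
Local Open Scope classical_set_scope.
Variables (R : realType) (q : R[i]).
Hypothesis q01 : 0 < `|q| < 1.
Local Notation C := (R[i]).
Implicit Types (x y : C).

Lemma base_neq0 : q != 0.
Proof. by have /andP[] := q01; rewrite normr_gt0. Qed.

Lemma base_norm_lt1 : `|q| < 1.
Proof. by have /andP[] := q01. Qed.

Lemma base_cabs : 0 < cabs q < 1.
Proof. by have := q01; rewrite cabsE !ltcR. Qed.

Lemma base_cabs01 : 0 <= cabs q < 1.
Proof. by have /andP[h ->] := base_cabs; rewrite ltW. Qed.

Lemma qfac0 x : qfac q x 0 = 1.
Proof. by rewrite /qfac big_geq. Qed.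

Lemma qfacS x n : qfac q x n.+1 = qfac q x n * (1 - x * q ^+ n).
Proof. by rewrite /qfac big_nat_recr. Qed.

Lemma qfacSl x n : qfac q x n.+1 = (1 - x) * qfac q (x * q) n.
Proof.
by rewrite -add1n qfacD expr1 {1}/qfac big_nat1 expr0 mulr1.
Qed.

Lemma sum_geometric_le (B : R) n : 0 <= B ->
  \sum_(0 <= k < n) B * cabs q ^+ k <= B / (1 - cabs q).
Proof.
move=> B0; have := geometric_tail_le 0 n base_cabs01 B0.
by rewrite expr0 mulr1.
Qed.

Lemma prod_geometric_le (B : R) n : 0 <= B ->
  \prod_(0 <= k < n) (1 + B * cabs q ^+ k) <= expR (B / (1 - cabs q)).
Proof.
move=> B0; apply: le_trans (_ : expR (\sum_(0 <= k < n) B * cabs q ^+ k) <= _).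
  rewrite expR_sum; apply: ler_prod => k _.
  by rewrite expR_ge1Dx addr_ge0 // mulr_ge0 // exprn_ge0 // cabs_ge0.
by rewrite ler_expR sum_geometric_le.
Qed.

Lemma cabs_prod (f : nat -> C) n :
  cabs (\prod_(0 <= k < n) f k) = \prod_(0 <= k < n) cabs (f k).
Proof. by elim/big_ind2 : _ => [|x a y b <- <-|//]; rewrite ?cabs1 ?cabsM. Qed.

Lemma qfac_le (B : R) x n : cabs x <= B ->
  cabs (qfac q x n) <= expR (B / (1 - cabs q)).
Proof.
move=> xB; have B0 : 0 <= B := le_trans (cabs_ge0 _) xB.
apply: le_trans (prod_geometric_le n B0).
rewrite /qfac cabs_prod; apply: ler_prod => k _; rewrite cabs_ge0 /=.
apply: le_trans (cabsB _ _) _; rewrite cabs1 lerD2l cabsM cabsX.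
by rewrite ler_wpM2r // exprn_ge0 // cabs_ge0.
Qed.

(** Weierstrass' product inequality: the modulus of the product is at least 1 minus the sum of the B
    |q|^k, and that sum is at most B/(1 - |q|). *)
Lemma qfac_ge_half (B : R) x n : cabs x <= B -> B / (1 - cabs q) <= 2^-1 ->
  2^-1 <= cabs (qfac q x n).
Proof.
move=> xB Bq; have B0 : 0 <= B := le_trans (cabs_ge0 _) xB.
suff h : 1 - \sum_(0 <= k < n) B * cabs q ^+ k <= cabs (qfac q x n).
  by apply: le_trans h; have := sum_geometric_le n B0; lra.
elim: n => [|n IH]; first by rewrite big_geq // qfac0 cabs1 subr0.
rewrite qfacS cabsM big_nat_recr //=.
set S := \sum_(_ <= _ < _) _ in IH *.
have S0 : 0 <= S.
  by apply: sumr_ge0 => k _; rewrite mulr_ge0 // exprn_ge0 // cabs_ge0.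
have := sum_geometric_le n.+1 B0; rewrite big_nat_recr //= -/S.
set t := B * cabs q ^+ n => St.
have t0 : 0 <= t by rewrite mulr_ge0 // exprn_ge0 // cabs_ge0.
have h : 1 - t <= cabs (1 - x * q ^+ n).
  have := cabsD (1 - x * q ^+ n) (x * q ^+ n); rewrite subrK cabs1.
  have : cabs (x * q ^+ n) <= t.
    by rewrite cabsM cabsX ler_wpM2r // exprn_ge0 // cabs_ge0.
  lra.
apply: le_trans (_ : (1 - S) * (1 - t) <= _); last by apply: ler_pM => //; lra.
have : 0 <= S * t by exact: mulr_ge0.
lra.
Qed.

Lemma tends_bounded (u : nat -> C) l : tends u l ->
  \forall m \near \oo, cabs (u m) <= cabs l + 1.
Proof.
move=> /tendsP /(_ _ ltr01); apply: filterS => m h.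
have := cabsB l (l - u m); have -> : l - (l - u m) = u m by ring.
lra.
Qed.

Lemma tends_qfac (u : nat -> C) x n : tends u x ->
  tends (fun m => qfac q (u m) n) (qfac q x n).
Proof.
move=> h; apply: (@tends_prod R nat _ (fun k m => 1 - u m * q ^+ k)
  (fun k => 1 - x * q ^+ k)) => k.
exact: tendsB (tends_cst _) (tendsM h (tends_cst _)).
Qed.

(** Beyond an index M the tail is a q-factorial at a parameter of modulus at most B |q|^M, small
    enough for [qfac_ge_half]; the first M factors converge to a nonzero product. For n <= M, the
    lower bound for M factors is divided by an upper bound for the surplus ones. *)
Lemma qfac_ge (u : nat -> C) x : tends u x -> (forall n, qfac q x n != 0) ->
  exists k : R, 0 < k /\
    \forall m \near \oo, forall n, k <= cabs (qfac q (u m) n).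
Proof.
move=> ux x0.
have [q0 q1] := andP base_cabs.
have q1' : 0 < 1 - cabs q by rewrite subr_gt0.
pose B := cabs x + 1; have B0 : 0 < B by rewrite ltr_wpDl // cabs_ge0.
near \oo => M.
have BM : B * cabs q ^+ M / (1 - cabs q) <= 2^-1.
  rewrite ler_pdivrMr //.
  have : cabs q ^+ M < 2^-1 * (1 - cabs q) / B.
    near: M; apply: geometric_small; first exact: base_cabs01.
    by rewrite divr_gt0 // mulr_gt0 // invr_gt0.
  by rewrite ltr_pdivlMr // mulrC => /ltW.
pose K := expR (B / (1 - cabs q)); have K0 : 0 < K by exact: expR_gt0.
pose k := cabs (qfac q x M) / 2.
have k0 : 0 < k by rewrite divr_gt0 // cabs_gt0.
exists (Num.min (k / K) (k / 2)); split.
  by rewrite lt_min; apply/andP; split; apply: divr_gt0.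
near=> m.
have um : cabs (u m) <= B by near: m; exact: tends_bounded.
have hk : k <= cabs (qfac q (u m) M).
  have : cabs (qfac q x M - qfac q (u m) M) < k.
    by near: m; move/tendsP : (tends_qfac M ux); apply.
  have := cabsD (qfac q x M - qfac q (u m) M) (qfac q (u m) M).
  by rewrite subrK /k; lra.
move=> n; rewrite ge_min; have [nM|Mn] := leqP n M.
  apply/orP; left; rewrite ler_pdivrMr //; apply: le_trans hk _.
  rewrite -(subnKC nM) qfacD cabsM; rewrite ler_wpM2l ?cabs_ge0 // qfac_le //.
  rewrite cabsM cabsX; apply: le_trans um; rewrite ler_piMr ?cabs_ge0 //.
  by rewrite exprn_ile1 // ltW.
apply/orP; right; rewrite -(subnKC (ltnW Mn)) qfacD cabsM.
apply: ler_pM => //; [exact: ltW|].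
apply: (@qfac_ge_half (B * cabs q ^+ M)) => //.
by rewrite cabsM cabsX ler_wpM2r // exprn_ge0 // ltW.
Unshelve. all: by end_near. Qed.

Lemma tends_qfac_qinf x : tends (qfac q x) (qinf q x).
Proof. by constructor; exact: is_cvg_qfac base_norm_lt1. Qed.

Lemma qinfE x n : qinf q x = qfac q x n * qinf q (x * q ^+ n).
Proof. by apply: qinf_shift; exact: is_cvg_qfac base_norm_lt1. Qed.

Lemma qinfS x : qinf q x = (1 - x) * qinf q (x * q).
Proof. by rewrite (qinfE x 1) qfacS qfac0 expr0 expr1 mulr1 mul1r. Qed.

(** Partial products without a zero factor could still tend to 0; [qfac_ge] at a constant sequence
    excludes this. *)
Lemma qinf_neq0P x : qinf q x != 0 <-> forall n, qfac q x n != 0.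
Proof.
split=> [h n|h].
  by apply: contraNneq h => h; rewrite (qinfE x n) h mul0r.
have [k [k0 [m _ hk]]] := qfac_ge (tends_cst x) h.
apply/eqP => x0; have := tends_qfac_qinf x; rewrite x0 => /tendsP/(_ _ k0)[n _ hn].
have := hn n (leqnn n); rewrite sub0r cabsN.
by have := hk m (leqnn m) n; lra.
Qed.

Lemma qinf_neq0 x : cabs x < 1 -> qinf q x != 0.
Proof.
move=> x1; apply/qinf_neq0P => n; rewrite /qfac prodf_seq_neq0; apply/allP => k _ /=.
rewrite subr_eq0; apply/eqP => h; suff : cabs (x * q ^+ k) < 1.
  by rewrite -h cabs1 ltxx.
have [q0 q1] := andP base_cabs.
rewrite cabsM cabsX; apply: le_lt_trans x1.
by rewrite ler_piMr ?cabs_ge0 // exprn_ile1 // ltW.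
Qed.

Lemma qinf_q_neq0 : qinf q q != 0.
Proof. by apply: qinf_neq0; have /andP[] := base_cabs. Qed.

Lemma qinf0 : qinf q 0 = 1.
Proof.
apply: tends_unique (tends_qfac_qinf 0) _; apply: eq_tends (tends_cst 1) _ => n.
by rewrite /qfac big1 // => k _; rewrite mul0r subr0.
Qed.

Lemma tame_qfac u x : tends u x ->
  tame 1 (fun m n => qfac q (u m) n) (qfac q x).
Proof.
move=> h; split=> [|n]; last exact: tends_qfac.
exists (expR ((cabs x + 1) / (1 - cabs q))); split; first exact: expR_ge0.
apply: filterS (tends_bounded h) => m hm n.
by rewrite expr1n mulr1 qfac_le.
Qed.

Lemma tame_qfacV u x : tends u x -> (forall n, qfac q x n != 0) ->
  tame 1 (fun m n => (qfac q (u m) n)^-1) (fun n => (qfac q x n)^-1).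
Proof.
move=> h x0; split=> [|n]; last by apply: tendsV; [exact: x0|exact: tends_qfac].
have [k [k0 hk]] := qfac_ge h x0.
exists k^-1; split; first by rewrite invr_ge0 ltW.
apply: filterS hk => m hm n; rewrite expr1n mulr1 cabsV.
by rewrite lef_pV2 // posrE // (lt_le_trans k0).
Qed.

Lemma tame_expr (u : nat -> C) z (r : R) : tends u z -> cabs z < r ->
  tame r (fun m n => u m ^+ n) (fun n => z ^+ n).
Proof.
move=> h zr; split=> [|n]; last exact: tendsX.
exists 1; split; first exact: ler01.
have e0 : 0 < r - cabs z by rewrite subr_gt0.
move/tendsP : h => /(_ _ e0); apply: filterS => m hm n.
rewrite mul1r cabsX lerXn2r ?nnegrE ?cabs_ge0 //.
  by rewrite (le_trans (cabs_ge0 z)) // ltW.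
have := cabsB z (z - u m); have -> : z - (z - u m) = u m by ring.
lra.
Qed.

(** The differences (y;q)_(n+1) - (y;q)_n = - y q^n (y;q)_n turn the infinite product into a series
    with a geometric majorant locally uniform in y, to which Tannery's theorem applies. *)
Lemma tends_qinf u x : tends u x -> tends (fun m => qinf q (u m)) (qinf q x).
Proof.
move=> h; pose t y n : C := - (y * q ^+ n) * qfac q y n.
have qS y : qinf q y = 1 + limn (series (t y) : nat -> (C : numFieldType)).
  apply: tends_unique (tends_qfac_qinf y) _.
  have dt : dominated (cabs q) (t y).
    exists (cabs y * expR (cabs y / (1 - cabs q))).
    split; first by rewrite mulr_ge0 ?cabs_ge0 ?expR_ge0.
    move=> n; rewrite /t cabsM cabsN cabsM cabsX [leRHS]mulrAC ler_wpM2l ?qfac_le //.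
    by rewrite mulr_ge0 ?cabs_ge0 // exprn_ge0 ?cabs_ge0.
  have st := Tends (dominated_cvg_series base_cabs01 dt).
  apply: eq_tends (tendsD (tends_cst 1) st) _ => n.
  rewrite /series /=; elim: n => [|n IH]; first by rewrite big_geq // qfac0 addr0.
  by rewrite big_nat_recr //= addrA IH qfacS /t; ring.
rewrite qS; apply: eq_tends (tendsD (tends_cst 1) _) _ => [|m]; last exact: esym (qS _).
apply: (tame_series base_cabs01).
split=> [|n]; last first.
  apply: tendsM (tends_qfac n h); apply: tendsN.
  exact: tendsM h (tends_cst _).
exists ((cabs x + 1) * expR ((cabs x + 1) / (1 - cabs q))).
have x1 : 0 <= cabs x + 1 by rewrite addr_ge0 ?cabs_ge0.
split; first by rewrite mulr_ge0 ?expR_ge0.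
apply: filterS (tends_bounded h) => m hm n.
rewrite /t cabsM cabsN cabsM cabsX [leRHS]mulrAC ler_pM ?cabs_ge0 ?qfac_le //.
  by rewrite mulr_ge0 ?cabs_ge0 // exprn_ge0 ?cabs_ge0.
by rewrite ler_wpM2r // exprn_ge0 ?cabs_ge0.
Qed.

Lemma tends_expr0 : tends (fun n => q ^+ n) 0.
Proof.
apply: (dominated_cvg0 base_cabs01); exists 1; split=> // n.
by rewrite mul1r cabsX.
Qed.

Lemma tame_vwp u a : tends u a ->
  tame 1 (fun m n => 1 - u m * q ^+ (2 * n)) (fun n => 1 - a * q ^+ (2 * n)).
Proof.
move=> h; split=> [|n]; last first.
  exact: tendsB (tends_cst _) (tendsM h (tends_cst _)).
have [q0 q1] := andP base_cabs.
exists (1 + (cabs a + 1)); split; first by rewrite !addr_ge0 ?cabs_ge0.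
apply: filterS (tends_bounded h) => m hm n.
rewrite expr1n mulr1; apply: le_trans (cabsB _ _) _.
rewrite cabs1 lerD2l; apply: le_trans hm.
rewrite cabsM cabsX ler_piMr ?cabs_ge0 // exprn_ile1 // ltW //.
Qed.

End QFactorial.

(** * Bailey's 6psi6 sum *)

Section Bailey.
Local Open Scope classical_set_scope.
Variables (R : realType) (q : R[i]).
Hypothesis q01 : 0 < `|q| < 1.
Local Notation C := (R[i]).
Implicit Types (x y A Z : C).

Definition csum (f : nat -> C) : C := limn (series f : nat -> (C : numFieldType)).

Lemma tends_csum (r : R) f : 0 <= r < 1 -> dominated r f ->
  tends (series f) (csum f).
Proof. by move=> r01 h; constructor; exact: dominated_cvg_series r01 h. Qed.

Lemma eq_csum (f g : nat -> C) : f =1 g -> csum f = csum g.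
Proof. by move=> /funext ->. Qed.

Lemma csum_tends (f : nat -> C) l : tends (series f) l -> csum f = l.
Proof. exact: tends_lim. Qed.

Lemma tends_seriesD (f g : nat -> C) k l :
  tends (series f) k -> tends (series g) l -> tends (series (fun n => f n + g n)) (k + l).
Proof.
move=> h h'; apply: eq_tends (tendsD h h') _ => n.
by rewrite /series /= big_split.
Qed.

Lemma tends_seriesZ x (f : nat -> C) k :
  tends (series f) k -> tends (series (fun n => x * f n)) (x * k).
Proof.
move=> h; apply: eq_tends (tendsM (tends_cst x) h) _ => n.
by rewrite /series /= mulr_sumr.
Qed.

Lemma tends_telescope (G : nat -> C) l : tends G l ->
  tends (series (fun n => G n.+1 - G n)) (l - G 0%N).
Proof.
move=> h; apply: eq_tends (tendsB h (tends_cst (G 0%N))) _ => n.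
by rewrite /series /= telescope_sumr.
Qed.

Lemma eq_tends_series (f g : nat -> C) l : tends (series f) l -> f =1 g ->
  tends (series g) l.
Proof. by move=> h /funext <-. Qed.

(* (1/beta;q)_n beta^n / (A beta q;q)_n, in the form that makes sense at beta = 0. *)
Definition tau A (beta : C) n : C :=
  (\prod_(0 <= j < n) (beta - q ^+ j)) / qfac q (A * beta * q) n.

Lemma tau0 A beta : tau A beta 0 = 1.
Proof. by rewrite /tau big_geq // qfac0 invr1 mulr1. Qed.

Lemma tauS A beta n : tau A beta n.+1 =
  tau A beta n * (beta - q ^+ n) / (1 - A * beta * q ^+ n.+1).
Proof.
rewrite /tau big_nat_recr //= qfacS invfM -[A * beta * q * q ^+ n]mulrA -exprS.
by ring.
Qed.

(** Passing from beta to q beta changes numerator and denominator by their end factors only.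
    Induction on n avoids a division by beta, which may be 0. *)
Lemma tau_shift A beta n : (forall n, qfac q (A * beta * q) n != 0) ->
  q * beta != 1 -> 
  tau A beta n * q ^+ n = tau A (q * beta) n * ((q ^+ n - q * beta) *
    (1 - A * (q * beta) * q ^+ n)) / ((1 - q * beta) * (1 - A * (q * beta))).
Proof.
move=> h hb.
have b1 : 1 - q * beta != 0 by rewrite subr_eq0 eq_sym.
have b3 k : 1 - A * (q * beta) * q ^+ k != 0.
  have := h k.+1; rewrite qfacS mulf_eq0 negb_or => /andP[_].
  by rewrite -[A * beta * q]mulrA (mulrC beta).
have b2 : 1 - A * (q * beta) != 0 by have := b3 0%N; rewrite expr0 mulr1.
elim: n => [|n IH]; first by rewrite !tau0 !expr0 !mulr1; field; rewrite b1 b2.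
rewrite !tauS.
have q0 := base_neq0 q01.
have -> : tau A beta n * (beta - q ^+ n) / (1 - A * beta * q ^+ n.+1) * q ^+ n.+1
  = tau A beta n * q ^+ n * (q * (beta - q ^+ n) / (1 - A * beta * q ^+ n.+1)).
  by rewrite exprS; ring.
rewrite IH.
have e : A * beta * q ^+ n.+1 = A * (q * beta) * q ^+ n by rewrite exprS; ring.
rewrite e; have := b3 n; have := b3 n.+1; rewrite exprS => h1 h2.
by field; rewrite b1 b2 h2 h1.
Qed.

(** Once |u m| <= r, each factor is at most r (1 + |q|^j/r), so the product grows at most like r^n,
    for any r > |beta|. This includes beta = 0, a parameter at infinity. *)
Lemma tame_tau (a u : nat -> C) A beta (r : R) : tends a A -> tends u beta ->
  cabs beta < r -> (forall n, qfac q (A * beta * q) n != 0) ->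
  tame r (fun m n => tau (a m) (u m) n) (tau A beta).
Proof.
move=> ha hu br hn.
have r0 : 0 < r := le_lt_trans (cabs_ge0 _) br.
rewrite -[r]mulr1; apply: tameM => //; first exact: ltW.
  split=> [|n]; last first.
    apply: (@tends_prod R nat _ (fun k m => u m - q ^+ k)
      (fun k => beta - q ^+ k)) => k.
    exact: tendsB hu (tends_cst _).
  exists (expR (r^-1 / (1 - cabs q))); split; first exact: expR_ge0.
  have e0 : 0 < r - cabs beta by rewrite subr_gt0.
  move/tendsP : hu => /(_ _ e0); apply: filterS => m hm n.
  have um : cabs (u m) <= r.
    have := cabsB beta (beta - u m); have -> : beta - (beta - u m) = u m by ring.
    lra.
  apply: le_trans (_ : \prod_(0 <= k < n) (r * (1 + r^-1 * cabs q ^+ k)) <= _).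
    rewrite cabs_prod; apply: ler_prod => k _; rewrite cabs_ge0 /=.
    rewrite mulrDr mulr1 mulrA mulfV ?gt_eqF // mul1r -cabsX.
    by apply: le_trans (cabsB _ _) _; rewrite lerD2r.
  rewrite big_split /= prodr_const_nat subn0 mulrC ler_wpM2r ?exprn_ge0 ?(ltW r0) //.
  by apply: prod_geometric_le => //; rewrite invr_ge0 ltW.
by apply: tame_qfacV => //; apply: tendsM (tends_cst _); apply: tendsM.
Qed.

(** Makes room for strict majorants: in [tame_tau4] five moduli are replaced one after another by
    larger ratios while their product stays below 1. *)
Lemma enlarge (k b : R) : 0 <= k -> 0 <= b -> k * b < 1 ->
  exists r, [/\ b < r, 0 < r & k * r < 1].
Proof.
move=> k0 b0 kb; have [->|kn] := eqVneq k 0.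
  by exists (b + 1); rewrite mul0r ltrDl ltr01 ltr_wpDl.
have {}k0 : 0 < k by rewrite lt_def kn.
have bk : b < k^-1 by rewrite -ltr_pdivlMl // mulr1 in kb.
exists ((b + k^-1) / 2); split; [lra|lra|].
rewrite -ltr_pdivlMl // mulr1; lra.
Qed.

Lemma tame_tau4 (a u1 u2 u3 u4 : nat -> C) A b1 b2 b3 b4 K :
  tends a A -> tends u1 b1 -> tends u2 b2 -> tends u3 b3 -> tends u4 b4 ->
  (forall n, qfac q (A * b1 * q) n != 0) -> (forall n, qfac q (A * b2 * q) n != 0) ->
  (forall n, qfac q (A * b3 * q) n != 0) -> (forall n, qfac q (A * b4 * q) n != 0) ->
  cabs (K * b1 * b2 * b3 * b4) < 1 ->
  exists2 r : R, 0 <= r < 1 & 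
  tame r (fun m n => tau (a m) (u1 m) n * tau (a m) (u2 m) n * tau (a m) (u3 m) n
                     * tau (a m) (u4 m) n * K ^+ n)
   (fun n => tau A b1 n * tau A b2 n * tau A b3 n * tau A b4 n * K ^+ n).
Proof.
move=> ha h1 h2 h3 h4 n1 n2 n3 n4; rewrite !cabsM => hK.
have g x := @cabs_ge0 R x.
have [|||r1 [r1b r1p r1K]] := @enlarge (cabs K * cabs b2 * cabs b3 * cabs b4) (cabs b1).
- by rewrite !mulr_ge0.
- by [].
- by apply: le_lt_trans hK; rewrite le_eqVlt; apply/orP; left; apply/eqP; ring.
have [|||r2 [r2b r2p r2K]] := @enlarge (cabs K * r1 * cabs b3 * cabs b4) (cabs b2).
- by rewrite !mulr_ge0 // ltW.
- by [].
- by apply: le_lt_trans r1K; rewrite le_eqVlt; apply/orP; left; apply/eqP; ring.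
have [|||r3 [r3b r3p r3K]] := @enlarge (cabs K * r1 * r2 * cabs b4) (cabs b3).
- by rewrite !mulr_ge0 // ltW.
- by [].
- by apply: le_lt_trans r2K; rewrite le_eqVlt; apply/orP; left; apply/eqP; ring.
have [|||r4 [r4b r4p r4K]] := @enlarge (cabs K * r1 * r2 * r3) (cabs b4).
- by rewrite !mulr_ge0 // ltW.
- by [].
- by apply: le_lt_trans r3K; rewrite le_eqVlt; apply/orP; left; apply/eqP; ring.
have [|||r5 [r5b r5p r5K]] := @enlarge (r1 * r2 * r3 * r4) (cabs K).
- by rewrite !mulr_ge0 // ltW.
- by [].
- by apply: le_lt_trans r4K; rewrite le_eqVlt; apply/orP; left; apply/eqP; ring.
exists (r1 * r2 * r3 * r4 * r5).
  by rewrite r5K andbT !mulr_ge0 // ltW.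
have [p1 p2 p3 p4 p5] := And5 (ltW r1p) (ltW r2p) (ltW r3p) (ltW r4p) (ltW r5p).
apply: tameM; rewrite ?mulr_ge0 //; last exact: tame_expr (tends_cst _) _.
apply: tameM; rewrite ?mulr_ge0 //; last exact: tame_tau.
apply: tameM; rewrite ?mulr_ge0 //; last exact: tame_tau.
by apply: tameM; rewrite ?mulr_ge0 //; exact: tame_tau.
Qed.

(** For b_i = 1/x_i this is the very-well-poised term with parameters x_i and argument A^2 q/(x1 x2
    x3 x4), without the normalisation 1/(1 - A); the powers of 1/x_i are part of [tau]. *)
Definition tterm A b1 b2 b3 b4 n : C := (1 - A * q ^+ (2 * n)) *
  (tau A b1 n * tau A b2 n * tau A b3 n * tau A b4 n * (A ^+ 2 * q) ^+ n).

Lemma tame_tterm (u1 u2 u3 u4 : nat -> C) A b1 b2 b3 b4 :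
  tends u1 b1 -> tends u2 b2 -> tends u3 b3 -> tends u4 b4 ->
  (forall n, qfac q (A * b1 * q) n != 0) -> (forall n, qfac q (A * b2 * q) n != 0) ->
  (forall n, qfac q (A * b3 * q) n != 0) -> (forall n, qfac q (A * b4 * q) n != 0) ->
  cabs (A ^+ 2 * q * b1 * b2 * b3 * b4) < 1 ->
  exists2 r : R, 0 <= r < 1 &
  tame r (fun m => tterm A (u1 m) (u2 m) (u3 m) (u4 m)) (tterm A b1 b2 b3 b4).
Proof.
move=> h1 h2 h3 h4 n1 n2 n3 n4 hK.
have [r r01 h] := tame_tau4 (tends_cst A) h1 h2 h3 h4 n1 n2 n3 n4 hK.
exists r => //; rewrite -[r]mul1r; apply: tameM => //; first by case/andP: r01.
by apply: tame_vwp => //; exact: tends_cst.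
Qed.

Definition tsum A b1 b2 b3 b4 := csum (tterm A b1 b2 b3 b4).

Lemma tsum_rot A b1 b2 b3 b4 : tsum A b1 b2 b3 b4 = tsum A b2 b3 b4 b1.
Proof. by apply: eq_csum => n; rewrite /tterm; ring. Qed.

Lemma tsum1_0 A b : tsum A b 1 0 0 = 1 - A /\ tsum A 1 b 0 0 = 1 - A.
Proof.
have tau1 n : tau A 1 n.+1 = 0.
  by rewrite /tau big_nat_recl //= expr0 subrr !mul0r.
by split; apply: csum_tends; apply/tends_shift;
  apply: eq_tends (tends_cst _) _ => n;
  rewrite /series /= big_nat_recl //= big1 ?addr0 => [|i _];
  rewrite /tterm ?tau1 ?tau0 ?expr0 ?(mulr0, mulr1, mul0r, mul1r).
Qed.

Lemma tends_tsum A b1 b2 b3 b4 :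
  (forall n, qfac q (A * b1 * q) n != 0) -> (forall n, qfac q (A * b2 * q) n != 0) ->
  (forall n, qfac q (A * b3 * q) n != 0) -> (forall n, qfac q (A * b4 * q) n != 0) ->
  cabs (A ^+ 2 * q * b1 * b2 * b3 * b4) < 1 ->
  tends (series (tterm A b1 b2 b3 b4)) (tsum A b1 b2 b3 b4).
Proof.
move=> n1 n2 n3 n4 hK.
have [r r01 h] := tame_tterm (tends_cst b1) (tends_cst b2) (tends_cst b3)
  (tends_cst b4) n1 n2 n3 n4 hK.
exact: tends_csum r01 (tame_dominated h).
Qed.

Lemma qfac_shift_neq0 x : (forall n, qfac q x n != 0) ->
  forall n, qfac q (x * q) n != 0.
Proof. by move=> h n; have := h n.+1; rewrite qfacSl mulf_eq0 negb_or => /andP[]. Qed.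

Lemma qfac_factor_neq0 x n : (forall n, qfac q x n != 0) -> 1 - x * q ^+ n != 0.
Proof. by move=> /(_ n.+1); rewrite qfacS mulf_eq0 negb_or => /andP[]. Qed.

Lemma cabs_base_lt x : cabs x < 1 -> cabs (q * x) < 1.
Proof.
have [q0 q1] := andP (base_cabs q01).
move=> h; rewrite cabsM; apply: le_lt_trans h.
by rewrite ler_piMl ?cabs_ge0 // ltW.
Qed.

(** Telescoping: a combination of the two summands is a difference G (n+1) - G n with G tending to
    0, and the inhomogeneous term is G 0. *)
Lemma tsum_rec A b1 b2 b3 b4 :
  (forall n, qfac q (A * b1 * q) n != 0) -> (forall n, qfac q (A * b2 * q) n != 0) ->
  (forall n, qfac q (A * b3 * q) n != 0) -> (forall n, qfac q (A * b4 * q) n != 0) ->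
  q * b1 != 1 ->
  cabs (A ^+ 2 * q * b1 * b2 * b3 * b4) < 1 ->
  let g := q * b1 in
  (1 - A ^+ 2 * g * b2 * b3 * b4) * (1 - g) * (1 - A * g) * tsum A b1 b2 b3 b4
  = (1 - A * g * b2) * (1 - A * g * b3) * (1 - A * g * b4) * tsum A g b2 b3 b4
    - g * (1 - A * g) * (1 - A * b2) * (1 - A * b3) * (1 - A * b4).
Proof.
move=> n1 n2 n3 n4 gn hK g.
have n1' : forall n, qfac q (A * g * q) n != 0.
  by move=> n; rewrite (_ : A * g * q = A * b1 * q * q) ?qfac_shift_neq0 // /g; ring.
have hK' : cabs (A ^+ 2 * g * b2 * b3 * b4) < 1.
  by rewrite (_ : _ * _ = A ^+ 2 * q * b1 * b2 * b3 * b4) // /g; ring.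
have hK2 : cabs (A ^+ 2 * q * g * b2 * b3 * b4) < 1.
  rewrite (_ : _ * b4 = q * (A ^+ 2 * g * b2 * b3 * b4)); last by ring.
  exact: cabs_base_lt.
have g1 : 1 - g != 0 by rewrite subr_eq0 eq_sym.
have g2 : 1 - A * g != 0.
  by have := qfac_factor_neq0 0 n1; rewrite expr0 mulr1 -[A * b1 * q]mulrA (mulrC b1).
pose G n := tau A g n * tau A b2 n * tau A b3 n * tau A b4 n * (A ^+ 2) ^+ n
   * (g * ((1 - A * g * q ^+ n) * (1 - A * b2 * q ^+ n) * (1 - A * b3 * q ^+ n)
       * (1 - A * b4 * q ^+ n))).
have G0 : tends G 0.
  rewrite -[X in tends _ X](mul0r
    (g * ((1 - A * g * 0) * (1 - A * b2 * 0) * (1 - A * b3 * 0) * (1 - A * b4 * 0)))).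
  have [r r01 h] := tame_tau4 (tends_cst A) (tends_cst g) (tends_cst b2) (tends_cst b3)
    (tends_cst b4) n1' n2 n3 n4 hK'.
  have h0 := dominated_cvg0 r01 (tame_dominated h).
  apply: tendsM h0 _; apply: tendsM; first exact: tends_cst.
  have f x : tends (fun n => 1 - A * x * q ^+ n) (1 - A * x * 0).
    exact: tendsB (tends_cst _) (tendsM (tends_cst _) (tends_expr0 q01)).
  by do 3!(apply: tendsM => //).
have s1 := tends_tsum n1 n2 n3 n4 hK.
have s2 := tends_tsum n1' n2 n3 n4 hK2.
have sG := tends_telescope G0.
have key n : G n.+1 - G n =
  (1 - A ^+ 2 * g * b2 * b3 * b4) * (1 - g) * (1 - A * g) * tterm A b1 b2 b3 b4 n
  + - ((1 - A * g * b2) * (1 - A * g * b3) * (1 - A * g * b4)) * tterm A g b2 b3 b4 n.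
  rewrite /G /tterm !tauS.
  have e2 : q ^+ (2 * n) = q ^+ n * q ^+ n by rewrite mul2n -addnn exprD.
  have f1 : (1 - g) * (1 - A * g) * (tau A b1 n * q ^+ n) =
      tau A g n * ((q ^+ n - g) * (1 - A * g * q ^+ n)).
    rewrite tau_shift // -/g; field.
    by rewrite g1 g2.
  have m1 : 1 - A * g * q ^+ n.+1 != 0 by rewrite exprS mulrA qfac_factor_neq0.
  have m2 : 1 - A * b2 * q ^+ n.+1 != 0 by rewrite exprS mulrA qfac_factor_neq0.
  have m3 : 1 - A * b3 * q ^+ n.+1 != 0 by rewrite exprS mulrA qfac_factor_neq0.
  have m4 : 1 - A * b4 * q ^+ n.+1 != 0 by rewrite exprS mulrA qfac_factor_neq0.
  rewrite [(A ^+ 2 * q) ^+ n]exprMn [(A ^+ 2) ^+ n.+1]exprS e2.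
  (* With X = q^n the bracket vanishes when A X^2 = 1, so it is divisible by 1 - A X^2; by the
     symmetry X -> 1/(A X) the quadratic quotient is a combination of (X - g) (1 - A g X) and X,
     which account for the two sums. *)
  transitivity (tau A g n * tau A b2 n * tau A b3 n * tau A b4 n * (A ^+ 2) ^+ n * g *
    (A ^+ 2 * ((g - q ^+ n) * (b2 - q ^+ n) * (b3 - q ^+ n) * (b4 - q ^+ n)) -
     (1 - A * g * q ^+ n) * (1 - A * b2 * q ^+ n) * (1 - A * b3 * q ^+ n)
       * (1 - A * b4 * q ^+ n))).
    by field; rewrite m1 m2 m3 m4.
  transitivity ((1 - A * (q ^+ n * q ^+ n)) * (tau A b2 n * tau A b3 n * tau A b4 n)
    * (A ^+ 2) ^+ n * ((1 - A ^+ 2 * g * b2 * b3 * b4) *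
      ((1 - g) * (1 - A * g) * (tau A b1 n * q ^+ n)) -
      (1 - A * g * b2) * (1 - A * g * b3) * (1 - A * g * b4) * tau A g n * q ^+ n)).
    by rewrite f1; ring.
  by ring.
have := tends_unique (eq_tends_series sG key)
  (tends_seriesD (tends_seriesZ _ s1) (tends_seriesZ _ s2)).
have aux (c1 c2 t1 t2 w w' : C) :
    0 - w' = c1 * t1 + - c2 * t2 -> w' = w -> c1 * t1 = c2 * t2 - w.
  by move=> h <-; rewrite -[c1 * t1](addrK (- c2 * t2)) -h; ring.
move=> /aux; apply; rewrite /G !tau0 !expr0; ring.
Qed.

End Bailey.

(* Opaque atoms are abstracted first: ring and field would otherwise try to
   convert them into each other. *)
Ltac abstract_atoms := repeat match goal with
  | |- context [qinf ?q ?x] => generalize (qinf q x); intro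
  | |- context [qfac ?q ?x ?n] => generalize (qfac q x n); intro
  | |- context [tsum ?q ?a ?b1 ?b2 ?b3 ?b4] => generalize (tsum q a b1 b2 b3 b4); intro
  end.

Local Opaque qinf qfac csum tsum tau.

(** * Solution of the recurrence for the bilateral sum *)

Section BaileySum.
Local Open Scope classical_set_scope.
Variables (R : realType) (q : R[i]).
Hypothesis q01 : 0 < `|q| < 1.
Local Notation C := (R[i]).
Implicit Types (x y A Z b : C).
Local Notation tsum := (tsum q).

(* The terms of index - n of the bilateral series are, up to a factor, those of
   the unilateral series with A, b replaced by 1/A, A b; the term of index 0 is
   counted twice, whence the correction A - 1. *)
Definition tbil A b1 b2 b3 b4 : C :=
  tsum A b1 b2 b3 b4 - A * tsum A^-1 (A * b1) (A * b2) (A * b3) (A * b4) + A - 1.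

(** With b = 1/x these are (A q/x;q)_oo and (q/x;q)_oo, which govern the denominators of the two
    halves of the bilateral series. *)
Definition regular A b := (qinf q (A * b * q) != 0) && (qinf q (b * q) != 0).

Lemma regularP A b : A != 0 -> regular A b ->
  [/\ forall n, qfac q (A * b * q) n != 0,
      forall n, qfac q (A^-1 * (A * b) * q) n != 0 & q * b != 1].
Proof.
move=> A0 /andP[/(qinf_neq0P q01) h1 /(qinf_neq0P q01) h2]; split=> //.
  by move=> n; rewrite mulKf.
by have := h2 1%N; rewrite qfacS qfac0 mul1r expr0 mulr1 subr_eq0 eq_sym mulrC.
Qed.

Lemma regular_shift A b : regular A b -> regular A (q * b).
Proof.
move=> /andP[]; rewrite (qinfS q01) mulf_eq0 negb_or => /andP[_ h].
rewrite (qinfS q01) mulf_eq0 negb_or => /andP[_ h'].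
have e1 : A * (q * b) * q = A * b * q * q by ring.
have e2 : q * b * q = b * q * q by ring.
by apply/andP; split; [rewrite e1; exact: h|rewrite e2; exact: h'].
Qed.

Lemma regular_exp A b n : regular A b -> regular A (q ^+ n * b).
Proof.
move=> h; elim: n => [|n IH]; first by rewrite expr0 mul1r.
by rewrite exprS -mulrA regular_shift.
Qed.

(** The boundary terms of the recurrences at A and at 1/A and the contribution of A - 1 add up to 0,
    which makes the bilateral recurrence homogeneous. *)
Lemma tbil_rec A b1 b2 b3 b4 : A != 0 ->
  regular A b1 -> regular A b2 -> regular A b3 -> regular A b4 ->
  cabs (A ^+ 2 * q * b1 * b2 * b3 * b4) < 1 ->
  let g := q * b1 in
  (1 - A ^+ 2 * g * b2 * b3 * b4) * (1 - g) * (1 - A * g) * tbil A b1 b2 b3 b4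
  = (1 - A * g * b2) * (1 - A * g * b3) * (1 - A * g * b4) * tbil A g b2 b3 b4.
Proof.
move=> A0 /(regularP A0)[n1 m1 g1] /(regularP A0)[n2 m2 _]
  /(regularP A0)[n3 m3 _] /(regularP A0)[n4 m4 _] hK g.
have h1 := tsum_rec q01 n1 n2 n3 n4 g1 hK.
have Ag : A^-1 * (q * (A * b1)) = g by rewrite mulrCA mulKf.
have hK' : cabs (A^-1 ^+ 2 * q * (A * b1) * (A * b2) * (A * b3) * (A * b4)) < 1.
  by rewrite (_ : _ * (A * b4) = A ^+ 2 * q * b1 * b2 * b3 * b4) //; field.
have [g0|gn0] := eqVneq g 0.
  have b0 : b1 = 0 by apply/eqP; move/eqP : g0; rewrite mulf_eq0 (negbTE (base_neq0 q01)).
  by rewrite g0 b0 !(mulr0, mul0r, subr0, mul1r).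
have gA : q * (A * b1) != 1 \/ q * (A * b1) = 1 by case: eqVneq; [right|left].
have n1' := qfac_factor_neq0 0 n1; rewrite expr0 mulr1 in n1'.
have {gA}gA : q * (A * b1) != 1.
  by rewrite mulrCA -subr_eq0 -oppr_eq0 opprB (mulrC q b1) mulrA.
have h2 := tsum_rec q01 m1 m2 m3 m4 gA hK'.
rewrite /= -/g in h1; rewrite /= in h2.
rewrite /tbil.
have -> : A * g = q * (A * b1) by rewrite /g; ring.
move: h1 h2.
set T1 := tsum _ _ _ _ _; set T2 := tsum _ _ _ _ _.
set T3 := tsum _ _ _ _ _; set T4 := tsum _ _ _ _ _.
move=> h1 h2.
have {}h2 : (1 - A ^+ 2 * g * b2 * b3 * b4) * (1 - g) * (1 - A * g) * T3 =
    (1 - A * g * b2) * (1 - A * g * b3) * (1 - A * g * b4) * T4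
    - A * g * (1 - g) * (1 - b2) * (1 - b3) * (1 - b4).
  transitivity ((1 - A^-1 ^+ 2 * (q * (A * b1)) * (A * b2) * (A * b3) * (A * b4)) *
     (1 - q * (A * b1)) * (1 - A^-1 * (q * (A * b1))) * T3).
    by rewrite /g; field.
  by rewrite h2 /g; field.
have -> : q * (A * b1) = A * g by rewrite /g; ring.
set L := (1 - A ^+ 2 * g * b2 * b3 * b4) * (1 - g) * (1 - A * g) in h1 h2 *.
transitivity (L * T1 - A * (L * T3) + L * (A - 1)); first by ring.
rewrite h1 h2 /L; clearbody T1 T2 T3 T4 g; ring.
Qed.

Ltac abstract_bil := repeat match goal with
  | |- context [tbil ?a ?b1 ?b2 ?b3 ?b4] => generalize (tbil a b1 b2 b3 b4); intro
  end.

Lemma tbil_iter A b1 b2 b3 b4 n : A != 0 ->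
  regular A b1 -> regular A b2 -> regular A b3 -> regular A b4 ->
  cabs (A ^+ 2 * q * b1 * b2 * b3 * b4) < 1 ->
  qfac q (A ^+ 2 * q * b1 * b2 * b3 * b4) n * qfac q (q * b1) n
    * qfac q (A * q * b1) n * tbil A b1 b2 b3 b4
  = qfac q (A * q * b1 * b2) n * qfac q (A * q * b1 * b3) n
    * qfac q (A * q * b1 * b4) n * tbil A (q ^+ n * b1) b2 b3 b4.
Proof.
move=> A0 r1 r2 r3 r4 hK; elim: n => [|n IH]; first by rewrite !qfac0 expr0 [1 * b1]mul1r.
have hKn : cabs (A ^+ 2 * q * (q ^+ n * b1) * b2 * b3 * b4) < 1.
  elim: n {IH} => [|n IH]; first by rewrite expr0 mul1r.
  rewrite [q ^+ n.+1]exprS (_ : _ * b4 = q * (A ^+ 2 * q * (q ^+ n * b1) * b2 * b3 * b4)).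
    exact: cabs_base_lt.
  by ring.
have /= := tbil_rec A0 (regular_exp n r1) r2 r3 r4 hKn.
rewrite !qfacS [q * (q ^+ n * b1)]mulrA -[q * q ^+ n]exprS => h.
transitivity (qfac q (A ^+ 2 * q * b1 * b2 * b3 * b4) n * qfac q (q * b1) n
    * qfac q (A * q * b1) n * tbil A b1 b2 b3 b4 *
   ((1 - A ^+ 2 * (q ^+ n.+1 * b1) * b2 * b3 * b4) * (1 - q ^+ n.+1 * b1) *
    (1 - A * (q ^+ n.+1 * b1)))); first by rewrite [q ^+ n.+1]exprS; generalize (tbil A b1 b2 b3 b4); intro; abstract_atoms; ring.
rewrite IH; move: h; set T := tbil _ (q ^+ n * b1) _ _ _ => h.
transitivity (qfac q (A * q * b1 * b2) n * qfac q (A * q * b1 * b3) n *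
   qfac q (A * q * b1 * b4) n * ((1 - A ^+ 2 * (q ^+ n.+1 * b1) * b2 * b3 * b4) *
   (1 - q ^+ n.+1 * b1) * (1 - A * (q ^+ n.+1 * b1)) * T)).
  by clearbody T; abstract_atoms; ring.
by rewrite h [q ^+ n.+1]exprS; generalize (tbil A (q * q ^+ n * b1) b2 b3 b4); intro; abstract_atoms; ring.
Qed.

Lemma regular0 A : regular A 0.
Proof. by rewrite /regular !(mulr0, mul0r) qinf0 // oner_neq0. Qed.

Lemma tends_tbil (u : nat -> C) A b1 b2 b3 b4 : A != 0 -> tends u b1 ->
  regular A b1 -> regular A b2 -> regular A b3 -> regular A b4 ->
  cabs (A ^+ 2 * q * b1 * b2 * b3 * b4) < 1 ->
  tends (fun m => tbil A (u m) b2 b3 b4) (tbil A b1 b2 b3 b4).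
Proof.
move=> A0 hu /(regularP A0)[n1 m1 g1] /(regularP A0)[n2 m2 _]
  /(regularP A0)[n3 m3 _] /(regularP A0)[n4 m4 _] hK.
have hK' : cabs (A^-1 ^+ 2 * q * (A * b1) * (A * b2) * (A * b3) * (A * b4)) < 1.
  by rewrite (_ : _ * (A * b4) = A ^+ 2 * q * b1 * b2 * b3 * b4) //; field.
have [r r01 h] := tame_tterm q01 hu (tends_cst b2) (tends_cst b3) (tends_cst b4)
  n1 n2 n3 n4 hK.
have hu' := tendsM (tends_cst A) hu.
have [s s01 h'] := tame_tterm q01 hu' (tends_cst (A * b2)) (tends_cst (A * b3))
  (tends_cst (A * b4)) m1 m2 m3 m4 hK'.
apply: tendsB (tends_cst _); apply: tendsD (tends_cst _); apply: tendsB.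
  exact: tame_series r01 h.
by apply: tendsM (tends_cst _) _; exact: tame_series s01 h'.
Qed.

(** The recurrence is iterated towards b1 = 0, where the first parameter is at infinity. The new 0
    is rotated to the last place, so that the lemma applies again to the next parameter. *)
Lemma tbil_limit A b1 b2 b3 b4 : A != 0 ->
  regular A b1 -> regular A b2 -> regular A b3 -> regular A b4 ->
  cabs (A ^+ 2 * q * b1 * b2 * b3 * b4) < 1 ->
  qinf q (A ^+ 2 * q * b1 * b2 * b3 * b4) * qinf q (q * b1)
    * qinf q (A * q * b1) * tbil A b1 b2 b3 b4
  = qinf q (A * q * b1 * b2) * qinf q (A * q * b1 * b3)
    * qinf q (A * q * b1 * b4) * tbil A b2 b3 b4 0.
Proof.
move=> A0 r1 r2 r3 r4 hK.
have t x := tends_qfac_qinf q01 x.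
apply: tends_unique (tendsM (tendsM (tendsM (t _) (t _)) (t _)) (tends_cst _)) _.
have hu : tends (fun n => q ^+ n * b1) 0.
  by rewrite -(mul0r b1); exact: tendsM (tends_expr0 q01) (tends_cst _).
have hK0 : cabs (A ^+ 2 * q * 0 * b2 * b3 * b4) < 1.
  by rewrite !(mulr0, mul0r) cabs0 ltr01.
have rot x1 x2 x3 x4 : tbil A x1 x2 x3 x4 = tbil A x2 x3 x4 x1.
  by rewrite /tbil tsum_rot (tsum_rot q A^-1).
rewrite -(rot 0 b2 b3 b4).
apply: eq_tends (tendsM (tendsM (tendsM (t _) (t _)) (t _))
  (tends_tbil A0 hu (regular0 A) r2 r3 r4 hK0)) _ => n.
exact: esym (tbil_iter n A0 r1 r2 r3 r4 hK).
Qed.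

(** Elimination for four successive uses of [tbil_limit]: e_ij stands for the infinite product at
    the pair (i, j), and each 1 for one at 0. *)
Lemma mul_chain4 (K : comRingType) (P a1 a2 a3 a4 c1 c2 c3 c4 e12 e13 e14 e23 e24
    e34 T0 T1 T2 T3 T4 : K) :
  P * a1 * c1 * T1 = e12 * e13 * e14 * T2 -> 1 * a2 * c2 * T2 = e23 * e24 * 1 * T3 ->
  1 * a3 * c3 * T3 = e34 * 1 * 1 * T4 -> 1 * a4 * c4 * T4 = 1 * 1 * 1 * T0 ->
  P * (a1 * a2 * a3 * a4) * (c1 * c2 * c3 * c4) * T1 =
  T0 * (e12 * e13 * e14 * e23 * e24 * e34).
Proof.
move=> l1 l2 l3 l4.
transitivity (a2 * a3 * a4 * c2 * c3 * c4 * (P * a1 * c1 * T1)); first by ring.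
rewrite l1; transitivity (a3 * a4 * c3 * c4 * (e12 * e13 * e14) * (1 * a2 * c2 * T2)).
  by ring.
rewrite l2; transitivity (a4 * c4 * (e12 * e13 * e14 * e23 * e24) * (1 * a3 * c3 * T3)).
  by ring.
rewrite l3; transitivity (e12 * e13 * e14 * e23 * e24 * e34 * (1 * a4 * c4 * T4)).
  by ring.
by rewrite l4; ring.
Qed.

Lemma tbil_value A b1 b2 b3 b4 : A != 0 ->
  qinf q (A * q) != 0 -> qinf q (q / A) != 0 ->
  regular A b1 -> regular A b2 -> regular A b3 -> regular A b4 ->
  cabs (A ^+ 2 * q * b1 * b2 * b3 * b4) < 1 ->
  qinf q (A ^+ 2 * q * b1 * b2 * b3 * b4)
    * (qinf q (q * b1) * qinf q (q * b2) * qinf q (q * b3) * qinf q (q * b4))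
    * (qinf q (A * q * b1) * qinf q (A * q * b2) * qinf q (A * q * b3)
       * qinf q (A * q * b4)) * tbil A b1 b2 b3 b4
  = qinf q A * qinf q (q / A) * qinf q q
    * (qinf q (A * q * b1 * b2) * qinf q (A * q * b1 * b3) * qinf q (A * q * b1 * b4)
       * qinf q (A * q * b2 * b3) * qinf q (A * q * b2 * b4) * qinf q (A * q * b3 * b4)).
Proof.
move=> A0 Aq qA.
have r0 := regular0 A.
have c0 : cabs (0 : C) < 1 by rewrite cabs0 ltr01.
have main x1 x2 x3 x4 : regular A x1 -> regular A x2 -> regular A x3 ->
    regular A x4 -> cabs (A ^+ 2 * q * x1 * x2 * x3 * x4) < 1 ->
  qinf q (A ^+ 2 * q * x1 * x2 * x3 * x4)
    * (qinf q (q * x1) * qinf q (q * x2) * qinf q (q * x3) * qinf q (q * x4))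
    * (qinf q (A * q * x1) * qinf q (A * q * x2) * qinf q (A * q * x3)
       * qinf q (A * q * x4)) * tbil A x1 x2 x3 x4
  = tbil A 0 0 0 0 * (qinf q (A * q * x1 * x2) * qinf q (A * q * x1 * x3)
     * qinf q (A * q * x1 * x4) * qinf q (A * q * x2 * x3)
     * qinf q (A * q * x2 * x4) * qinf q (A * q * x3 * x4)).
  move=> r1 r2 r3 r4 hK.
  have l1 := tbil_limit A0 r1 r2 r3 r4 hK.
  have := tbil_limit A0 r2 r3 r4 r0; rewrite mulr0 => /(_ c0) l2.
  have := tbil_limit A0 r3 r4 r0 r0; rewrite mulr0 => /(_ c0) l3.
  have := tbil_limit A0 r4 r0 r0 r0; rewrite mulr0 => /(_ c0) l4.
  move: l2 l3 l4.
  rewrite [A * q * x2 * 0]mulr0 [A * q * x3 * 0]mulr0 [A * q * x4 * 0]mulr0.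
  rewrite (qinf0 q01) => l2 l3 l4.
  exact: (mul_chain4 l1 l2 l3 l4).
have k0 : tbil A 0 0 0 0 = qinf q A * qinf q (q / A) * qinf q q.
  have ra : regular A A^-1.
    apply/andP; split; first by rewrite (mulfV A0) mul1r; exact: qinf_q_neq0.
    by rewrite [A^-1 * q]mulrC; exact: qA.
  have r1 : regular A 1.
    apply/andP; split; first by rewrite [A * 1]mulr1; exact: Aq.
    by rewrite mul1r; exact: qinf_q_neq0.
  have := main _ _ _ _ ra r1 r0 r0; rewrite mulr0 => /(_ c0).
  (* The entry 1 stops the series at A after n = 0, and A / A = 1 stops the mirrored one. *)
  have -> : tbil A A^-1 1 0 0 = 1 - A.
    rewrite /tbil !mulr0 mulr1 mulfV // (tsum1_0 q A _).1 (tsum1_0 q A^-1 A).2.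
    by field.
  have -> : A * q / A * 1 = q by field.
  have -> : A * q / A = q by field.
  rewrite [q * 1]mulr1 [q * 0]mulr0 [A * q * 1]mulr1 [A * q * 0]mulr0 [0 * 0]mulr0.
  rewrite (qinf0 q01) => h.
  apply: (mulIf (qinf_q_neq0 q01)).
  transitivity (tbil A 0 0 0 0 * (qinf q q * 1 * 1 * 1 * 1 * 1)); first by abstract_bil; abstract_atoms; ring.
  by rewrite -h (qinfS q01 A); abstract_atoms; ring.
move=> r1 r2 r3 r4 hK.
exact: etrans (main _ _ _ _ r1 r2 r3 r4 hK) (congr1 (fun t => t * _) k0).
Qed.

End BaileySum.
Local Transparent qinf qfac csum tsum tau.

(** * Very-well-poised series *)

Section WellPoised.
Local Open Scope classical_set_scope.
Variables (R : realType) (q : R[i]).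
Hypothesis q01 : 0 < `|q| < 1.
Local Notation C := (R[i]).
Implicit Types (x y A Z b : C).

(** The factor 1/(1 - A) is left out. Listing A itself among the parameters produces
    (A;q)_n/(q;q)_n, so the same terms serve both halves of a bilateral series and genuinely
    unilateral series. *)
Definition uterm A (s : seq C) Z n : C := (1 - A * q ^+ (2 * n)) *
  (\prod_(x <- s) (qfac q x n / qfac q (A * q / x) n)) * Z ^+ n.

Definition usum A s Z := csum (uterm A s Z).

(** When Z^2 q^2 is the product of the A q/x^2, this is 1 - A times the bilateral series: the second
    sum is the half over n <= 0, and A - 1 removes the second copy of the term n = 0. *)
Definition vsum A s Z :=
  usum A s Z - A * usum A^-1 [seq x / A | x <- s] Z + A - 1.

Lemma uterm0 A s Z : uterm A s Z 0 = 1 - A.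
Proof.
rewrite /uterm muln0 !expr0 !mulr1 big1 ?mulr1 // => x _.
by rewrite !qfac0 divr1.
Qed.

(** Defined by recursion so that on an explicit list it computes to a conjunction. *)
Definition eachP (T : Type) (P : T -> Prop) : seq T -> Prop :=
  foldr (fun t Q => P t /\ Q) True.

Lemma eachP_mem (T : eqType) (P : T -> Prop) (s : seq T) :
  (forall t, t \in s -> P t) -> eachP P s.
Proof.
elim: s => //= x s IH h; split; first by apply: h; rewrite mem_head.
by apply: IH => y ys; apply: h; rewrite inE ys orbT.
Qed.

Lemma tame_ratio (a u : nat -> C) A x : tends a A -> tends u x -> x != 0 ->
  (forall n, qfac q (A * q / x) n != 0) ->
  tame 1 (fun m n => qfac q (u m) n / qfac q (a m * q / u m) n)
    (fun n => qfac q x n / qfac q (A * q / x) n).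
Proof.
move=> ha hu x0 hn; rewrite -[1](mulr1 1); apply: tameM => //.
  exact: tame_qfac.
apply: tame_qfacV => //; apply: tendsM (tendsV x0 hu).
exact: tendsM ha (tends_cst q).
Qed.

(** Each entry of [s] pairs a sequence of parameters with its limit. *)
Lemma tame_uterm (a z : nat -> C) A Z (s : seq ((nat -> C) * C)) r :
  tends a A -> tends z Z -> cabs Z < r ->
  eachP (fun p => [/\ tends p.1 p.2, p.2 != 0 &
     forall n, qfac q (A * q / p.2) n != 0]) s ->
  tame r (fun m => uterm (a m) [seq p.1 m | p <- s] (z m))
    (uterm A [seq p.2 | p <- s] Z).
Proof.
move=> ha hz Zr hs; have r0 : 0 <= r by apply: ltW; exact: le_lt_trans (cabs_ge0 _) Zr.
rewrite -[r]mul1r; apply: tameM => //; last exact: tame_expr.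
rewrite -[1]mulr1; apply: tameM => //; first exact: tame_vwp.
elim: s hs => [_|p s IH /= [[h1 h2 h3] /IH h]].
  apply: tame_ext (tame_cst (_ : dominated 1 (fun=> 1))).
  - by move=> m n; rewrite big_nil.
  - by move=> n; rewrite big_nil.
  - by exists 1; split=> // n; rewrite cabs1 expr1n mulr1.
apply: tame_ext; last first.
- by rewrite -[1](mulr1 1); apply: (tameM _ _ (tame_ratio ha h1 h2 h3) h).
- by move=> n; rewrite big_cons.
- by move=> m n; rewrite big_cons.
Qed.

Lemma between1 r : r < 1 -> 0 <= r -> exists2 s : R, 0 <= s < 1 & r < s.
Proof.
move=> r1 r0; exists ((r + 1) / 2); last by lra.
by apply/andP; split; lra.
Qed.

Lemma dominated_uterm A s Z : cabs Z < 1 ->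
  eachP (fun x => x != 0 /\ forall n, qfac q (A * q / x) n != 0) s ->
  exists2 r, 0 <= r < 1 & dominated r (uterm A s Z).
Proof.
move=> Z1 hs; have [r r01 Zr] := between1 Z1 (cabs_ge0 _); exists r => //.
have := @tame_uterm _ _ A Z [seq ((fun=> x), x) | x <- s] r (tends_cst A) (tends_cst Z) Zr.
rewrite -map_comp map_id => h; apply: tame_dominated; apply: h.
elim: s hs => //= x s IH [[x0 xn] /IH h]; split=> //; split=> //.
exact: tends_cst.
Qed.

Lemma tends_usum_series A s Z : cabs Z < 1 ->
  eachP (fun x => x != 0 /\ forall n, qfac q (A * q / x) n != 0) s ->
  tends (series (uterm A s Z)) (usum A s Z).
Proof. by move=> Z1 /(dominated_uterm Z1) [r r01]; exact: tends_csum. Qed.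

Lemma tends_usum (a z : nat -> C) A Z (s : seq ((nat -> C) * C)) :
  tends a A -> tends z Z -> cabs Z < 1 ->
  eachP (fun p => [/\ tends p.1 p.2, p.2 != 0 &
     forall n, qfac q (A * q / p.2) n != 0]) s ->
  tends (fun m => usum (a m) [seq p.1 m | p <- s] (z m))
    (usum A [seq p.2 | p <- s] Z).
Proof.
move=> ha hz Z1 hs; have [r r01 Zr] := between1 Z1 (cabs_ge0 _).
exact: tame_series r01 (tame_uterm ha hz Zr hs).
Qed.

(** The factors are rewritten by 1 - x q^-j = - x q^-j (1 - q^j/x) for j = 1, ..., n. *)
Lemma qfac_reverse x n : x != 0 -> qfac q (x * q ^- n) n =
  (- x) ^+ n * (\prod_(0 <= k < n) q ^- k.+1) * qfac q (q / x) n.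
Proof.
move=> x0; have q0 := base_neq0 q01.
elim: n => [|n IH]; first by rewrite !qfac0 big_geq // expr0 !mul1r.
rewrite qfacSl; have -> : x * q ^- n.+1 * q = x * q ^- n.
  by rewrite exprS; field; rewrite q0 expf_neq0.
rewrite IH big_nat_recr //= qfacS [(- x) ^+ n.+1]exprS [q ^+ n.+1]exprS.
move: (\prod_(_ <= _ < _) _) (qfac q (q / x) n) => P F.
have := expf_neq0 n q0; move: (q ^+ n) ((- x) ^+ n) => Q X Q0.
by field; rewrite q0 x0 Q0.
Qed.

Lemma qpoch_ratio_neg a x n : a != 0 -> x != 0 ->
  qpoch q x (- n.+1%:Z) / qpoch q (a * q / x) (- n.+1%:Z) =
  qfac q (x / a) n.+1 / qfac q (q / x) n.+1 * (a * q / x ^+ 2) ^+ n.+1.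
Proof.
move=> a0 x0; have q0 := base_neq0 q01.
have aqx : a * q / x != 0 by rewrite !(mulf_neq0, invr_neq0).
rewrite -NegzE /= invrK !qfac_reverse //.
have -> : q / (a * q / x) = x / a by field; rewrite a0 q0 x0.
have -> : (a * q / x ^+ 2) ^+ n.+1 = (- (a * q / x)) ^+ n.+1 / (- x) ^+ n.+1.
  by rewrite -expr_div_n; congr (_ ^+ _); field.
have P0 : \prod_(0 <= k < n.+1) q ^- k.+1 != 0.
  by rewrite prodf_seq_neq0; apply/allP => k _ /=; rewrite invr_neq0 ?expf_neq0.
have X0 : (- x) ^+ n.+1 != 0 by rewrite expf_neq0 // oppr_eq0.
move: P0 X0.
move: (\prod_(_ <= _ < _) _) (qfac q (q / x) n.+1) (qfac q (x / a) n.+1)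
  ((- x) ^+ n.+1) ((- (a * q / x)) ^+ n.+1) => P F G X Y P0 X0.
(* When (q/x;q)_(n+1) = 0 both sides are 0, because 0^-1 = 0. *)
by have [->|F0] := eqVneq F 0; [rewrite !(mulr0, invr0, mul0r)|field; rewrite P0 X0 F0].
Qed.

Lemma bisum_tends (f : int -> C) k l : tends (series (fun n : nat => f n%:Z)) k ->
  tends (series (fun n : nat => f (- n.+1%:Z))) l -> bisum f = k + l.
Proof. by move=> h h'; rewrite /bisum (tends_lim h) (tends_lim h'). Qed.

Lemma psi88E (a b c d e z : C) :
  a != 0 -> b != 0 -> c != 0 -> d != 0 -> e != 0 ->
  z = b * c * d * e / (a * q) -> cabs (a * q / z) < 1 ->
  vwp_psi_defined q a [:: b; c; d; e; a / z; z] ->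
  psi88 q a b c d e (a / z) z (a * q / z) =
  vsum a [:: b; c; d; e; a / z; z] (a * q / z) / (1 - a).
Proof.
move=> a0 b0 c0 d0 e0 zE Z1 [a1 hx].
have q0 := base_neq0 q01.
have z0 : z != 0 by rewrite zE !(mulf_neq0, invr_neq0).
have az0 : a / z != 0 by rewrite !(mulf_neq0, invr_neq0).
have hn x n : x != 0 -> x \in [:: b; c; d; e; a / z; z] ->
    qfac q (a^-1 * q / (x / a)) n != 0.
  move=> x0 /hx/(_ n)[_]; rewrite qfac_reverse // !mulf_eq0 !negb_or => /andP[_].
  by have -> : a^-1 * q / (x / a) = q / x by field; rewrite a0 x0.
set Z := a * q / z in Z1 *; set s := [:: b; c; d; e; a / z; z] in hx hn *.
have s0 x : x \in s -> x != 0.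
  by rewrite !inE => /or4P[|||/or3P[||]] /eqP ->.
have s1 : tends (series (uterm a s Z)) (usum a s Z).
  apply: tends_usum_series => //; apply: eachP_mem => x xs.
  by split; [exact: s0|move=> n; exact: (hx x xs n).1].
have s2 : tends (series (uterm a^-1 [seq x / a | x <- s] Z))
    (usum a^-1 [seq x / a | x <- s] Z).
  apply: tends_usum_series => //; apply: eachP_mem => _ /mapP[x xs ->].
  split; first by rewrite mulf_neq0 ?invr_neq0 // s0.
  by move=> n; apply: hn => //; exact: s0.
rewrite /psi88 /vwp_psi -/s -/Z.
rewrite (@bisum_tends _ ((1 - a)^-1 * usum a s Z)
  ((- a / (1 - a)) * (usum a^-1 [seq x / a | x <- s] Z - (1 - a^-1)))).
- rewrite /vsum; move: (usum _ _ _) (usum _ _ _) => U U'.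
  by field; rewrite a1 a0.
- apply: eq_tends_series (tends_seriesZ _ s1) _ => n.
  rewrite /uterm -[2 * n%:Z]/((2 * n)%N%:Z) -!exprnP.
  by move: (\prod_(_ <- _) _) (_ ^+ (2 * n)) (Z ^+ n) => P Q W; ring.
- have s3 : tends (series (fun n => uterm a^-1 [seq x / a | x <- s] Z n.+1))
    (usum a^-1 [seq x / a | x <- s] Z - (1 - a^-1)).
    have := tendsB ((tends_shift _ _).2 s2) (tends_cst (1 - a^-1)).
    move=> /eq_tends; apply=> n; rewrite /series /= big_nat_recl //= uterm0.
    by rewrite addrC addrA addNr add0r.
  apply: eq_tends_series (tends_seriesZ _ s3) _ => n.
  rewrite /uterm /s !big_cons !big_nil !qpoch_ratio_neg //.
  have f x : a^-1 * q / (x / a) = q / x.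
    by rewrite invfM invrK; move: x^-1 => y; field.
  rewrite !f mulrN -[2 * n.+1%:Z]/((2 * n.+1)%N%:Z) -!exprnN.
  (* Here b c d e = a q z enters: these powers turn Z^-(n+1) into Z^(n+1) q^(2(n+1)), and the power
     of q converts 1 - a q^(-2(n+1)) into - a (1 - q^(2(n+1))/a). *)
  have key : (a * q / b ^+ 2) ^+ n.+1 * ((a * q / c ^+ 2) ^+ n.+1 *
     ((a * q / d ^+ 2) ^+ n.+1 * ((a * q / e ^+ 2) ^+ n.+1 *
     ((a * q / (a / z) ^+ 2) ^+ n.+1 * (a * q / z ^+ 2) ^+ n.+1)))) =
     Z ^+ n.+1 * Z ^+ n.+1 * q ^+ (2 * n.+1).
    rewrite exprM -!exprMn; congr (_ ^+ _); rewrite /Z zE; field.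
    by rewrite a0 b0 c0 d0 e0 q0.
  have ZN : Z ^+ n.+1 != 0 by rewrite expf_neq0 // /Z !(mulf_neq0, invr_neq0).
  have qN : q ^+ (2 * n.+1) != 0 by rewrite expf_neq0.
  move: key ZN qN; move: (q ^+ (2 * n.+1)) (Z ^+ n.+1) => Q W.
  move: (_ ^+ n.+1) => g1; move: (_ ^+ n.+1) => g2; move: (_ ^+ n.+1) => g3.
  move: (_ ^+ n.+1) => g4; move: (_ ^+ n.+1) => g5; move: (_ ^+ n.+1) => g6.
  do 5!(move: (_ / qfac q _ _)); move: (_ / qfac q _ _) => r1 r2 r3 r4 r5 r6.
  move=> key W0 Q0.
  transitivity ((1 - a / Q) / (1 - a) * (r1 * r2 * r3 * r4 * r5 * r6 *
    (g1 * (g2 * (g3 * (g4 * (g5 * g6)))))) / W); last by ring.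
  by rewrite key; field; rewrite a0 a1 W0 Q0.
Qed.

Lemma W87E a1 a4 a5 a6 a7 a8 Z : a1 != 0 -> cabs Z < 1 ->
  eachP (fun x => x != 0 /\ forall n, qfac q (a1 * q / x) n != 0)
    [:: a1; a4; a5; a6; a7; a8] ->
  W87 q a1 a4 a5 a6 a7 a8 Z = usum a1 [:: a1; a4; a5; a6; a7; a8] Z / (1 - a1).
Proof.
move=> a0 Z1 hs; apply: tends_lim; rewrite [X in tends _ X]mulrC.
apply: eq_tends_series (tends_seriesZ _ (tends_usum_series Z1 hs)) _ => n.
rewrite /uterm [in LHS]big_cons (_ : a1 * q / a1 = q) ?[_ / a1]mulrAC ?(mulfV a0) ?mul1r //.
by move: (\prod_(_ <- _) _) (Z ^+ n) (qpoch q a1 n / qpoch q q n) => P W r; ring.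
Qed.

Lemma tauV A x n : x != 0 ->
  tau q A x^-1 n = qfac q x n / qfac q (A * q / x) n * x^-1 ^+ n.
Proof.
move=> x0; rewrite /tau [A / x * q]mulrAC [RHS]mulrAC; congr (_ / _).
rewrite /qfac.
elim: n => [|n IH]; first by rewrite !big_geq // expr0 mulr1.
by rewrite !big_nat_recr //= IH exprS; field; rewrite x0.
Qed.

Lemma usum_tsum A x1 x2 x3 x4 : x1 != 0 -> x2 != 0 -> x3 != 0 -> x4 != 0 ->
  usum A [:: x1; x2; x3; x4] (A ^+ 2 * q / (x1 * x2 * x3 * x4)) =
  tsum q A x1^-1 x2^-1 x3^-1 x4^-1.
Proof.
move=> h1 h2 h3 h4; apply: eq_csum => n.
rewrite /uterm /tterm !big_cons big_nil !tauV //.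
have -> : (A ^+ 2 * q / (x1 * x2 * x3 * x4)) ^+ n = (A ^+ 2 * q) ^+ n *
   (x1^-1 ^+ n * x2^-1 ^+ n * x3^-1 ^+ n * x4^-1 ^+ n).
  by rewrite -!exprMn !invfM !mulrA.
move: (_ ^+ (2 * n)) ((A ^+ 2 * q) ^+ n) (x1^-1 ^+ n) (x2^-1 ^+ n) (x3^-1 ^+ n)
  (x4^-1 ^+ n) => Q K y1 y2 y3 y4.
by do 4!(move: (_ / qfac q _ _) => ?); ring.
Qed.

(** Bailey's 6psi6 sum with the reciprocals undone and the denominators cleared. *)
Lemma vsum4 A x1 x2 x3 x4 : A != 0 -> qinf q (A * q) != 0 -> qinf q (q / A) != 0 ->
  eachP (fun x => [/\ x != 0, qinf q (A * q / x) != 0 & qinf q (q / x) != 0])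
    [:: x1; x2; x3; x4] ->
  let Z := A ^+ 2 * q / (x1 * x2 * x3 * x4) in cabs Z < 1 ->
  qinf q Z
    * (qinf q (q / x1) * qinf q (q / x2) * qinf q (q / x3) * qinf q (q / x4))
    * (qinf q (A * q / x1) * qinf q (A * q / x2) * qinf q (A * q / x3)
       * qinf q (A * q / x4)) * vsum A [:: x1; x2; x3; x4] Z
  = qinf q A * qinf q (q / A) * qinf q q
    * (qinf q (A * q / (x1 * x2)) * qinf q (A * q / (x1 * x3))
       * qinf q (A * q / (x1 * x4)) * qinf q (A * q / (x2 * x3))
       * qinf q (A * q / (x2 * x4)) * qinf q (A * q / (x3 * x4))).
Proof.
move=> A0 Aq qA /= [[x10 n1 m1] [[x20 n2 m2] [[x30 n3 m3] [[x40 n4 m4] _]]]] hZ.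
have reg x : qinf q (A * q / x) != 0 -> qinf q (q / x) != 0 -> regular q A x^-1.
  move=> h h'; apply/andP; split; first by rewrite [A / x * q]mulrAC; exact: h.
  by rewrite [x^-1 * q]mulrC; exact: h'.
have vE : vsum A [:: x1; x2; x3; x4] (A ^+ 2 * q / (x1 * x2 * x3 * x4)) =
    tbil q A x1^-1 x2^-1 x3^-1 x4^-1.
  rewrite /vsum /tbil /= usum_tsum //.
  have -> : A ^+ 2 * q / (x1 * x2 * x3 * x4) =
     A^-1 ^+ 2 * q / (x1 / A * (x2 / A) * (x3 / A) * (x4 / A)).
    by field; rewrite A0 x10 x20 x30 x40.
  have y0 x : x != 0 -> x / A != 0 by move=> x0; rewrite mulf_neq0 ?invr_neq0.
  rewrite (usum_tsum A^-1 (y0 _ x10) (y0 _ x20) (y0 _ x30) (y0 _ x40)).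
  by rewrite (invf_div x1 A) (invf_div x2 A) (invf_div x3 A) (invf_div x4 A).
have e : A ^+ 2 * q / (x1 * x2 * x3 * x4) = A ^+ 2 * q / x1 / x2 / x3 / x4.
  by field; rewrite x10 x20 x30 x40.
have f x y : A * q / (x * y) = A * q / x / y by rewrite invfM mulrA.
rewrite vE e !f; rewrite e in hZ.
have h := tbil_value q01 A0 Aq qA (reg _ n1 m1) (reg _ n2 m2) (reg _ n3 m3) (reg _ n4 m4) hZ.
exact: h.
Qed.

End WellPoised.

(** * Contiguous relations *)

Section FieldIdentities.
Variable K : fieldType.
Implicit Types A x X b c z f g : K.

Definition lam A x X := (1 - x * X) * (1 - A / x * X).

Definition trace A x := x + A / x.

(** The factor is affine in [trace A x], so its values at three parameters are linearly dependent,
    with differences of traces as coefficients. *)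
Lemma lamE A x X : x != 0 -> lam A x X = 1 + A * X ^+ 2 - X * trace A x.
Proof. by move=> x0; rewrite /lam /trace; field. Qed.

Lemma lam_mirror A x : A != 0 -> x != 0 -> lam A^-1 (x / A) 1 = lam A x 1 / A.
Proof. by move=> A0 x0; rewrite /lam; field; rewrite A0 x0. Qed.

Lemma trace_mirror A x : A != 0 -> x != 0 -> trace A^-1 (x / A) = trace A x / A.
Proof. by move=> A0 x0; rewrite /trace; field; rewrite A0 x0. Qed.

(** Raising b or c by a factor q inserts lam_b(X)/lam_b(1) or lam_c(X)/lam_c(1) into the term, and
    the pair A/z, z contributes lam_z(1)/lam_z(X); the linear dependence of the three factors
    cancels lam_z(X). *)
Lemma lam_insertion A b c z X P W rb rc rd re r1 r2 lb lc lz :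
  b != 0 -> c != 0 -> z != 0 -> lb != 0 -> lc != 0 -> lam A z X != 0 ->
  r1 * r2 = lz / lam A z X ->
  (trace A c - trace A z) * lb *
    (P * (rb * lam A b X / lb * (rc * (rd * (re * (r1 * (r2 * 1)))))) * W)
  + (trace A z - trace A b) * lc *
    (P * (rb * (rc * lam A c X / lc * (rd * (re * (r1 * (r2 * 1)))))) * W)
  = lz * (trace A c - trace A b) * (P * (rb * (rc * (rd * (re * 1)))) * W).
Proof.
move=> b0 c0 z0 lb0 lc0; rewrite !mulr1 !lamE // => lz0 ->.
by field; rewrite lz0 lb0 lc0.
Qed.

(* The coefficient of the contiguous relation, namely the value at X = 1/f of the
   quotient of prod (1 - x X) - prod (1 - A X/x) by (1 - A X^2) X, up to f. *)
Definition kap A f g h1 h2 h3 := - f ^+ 2 * (1 - f^-1) * (1 - A / (f * g)) *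
  (1 - A / (f * h1)) * (1 - A / (f * h2)) * (1 - A / (f * h3)).

(** By the balance, the X^6 terms cancel and the difference vanishes at A X^2 = 1; it also vanishes
    at X = 0. The quadratic quotient has the symmetry X -> 1/(A X), hence is a combination of lam_f
    and lam_g, with coefficients read off at X = 1/g and X = 1/f. *)
Lemma six_products A f g h1 h2 h3 X :
  A != 0 -> f != 0 -> g != 0 -> h1 != 0 -> h2 != 0 -> h3 != 0 ->
  f * g * h1 * h2 * h3 = A ^+ 2 ->
  (trace A g - trace A f) *
  ((1 - A * X) * (1 - f * X) * (1 - g * X) * (1 - h1 * X) * (1 - h2 * X) * (1 - h3 * X)
   - (1 - X) * (1 - A / f * X) * (1 - A / g * X) * (1 - A / h1 * X) * (1 - A / h2 * X)
     * (1 - A / h3 * X)) =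
  (1 - A * X ^+ 2) * X *
   (kap A g f h1 h2 h3 * lam A f X - kap A f g h1 h2 h3 * lam A g X).
Proof.
move=> A0 f0 g0 h10 h20 h30 hp.
have -> : h3 = A ^+ 2 / (f * g * h1 * h2).
  by rewrite -hp; field; rewrite f0 g0 h10 h20.
rewrite /trace /kap /lam; field.
by rewrite A0 f0 g0 h10 h20.
Qed.

Lemma quotient_shift x t X F1 F2 F3 F4 :
  F1 * (1 - x * X) = (1 - x) * F2 -> F3 * (1 - t * X) = (1 - t) * F4 ->
  1 - x != 0 -> 1 - t != 0 -> F3 != 0 -> F4 != 0 ->
  F2 / F3 = F1 / F4 * ((1 - x * X) * (1 - t * X)) / ((1 - x) * (1 - t)).
Proof.
move=> e1 e2 x1 t1 F30 F40.
have -> : F2 = F1 * (1 - x * X) / (1 - x) by rewrite e1 mulrAC mulfV ?mul1r.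
have e3 : (1 - t * X) / (1 - t) = F4 / F3.
  by apply/eqP; rewrite eqr_div // mulrC e2 mulrC.
transitivity (F1 / F4 * (1 - x * X) / (1 - x) * ((1 - t * X) / (1 - t))).
  by rewrite e3; field; rewrite F30 F40 x1.
by field; rewrite F40 x1 t1.
Qed.

Lemma quotient_pair x t X F1 F2 F3 F4 :
  F1 * (1 - x * X) = (1 - x) * F2 -> F3 * (1 - t * X) = (1 - t) * F4 ->
  1 - x * X != 0 -> 1 - t * X != 0 -> F2 != 0 -> F4 != 0 ->
  F3 / F2 * (F1 / F4) = (1 - x) * (1 - t) / ((1 - x * X) * (1 - t * X)).
Proof.
move=> e1 e2 x1 t1 F20 F40.
have e3 : F1 / F2 = (1 - x) / (1 - x * X) by apply/eqP; rewrite eqr_div // e1.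
have e4 : F3 / F4 = (1 - t) / (1 - t * X) by apply/eqP; rewrite eqr_div // e2.
transitivity ((F1 / F2) * (F3 / F4)); first by field; rewrite F20 F40.
by rewrite e3 e4; field; rewrite x1 t1.
Qed.

End FieldIdentities.

(** * Generic parameters and the contiguous relation of unilateral sums *)

Section Contiguity.
Local Open Scope classical_set_scope.
Variables (R : realType) (q : R[i]).
Hypothesis q01 : 0 < `|q| < 1.
Local Notation C := (R[i]).
Implicit Types (x y A Z b c d e z f g : C).
Local Notation usum := (usum q).
Local Notation vsum := (vsum q).

(** Invariant under inversion and under multiplication by powers of q, so one hypothesis covers a
    whole q-orbit. *)
Definition generic x := forall n : int, x * q ^ n != 1.

Lemma genericV x : generic x -> generic x^-1.
Proof.
move=> h n; apply: contraNneq (h (- n)) => e.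
by rewrite -[x * _]invrK invfM invr_expz opprK e invr1.
Qed.

Lemma genericMX x k : generic x -> generic (x * q ^+ k).
Proof.
by move=> h n; rewrite -mulrA exprnP -expfzDr ?base_neq0 //; exact: h.
Qed.

Lemma genericM x : generic x -> generic (x * q).
Proof. by move=> /(genericMX 1); rewrite expr1. Qed.

Lemma generic_div x y : generic (x / y) -> generic (y / x).
Proof. by move=> /genericV; rewrite invf_div. Qed.

Lemma genericMq x y : generic (x / y) -> generic (x * q / y).
Proof. by move=> /genericM; rewrite mulrAC. Qed.

Lemma generic_neq1 x : generic x -> 1 - x != 0.
Proof. by move=> /(_ 0); rewrite expr0z mulr1 subr_eq0 eq_sym. Qed.

Lemma generic_factor x n : generic x -> 1 - x * q ^+ n != 0.
Proof. by move=> /(_ n); rewrite -exprnP subr_eq0 eq_sym. Qed.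

Lemma generic_qfac x n : generic x -> qfac q x n != 0.
Proof.
move=> h; rewrite /qfac prodf_seq_neq0; apply/allP => k _ /=.
exact: generic_factor.
Qed.

Lemma generic_qinf x : generic x -> qinf q x != 0.
Proof. by move=> h; apply/(qinf_neq0P q01) => n; exact: generic_qfac. Qed.

(** Rules out zero denominators in both halves at base A, and is preserved by the mirror x -> x/A, A
    -> 1/A and by x -> A/x. *)
Definition gpar A x := [/\ x != 0, generic x & generic (x / A)].

Lemma gpar_mirror A x : A != 0 -> gpar A x -> gpar A^-1 (x / A).
Proof.
move=> A0 [x0 h1 h2]; split=> //; first by rewrite mulf_neq0 ?invr_neq0.
by rewrite invrK divfK.
Qed.

Lemma gpar_dual A x : A != 0 -> gpar A x -> gpar A (A / x).
Proof.
move=> A0 [x0 h1 h2]; split; first by rewrite mulf_neq0 ?invr_neq0.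
  exact: generic_div.
by rewrite mulrAC mulfV // mul1r; exact: genericV.
Qed.

Lemma gpar_qfac A x n : gpar A x -> qfac q (A * q / x) n != 0.
Proof.
by move=> [x0 h1 h2]; apply: generic_qfac; apply: genericMq; exact: generic_div.
Qed.

Lemma gparM A x : gpar A x -> gpar A (x * q).
Proof.
move=> [x0 h1 h2]; split; first by rewrite mulf_neq0 // base_neq0.
  exact: genericM.
exact: genericMq.
Qed.

Lemma eachP_imply (T : Type) (P Q : T -> Prop) (s : seq T) :
  (forall t, P t -> Q t) -> eachP P s -> eachP Q s.
Proof. by move=> h; elim: s => //= t s IH [/h p /IH]. Qed.

Lemma tends_usum_generic A s Z : cabs Z < 1 -> eachP (gpar A) s ->
  tends (series (uterm q A s Z)) (usum A s Z).
Proof.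
move=> Z1 hs; apply: tends_usum_series => //; apply: eachP_imply hs => x h.
by split=> [|n]; [case: h|exact: gpar_qfac].
Qed.

Local Notation ratio A x n := (qfac q x n / qfac q (A * q / x) n).

Lemma ratio_shift A x n : gpar A x ->
  ratio A (x * q) n = ratio A x n * lam A x (q ^+ n) / lam A x 1.
Proof.
move=> hx; have [x0 h1 h2] := hx; have h3 := generic_div h2.
have e1 : qfac q x n * (1 - x * q ^+ n) = (1 - x) * qfac q (x * q) n.
  by rewrite -qfacS qfacSl.
have e2 : qfac q (A / x) n * (1 - A / x * q ^+ n) = (1 - A / x) * qfac q (A * q / x) n.
  by rewrite -qfacS qfacSl mulrAC.
have -> : A * q / (x * q) = A / x by field; rewrite x0 base_neq0.
have n1 := generic_neq1 h1; have n2 := generic_neq1 h3.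
have n3 := generic_qfac n h3; have n4 := gpar_qfac n hx.
rewrite /lam !mulr1.
exact: (quotient_shift e1 e2 n1 n2 n3 n4).
Qed.

(** The denominators belong to z q and A q/z, one shift away from the numerators, so only the end
    factors survive. *)
Lemma ratio_pair A z n : A != 0 -> gpar A z ->
  ratio A (A / z) n * ratio A z n = lam A z 1 / lam A z (q ^+ n).
Proof.
move=> A0 hz; have [z0 h1 h2] := hz; have h3 := generic_div h2.
have -> : A * q / (A / z) = z * q by field; rewrite A0 z0.
have e1 : qfac q z n * (1 - z * q ^+ n) = (1 - z) * qfac q (z * q) n.
  by rewrite -qfacS qfacSl.
have e2 : qfac q (A / z) n * (1 - A / z * q ^+ n) = (1 - A / z) * qfac q (A * q / z) n.
  by rewrite -qfacS qfacSl mulrAC.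
have n1 := generic_neq1 h1; have n2 := generic_neq1 h3.
have n3 := generic_factor n h1; have n4 := generic_factor n h3.
have n5 := generic_qfac n (genericM h1); have n6 := gpar_qfac n hz.
rewrite /lam !mulr1.
exact: (quotient_pair e1 e2 n3 n4 n5 n6).
Qed.

Lemma lam_neq0 A x n : gpar A x -> lam A x (q ^+ n) != 0.
Proof.
move=> [x0 h1 h2]; rewrite /lam mulf_neq0 // generic_factor //.
exact: generic_div.
Qed.

Lemma lam1_neq0 A x : gpar A x -> lam A x 1 != 0.
Proof. by move=> /(lam_neq0 0); rewrite expr0. Qed.

Lemma usum_contiguity A b c d e z Z : A != 0 -> cabs Z < 1 ->
  eachP (gpar A) [:: b; c; d; e; z] ->
  (trace A c - trace A z) * lam A b 1 * usum A [:: b * q; c; d; e; A / z; z] Z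
  + (trace A z - trace A b) * lam A c 1 * usum A [:: b; c * q; d; e; A / z; z] Z
  = lam A z 1 * (trace A c - trace A b) * usum A [:: b; c; d; e] Z.
Proof.
move=> A0 Z1 /= [hb [hc [hd [he [hz _]]]]]; have hz' := gpar_dual A0 hz.
have s1 : eachP (gpar A) [:: b * q; c; d; e; A / z; z].
  by repeat (split; [first [assumption | exact: gparM]|]).
have {}s1 := tends_usum_generic Z1 s1.
have s2 : eachP (gpar A) [:: b; c * q; d; e; A / z; z].
  by repeat (split; [first [assumption | exact: gparM]|]).
have {}s2 := tends_usum_generic Z1 s2.
have s3 : eachP (gpar A) [:: b; c; d; e] by repeat (split; [assumption|]).
have {}s3 := tends_usum_generic Z1 s3.
apply: tends_unique (tends_seriesD (tends_seriesZ _ s1) (tends_seriesZ _ s2)) _.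
apply: eq_tends_series (tends_seriesZ _ s3) _ => n.
rewrite /uterm !big_cons !big_nil !ratio_shift //.
have [b0 _ _] := hb; have [c0 _ _] := hc; have [z0 _ _] := hz.
exact: esym (lam_insertion _ _ _ _ _ _ b0 c0 z0 (lam1_neq0 hb) (lam1_neq0 hc)
  (lam_neq0 n hz) (ratio_pair n A0 hz)).
Qed.

End Contiguity.

(** * The bilateral contiguous relation and the telescoping of the balanced 8W7 *)

Section Telescoping.
Local Open Scope classical_set_scope.
Variables (R : realType) (q : R[i]).
Hypothesis q01 : 0 < `|q| < 1.
Local Notation C := (R[i]).
Implicit Types (x y A Z b c d e z f g h : C).
Local Notation usum := (usum q).
Local Notation vsum := (vsum q).
Local Notation generic := (generic q).
Local Notation gpar := (gpar q).
Local Notation ratio A x n := (qfac q x n / qfac q (A * q / x) n).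

(** At base 1/A traces and factors [lam] are divided by A, so A^3 times the mirrored relation is
    subtracted; the linear dependence of the coefficients takes care of the correction A - 1. *)
Lemma bilateral_combination (K : fieldType) (A tb tc tz lb lc lz U1 U2 U3 V1 V2 V3 : K) :
  A != 0 -> (tc - tz) * lb + (tz - tb) * lc = lz * (tc - tb) ->
  (tc - tz) * lb * U1 + (tz - tb) * lc * U2 = lz * (tc - tb) * U3 ->
  (tc / A - tz / A) * (lb / A) * V1 + (tz / A - tb / A) * (lc / A) * V2
    = lz / A * (tc / A - tb / A) * V3 ->
  (tc - tz) * lb * (U1 - A * V1 + A - 1) + (tz - tb) * lc * (U2 - A * V2 + A - 1)
    = lz * (tc - tb) * (U3 - A * V3 + A - 1).
Proof.
move=> A0 e0 e1 e2.
transitivity ((tc - tz) * lb * U1 + (tz - tb) * lc * U2 - A ^+ 3 *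
  ((tc / A - tz / A) * (lb / A) * V1 + (tz / A - tb / A) * (lc / A) * V2)
  + (A - 1) * ((tc - tz) * lb + (tz - tb) * lc)); first by field.
by rewrite e0 e1 e2; field.
Qed.

Lemma vsum_contiguity A b c d e z Z : A != 0 -> cabs Z < 1 ->
  eachP (gpar A) [:: b; c; d; e; z] ->
  (trace A c - trace A z) * lam A b 1 * vsum A [:: b * q; c; d; e; A / z; z] Z
  + (trace A z - trace A b) * lam A c 1 * vsum A [:: b; c * q; d; e; A / z; z] Z
  = lam A z 1 * (trace A c - trace A b) * vsum A [:: b; c; d; e] Z.
Proof.
move=> A0 Z1 hs; have e1 := usum_contiguity q01 A0 Z1 hs.
move: hs => /= [hb [hc [hd [he [hz _]]]]].
have A0' : A^-1 != 0 by rewrite invr_neq0.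
have hs : eachP (gpar A^-1) [:: b / A; c / A; d / A; e / A; z / A].
  by repeat (split; [exact: gpar_mirror|]).
have e2 := usum_contiguity q01 A0' Z1 hs.
have [b0 _ _] := hb; have [c0 _ _] := hc; have [z0 _ _] := hz.
rewrite !(trace_mirror A0) // !(lam_mirror A0) // in e2.
have ez : A^-1 / (z / A) = A / z / A by field; rewrite A0 z0.
rewrite ez [b / A * q]mulrAC [c / A * q]mulrAC in e2.
apply: (bilateral_combination A0 _ e1 e2).
by rewrite !lamE //; ring.
Qed.

Lemma ratio_next A x n : x != 0 -> (forall k, qfac q (A * q / x) k != 0) ->
  ratio A x n.+1 * (1 - A / x * q ^+ n.+1) = ratio A x n * (1 - x * q ^+ n).
Proof.
move=> x0 h; have := h n.+1; have := h n.
have e : A * q / x * q ^+ n = A / x * q ^+ n.+1 by rewrite exprS; ring.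
rewrite !qfacS e mulf_eq0 negb_or.
move: (qfac q x n) (qfac q (A * q / x) n) (1 - _ * q ^+ n.+1) (1 - x * q ^+ n).
by move=> F1 F2 F3 F4 h1 /andP[_ h2]; field; rewrite h1 h2.
Qed.

Lemma tends_ratio A x : (forall k, qfac q (A * q / x) k != 0) ->
  tends (fun n => ratio A x n * (1 - A / x * q ^+ n)) (qinf q x / qinf q (A * q / x)).
Proof.
move=> h; rewrite -[X in tends _ X]mulr1; apply: tendsM.
  apply: tendsM (tends_qfac_qinf q01 x) (tendsV _ (tends_qfac_qinf q01 _)).
  exact/(qinf_neq0P q01).
rewrite -[X in tends _ X](subr0 1) -[X in 1 - X](mulr0 (A / x)).
exact: tendsB (tends_cst _) (tendsM (tends_cst _) (tends_expr0 q01)).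
Qed.

Lemma telescoping_step (K : fieldType) (A f g h1 h2 h3 X P r0 r1 r2 r3 r4 r5 lf lg : K) :
  A != 0 -> f != 0 -> g != 0 -> h1 != 0 -> h2 != 0 -> h3 != 0 ->
  f * g * h1 * h2 * h3 = A ^+ 2 -> lf != 0 -> lg != 0 -> P = 1 - A * X ^+ 2 ->
  kap A g f h1 h2 h3 * lf *
    (P * (r0 * (r1 * lam A f X / lf * (r2 * (r3 * (r4 * (r5 * 1)))))) * X)
  + - (kap A f g h1 h2 h3 * lg) *
    (P * (r0 * (r1 * (r2 * lam A g X / lg * (r3 * (r4 * (r5 * 1)))))) * X)
  = (trace A g - trace A f) *
    (r0 * (1 - A * X) * (r1 * (1 - f * X)) * (r2 * (1 - g * X)) * (r3 * (1 - h1 * X))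
       * (r4 * (1 - h2 * X)) * (r5 * (1 - h3 * X))
     - r0 * (1 - A / A * X) * (r1 * (1 - A / f * X)) * (r2 * (1 - A / g * X))
       * (r3 * (1 - A / h1 * X)) * (r4 * (1 - A / h2 * X)) * (r5 * (1 - A / h3 * X))).
Proof.
move=> A0 f0 g0 h10 h20 h30 hp lf0 lg0 ->.
have := six_products X A0 f0 g0 h10 h20 h30 hp; rewrite mulfV // mul1r.
move: (kap _ f _ _ _ _) (kap _ g _ _ _ _) (lam A f X) (lam A g X) => k1 k2 l1 l2 e.
transitivity (r0 * r1 * r2 * r3 * r4 * r5 *
  ((1 - A * X ^+ 2) * X * (k2 * l1 - k1 * l2))); first by field; rewrite lf0 lg0.
rewrite -e.
move: (trace A g - trace A f) (A / f) (A / g) (A / h1) (A / h2) (A / h3) => *.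
ring.
Qed.

Lemma usum6_contiguity A f g h1 h2 h3 :
  A != 0 -> f * g * h1 * h2 * h3 = A ^+ 2 ->
  eachP (gpar A) [:: f; g; h1; h2; h3] ->
  kap A g f h1 h2 h3 * lam A f 1 * usum A [:: A; f * q; g; h1; h2; h3] q
  - kap A f g h1 h2 h3 * lam A g 1 * usum A [:: A; f; g * q; h1; h2; h3] q
  = (trace A g - trace A f) *
    (qinf q A / qinf q q * (qinf q f / qinf q (A * q / f)) *
     (qinf q g / qinf q (A * q / g)) * (qinf q h1 / qinf q (A * q / h1)) *
     (qinf q h2 / qinf q (A * q / h2)) * (qinf q h3 / qinf q (A * q / h3))).
Proof.
move=> A0 hp /= [hf [hg [hh1 [hh2 [hh3 _]]]]].
have q1 : cabs q < 1 by have /andP[] := base_cabs q01.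
have Aq : A * q / A = q by rewrite mulrAC mulfV // mul1r.
have nq n : qfac q (A * q / A) n != 0.
  by rewrite Aq; move: n; apply/(qinf_neq0P q01); exact: qinf_q_neq0.
have P x : gpar A x -> x != 0 /\ forall n, qfac q (A * q / x) n != 0.
  by move=> h; split=> [|n]; [case: h|exact: gpar_qfac].
have sA : A != 0 /\ forall n, qfac q (A * q / A) n != 0 by [].
have s1 : eachP (fun x => x != 0 /\ forall n, qfac q (A * q / x) n != 0)
    [:: A; f * q; g; h1; h2; h3].
  split; first exact: sA.
  by repeat (split; [apply: P; first [assumption|exact: gparM]|]).
have {}s1 := tends_usum_series q01 q1 s1.
have s2 : eachP (fun x => x != 0 /\ forall n, qfac q (A * q / x) n != 0)
    [:: A; f; g * q; h1; h2; h3].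
  split; first exact: sA.
  by repeat (split; [apply: P; first [assumption|exact: gparM]|]).
have {}s2 := tends_usum_series q01 q1 s2.
(* For n >= 1 this is (x;q)_n/(A q/x;q)_(n-1). Over the common ratios, G (n+1) and G n become the
   two products of [six_products]; the limit of G gives the right-hand side, and G 0 = 0 because of
   the parameter A. *)
pose w x n := ratio A x n * (1 - A / x * q ^+ n).
pose G n := w A n * w f n * w g n * w h1 n * w h2 n * w h3 n.
have tw x : gpar A x -> tends (w x) (qinf q x / qinf q (A * q / x)).
  by move=> /P[_ h]; exact: tends_ratio.
have tG : tends G (qinf q A / qinf q q * (qinf q f / qinf q (A * q / f)) *
     (qinf q g / qinf q (A * q / g)) * (qinf q h1 / qinf q (A * q / h1)) *
     (qinf q h2 / qinf q (A * q / h2)) * (qinf q h3 / qinf q (A * q / h3))).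
  apply: tendsM (tw _ hh3); apply: tendsM (tw _ hh2); apply: tendsM (tw _ hh1).
  apply: tendsM (tw _ hg); apply: tendsM (tw _ hf).
  have tA := tends_ratio nq; have e : qinf q (A * q / A) = qinf q q by rewrite Aq.
  by rewrite e in tA; exact: tA.
have G0 : G 0%N = 0.
  have w0 : w A 0%N = 0 by rewrite /w expr0 (mulfV A0) [1 * 1]mulr1 subrr mulr0.
  by rewrite /G w0 !mul0r.
have := tends_telescope tG; rewrite G0 subr0 => {}tG.
apply: tends_unique _ (tends_seriesZ (trace A g - trace A f) tG).
rewrite -mulNr.
apply: eq_tends_series (tends_seriesD (tends_seriesZ _ s1) (tends_seriesZ _ s2)) _ => n.
have wS x : x != 0 /\ (forall n, qfac q (A * q / x) n != 0) ->
    w x n.+1 = ratio A x n * (1 - x * q ^+ n).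
  by move=> [x0 h]; exact: ratio_next.
rewrite /G (wS _ sA) (wS _ (P _ hf)) (wS _ (P _ hg)) (wS _ (P _ hh1)) (wS _ (P _ hh2))
  (wS _ (P _ hh3)).
rewrite /uterm !big_cons !big_nil (ratio_shift q01 n hf) (ratio_shift q01 n hg).
have [f0 _ _] := hf; have [g0 _ _] := hg; have [h10 _ _] := hh1.
have [h20 _ _] := hh2; have [h30 _ _] := hh3.
have eP : 1 - A * q ^+ (2 * n) = 1 - A * (q ^+ n) ^+ 2 by rewrite mulnC exprM.
exact: (telescoping_step _ _ _ _ _ _ A0 f0 g0 h10 h20 h30 hp (lam1_neq0 hf)
  (lam1_neq0 hg) eP).
Qed.

End Telescoping.

(** * The limit b q^N, c q^-N *)

Section PairLimit.
Local Open Scope classical_set_scope.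
Variables (R : realType) (q : R[i]).
Hypothesis q01 : 0 < `|q| < 1.
Local Notation C := (R[i]).
Implicit Types (x y A Z b c d e z f g h : C).
Local Notation usum := (usum q).
Local Notation vsum := (vsum q).
Local Notation generic := (generic q).
Local Notation gpar := (gpar q).
Local Notation ratio A x n := (qfac q x n / qfac q (A * q / x) n).

Lemma qfac_lower x : (forall n, qfac q x n != 0) ->
  exists2 k : R, 0 < k & forall n, k <= cabs (qfac q x n).
Proof.
move=> h; have [k [k0 [m _ hk]]] := qfac_ge q01 (tends_cst x) h.
by exists k => // n; exact: (hk m (leqnn m) n).
Qed.

Lemma qfac_upper x : exists2 k : R, 0 < k & forall n, cabs (qfac q x n) <= k.
Proof.
exists (expR (cabs x / (1 - cabs q))); first exact: expR_gt0.
by move=> n; exact: (qfac_le q01).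
Qed.

Lemma generic_reverse x : generic x -> forall n, qfac q (q / x) n != 0.
Proof.
move=> h n; apply: generic_qfac; rewrite mulrC; apply: (genericM q01).
exact: genericV.
Qed.

(** Reversing both q-factorials cancels the growing powers of q; besides (c/y)^n only products at
    q/c and q/y remain, bounded above and away from 0. *)
Lemma shift_ratio_small c y N n : c != 0 -> y != 0 -> generic c -> generic y ->
  (n <= N)%N ->
  qfac q (c * q ^- N) n / qfac q (y * q ^- N) n = (c / y) ^+ n *
   ((qfac q (q / c) N * qfac q (q / y) (N - n)) /
    (qfac q (q / c) (N - n) * qfac q (q / y) N)).
Proof.
move=> c0 y0 gc gy nN; have q0 := base_neq0 q01.
have red x : x != 0 -> generic x -> qfac q (x * q ^- N) n =
   (- x) ^+ n * (\prod_(0 <= k < N) q ^- k.+1 / \prod_(0 <= k < N - n) q ^- k.+1) *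
   (qfac q (q / x) N / qfac q (q / x) (N - n)).
  move=> x0 gx.
  have P0 m : \prod_(0 <= k < m) q ^- k.+1 != 0.
    by rewrite prodf_seq_neq0; apply/allP => k _ /=; rewrite invr_neq0 ?expf_neq0.
  have e1 := qfac_reverse q01 N x0; have e2 := qfac_reverse q01 (N - n) x0.
  have e3 := qfacD q (x * q ^- N) n (N - n); rewrite (subnKC nN) in e3.
  have e4 : x * q ^- N * q ^+ n = x * q ^- (N - n).
    by rewrite -{1}(subnKC nN) exprD invfM -!mulrA; congr (_ * _);
      rewrite mulrCA mulVf ?expf_neq0 // mulr1.
  rewrite e4 e2 in e3; rewrite e1 in e3.
  have m0 : (- x) ^+ (N - n) != 0 by rewrite expf_neq0 // oppr_eq0.
  have e5 : (- x) ^+ N = (- x) ^+ n * (- x) ^+ (N - n) by rewrite -exprD subnKC.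
  rewrite e5 in e3; move: e3 (P0 (N - n)%N) m0 (generic_reverse gx (N - n)).
  move: (qfac q (x * q ^- N) n) (qfac q (q / x) N) (qfac q (q / x) (N - n)) => F1 F2 F3.
  move: (\prod_(0 <= k < N) _) (\prod_(0 <= k < N - n) _) => P1 P2.
  move: ((- x) ^+ n) ((- x) ^+ (N - n)) => X1 X2 e P20 X20 F30.
  have n0 : X2 * P2 * F3 != 0 by rewrite !mulf_neq0.
  by apply: (mulIf n0); rewrite -e; field; rewrite P20 F30.
rewrite !red //.
have -> : (c / y) ^+ n = (- c) ^+ n / (- y) ^+ n.
  by rewrite -expr_div_n; congr (_ ^+ _); field.
have P0 m : \prod_(0 <= k < m) q ^- k.+1 != 0.
  by rewrite prodf_seq_neq0; apply/allP => k _ /=; rewrite invr_neq0 ?expf_neq0.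
have Y0 : (- y) ^+ n != 0 by rewrite expf_neq0 // oppr_eq0.
move: (P0 N) (P0 (N - n)%N) Y0 (generic_reverse gc (N - n)) (generic_reverse gy N)
  (generic_reverse gy (N - n)).
move: (qfac q (q / c) N) (qfac q (q / c) (N - n)) => F1 F2.
move: (qfac q (q / y) N) (qfac q (q / y) (N - n)) => F3 F4.
move: (\prod_(0 <= k < N) _) (\prod_(0 <= k < N - n) _) ((- c) ^+ n) ((- y) ^+ n).
move=> P1 P2 X Y h1 h2 h3 h4 h5 h6.
by field; rewrite h1 h2 h3 h4 h5 h6.
Qed.

(** The bound is uniform in N: reversal serves n <= N, and for n > N the product is split at N,
    after which the parameters are c and y again. The maximum with 1 is needed there, where the
    exponent is N instead of n. *)
Lemma shift_ratio_bound c y : c != 0 -> y != 0 -> generic c -> generic y ->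
  exists K : R, 0 <= K /\ forall N n,
   cabs (qfac q (c * q ^- N) n / qfac q (y * q ^- N) n) <=
   K * Num.max 1 (cabs (c / y)) ^+ n.
Proof.
move=> c0 y0 gc gy; have q0 := base_neq0 q01.
have [k1 k10 h1] := qfac_upper (q / c); have [k2 k20 h2] := qfac_upper (q / y).
have [k3 k30 h3] := qfac_upper c.
have [l1 l10 g1] := qfac_lower (generic_reverse gc).
have [l2 l20 g2] := qfac_lower (generic_reverse gy).
have [l3 l30 g3] := qfac_lower (fun n => generic_qfac n gy).
set M := Num.max 1 _.
have M1 : 1 <= M by rewrite /M le_max lexx.
have M0 : 0 <= M := le_trans ler01 M1.
have cyM : cabs (c / y) <= M by rewrite /M le_max lexx orbT.
pose K1 := (k1 * k2) / (l1 * l2); pose K2 := k1 / l2 * (k3 / l3).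
have K10 : 0 <= K1 by rewrite divr_ge0 // mulr_ge0 // ltW.
have K20 : 0 <= K2 by rewrite mulr_ge0 // divr_ge0 // ltW.
exists (K1 + K2); split; first exact: addr_ge0.
have quot (F G : C) (u l : R) : cabs F <= u -> 0 < l -> l <= cabs G -> cabs (F / G) <= u / l.
  move=> hF l0 hG; rewrite cabsM cabsV; apply: ler_pM; rewrite ?invr_ge0 ?cabs_ge0 //.
  by rewrite lef_pV2 // posrE (lt_le_trans l0 hG).
move=> N n; have [nN|Nn] := leqP n N.
  rewrite shift_ratio_small // cabsM cabsX mulrC; apply: ler_pM;
    rewrite ?exprn_ge0 ?cabs_ge0 //; last by rewrite lerXn2r ?nnegrE ?cabs_ge0.
  apply: le_trans (_ : K1 <= _); last by rewrite lerDl.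
  apply: quot; rewrite ?mulr_gt0 // cabsM; apply: ler_pM; rewrite ?cabs_ge0 //.
    exact: ltW.
  exact: ltW.
have e x : x * q ^- N * q ^+ N = x by rewrite divfK ?expf_neq0.
have -> : qfac q (c * q ^- N) n / qfac q (y * q ^- N) n =
   (c / y) ^+ N * (qfac q (q / c) N / qfac q (q / y) N *
     (qfac q c (n - N) / qfac q y (n - N))).
  rewrite -(subnKC (ltnW Nn)) !qfacD !e addKn.
  rewrite invfM mulrACA shift_ratio_small // subnn !qfac0 mulr1 mul1r.
  exact: esym (mulrA _ _ _).
rewrite cabsM cabsX mulrC; apply: ler_pM; rewrite ?exprn_ge0 ?cabs_ge0 //.
  apply: le_trans (_ : K2 <= _); last by rewrite lerDr.
  rewrite cabsM; apply: ler_pM; rewrite ?cabs_ge0 //; exact: quot.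
apply: le_trans (_ : M ^+ N <= _); first by rewrite lerXn2r ?nnegrE ?cabs_ge0.
by apply: (ler_weXn2l M1); exact: ltnW.
Qed.

Lemma tends_shift_ratio c y n : c != 0 -> y != 0 ->
  tends (fun N => qfac q (c * q ^- N) n / qfac q (y * q ^- N) n) ((c / y) ^+ n).
Proof.
move=> c0 y0; have q0 := base_neq0 q01.
(* After multiplication of numerator and denominator by q^N the quotient converges factor by
   factor. *)
have lim : (c / y) ^+ n =
    \prod_(0 <= j < n) ((0 - c * q ^+ j) / (0 - y * q ^+ j)).
  rewrite -[X in _ ^+ X]subn0 -prodr_const_nat; apply: eq_bigr => j _.
  by have := expf_neq0 j q0; move: (q ^+ j) => Q Q0; field; rewrite y0 Q0.
rewrite lim.
have t := @tends_prod R nat (index_iota 0 n)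
  (fun j N => (q ^+ N - c * q ^+ j) / (q ^+ N - y * q ^+ j))
  (fun j => (0 - c * q ^+ j) / (0 - y * q ^+ j)).
apply: eq_tends (t _) _ => [j|N].
  apply: tendsM; first exact: tendsB (tends_expr0 q01) (tends_cst _).
  apply: tendsV; last exact: tendsB (tends_expr0 q01) (tends_cst _).
  by rewrite sub0r oppr_eq0 mulf_neq0 ?expf_neq0.
rewrite /qfac -prodf_div; apply: eq_bigr => j _.
have N0 := expf_neq0 N q0.
have -> : 1 - c * q ^- N * q ^+ j = (q ^+ N - c * q ^+ j) / q ^+ N by field.
have -> : 1 - y * q ^- N * q ^+ j = (q ^+ N - y * q ^+ j) / q ^+ N by field.
move: (q ^+ N - c * _) (q ^+ N - y * _) N0; move: (q ^+ N) => Q F G Q0.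
(* If the denominator vanishes for this N, both quotients are 0. *)
have [->|G0] := eqVneq G 0; first by rewrite !(mul0r, mulr0, invr0).
by field; rewrite G0 Q0.
Qed.

(** The factors are paired crosswise: the numerator of b q^N with the denominator of c q^-N, both
    tending to 1, and the numerator of c q^-N with the denominator of b q^N, both unbounded but with
    a quotient tending to (b c/(A q))^n. *)
Lemma tame_pair A b c : A != 0 -> gpar A b -> gpar A c ->
  tame (Num.max 1 (cabs (b * c / (A * q))))
    (fun N n => ratio A (b * q ^+ N) n * ratio A (c * q ^- N) n)
    (fun n => (b * c / (A * q)) ^+ n).
Proof.
move=> A0 [b0 gb gbA] [c0 gc gcA]; have q0 := base_neq0 q01.
set M := Num.max _ _.
have M0 : 0 <= M by rewrite /M le_max ler01.
have y0 : A * q / b != 0 by rewrite !mulf_neq0 ?invr_neq0.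
have gy : generic (A * q / b) by apply: (genericMq q01); exact: generic_div.
have qN0 N : q ^+ N != 0 by rewrite expf_neq0.
have t1 : tame 1 (fun N n => qfac q (b * q ^+ N) n / qfac q (A * q / c * q ^+ N) n)
    (fun n => qfac q 0 n / qfac q 0 n).
  have t0 x : tends (fun N => x * q ^+ N) 0.
    by rewrite -(mulr0 x); exact: tendsM (tends_cst _) (tends_expr0 q01).
  have z0 n : qfac q 0 n != 0.
    by rewrite /qfac big1 ?oner_neq0 // => k _; rewrite mul0r subr0.
  rewrite -[1](mulr1 1); apply: tameM => //; first exact: tame_qfac.
  exact: tame_qfacV.
have t2 : tame M (fun N n => qfac q (c * q ^- N) n / qfac q (A * q / b * q ^- N) n)
    (fun n => (c / (A * q / b)) ^+ n).
  split=> [|n]; last exact: tends_shift_ratio.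
  have [K [K0 hK]] := shift_ratio_bound c0 y0 gc gy.
  exists K; split=> //; exists 0%N => // N _ n /=; apply: le_trans (hK N n) _.
  by have -> : c / (A * q / b) = b * c / (A * q) by field; rewrite A0 q0 b0.
rewrite -[M]mul1r; apply: tame_ext (tameM ler01 M0 t1 t2) => [N n|n].
  have -> : A * q / (b * q ^+ N) = A * q / b * q ^- N by rewrite invfM mulrA.
  have -> : A * q / (c * q ^- N) = A * q / c * q ^+ N by rewrite invfM invrK mulrA.
  move: (qfac q (b * q ^+ N) n) (qfac q (A * q / c * q ^+ N) n)^-1.
  move: (qfac q (c * q ^- N) n) (qfac q (A * q / b * q ^- N) n)^-1 => F1 F2 F3 F4.
  ring.
have -> : qfac q 0 n = 1.
  by rewrite /qfac big1 // => k _; rewrite mul0r subr0.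
rewrite divr1 mul1r; congr (_ ^+ _); by field; rewrite A0 q0 b0.
Qed.

Lemma tends_usum_pair A b c Z s : A != 0 -> gpar A b -> gpar A c ->
  eachP (fun x => x != 0 /\ forall n, qfac q (A * q / x) n != 0) s ->
  cabs Z < 1 -> cabs (Z * (b * c / (A * q))) < 1 ->
  tends (fun N => usum A [:: b * q ^+ N, c * q ^- N & s] Z)
    (usum A s (Z * (b * c / (A * q)))).
Proof.
move=> A0 hb hc hs Z1 ZW1; set W := b * c / (A * q) in ZW1 *.
have tp := tame_pair A0 hb hc; rewrite -/W in tp.
set M := Num.max _ _ in tp.
have M0 : 0 <= M by rewrite /M le_max ler01.
have MZ : M * cabs Z < 1.
  by rewrite /M maxEle; case: ifP => _; rewrite ?mul1r // mulrC -cabsM.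
have [r [Zr r0 Mr]] := enlarge M0 (cabs_ge0 Z) MZ.
have tr : tame r (fun=> uterm q A s Z) (uterm q A s Z).
  have := @tame_uterm R q q01 _ _ A Z [seq ((fun=> x), x) | x <- s] r
    (tends_cst A) (tends_cst Z) Zr.
  rewrite -map_comp map_id => h; apply: tame_ext (h _) => [m n||] //.
    by rewrite -map_comp map_id.
  elim: s hs {h} => //= x s IH [[x0 xn] /IH h]; split=> //; split=> //.
  exact: tends_cst.
have Mr1 : 0 <= M * r < 1 by rewrite Mr andbT mulr_ge0 // ltW.
apply: (tame_series Mr1).
apply: tame_ext (tameM M0 (ltW r0) tp tr) => [N n|n].
  rewrite /uterm !big_cons.
  move: (\prod_(_ <- _) _) (ratio A (b * q ^+ N) n) (ratio A (c * q ^- N) n).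
  by move=> P r1 r2; ring.
rewrite /uterm [(Z * W) ^+ n]exprMn; move: (\prod_(_ <- _) _) (W ^+ n) (Z ^+ n) => P w z; ring.
Qed.

End PairLimit.

(** * Theta functions *)

Section Theta.
Local Open Scope classical_set_scope.
Variables (R : realType) (q : R[i]).
Hypothesis q01 : 0 < `|q| < 1.
Local Notation C := (R[i]).
Implicit Types (x y A Z b c d e z w s t : C).
Local Notation usum := (usum q).
Local Notation vsum := (vsum q).
Local Notation generic := (generic q).
Local Notation gpar := (gpar q).

Definition theta x := qinf q x * qinf q (q / x).

Lemma thetaE x : theta x = (1 - x) * qinf q (x * q) * qinf q (q / x).
Proof. by rewrite /theta (qinfS q01 x). Qed.

Lemma thetaV x : x != 0 -> theta x^-1 = - theta x / x.
Proof.
move=> x0; rewrite thetaE /theta (qinfS q01 x) invrK [x^-1 * q]mulrC [q * x]mulrC.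
by move: (qinf q (q / x)) (qinf q (x * q)) => F G; field.
Qed.

Lemma theta_neq0 x : generic x -> theta x != 0.
Proof.
move=> h; apply: mulf_neq0; first exact: (generic_qinf q01).
by apply/(qinf_neq0P q01); exact: generic_reverse.
Qed.

Lemma cocycle_step (K : fieldType) (tw ts tt lw ls lt w1 s1 t1 P X r1 r2 r3 r4 r5 r6 : K) :
  w1 != 0 -> s1 != 0 -> t1 != 0 ->
  (tw - ts) * t1 + (ts - tt) * w1 + (tt - tw) * s1 = 0 ->
  r1 * r2 = lw / w1 -> r3 * r4 = ls / s1 -> r5 * r6 = lt / t1 ->
  (tw - ts) * lt * (P * (r2 * (r1 * (r4 * (r3 * 1)))) * X)
  + (ts - tt) * lw * (P * (r4 * (r3 * (r6 * (r5 * 1)))) * X)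
  + (tt - tw) * ls * (P * (r6 * (r5 * (r2 * (r1 * 1)))) * X) = 0.
Proof.
move=> w0 s0 t0 h e1 e2 e3.
transitivity (P * X * ((tw - ts) * lt * ((r1 * r2) * (r3 * r4))
  + (ts - tt) * lw * ((r3 * r4) * (r5 * r6))
  + (tt - tw) * ls * ((r5 * r6) * (r1 * r2)))); first by ring.
rewrite e1 e2 e3.
transitivity (P * X * (lw * ls * lt) / (w1 * s1 * t1) *
  ((tw - ts) * t1 + (ts - tt) * w1 + (tt - tw) * s1)); first by field; rewrite w0 s0 t0.
by rewrite h mulr0.
Qed.

Lemma trace_cocycle (K : fieldType) (A w s t X : K) : w != 0 -> s != 0 -> t != 0 ->
  (trace A w - trace A s) * lam A t X + (trace A s - trace A t) * lam A w X
  + (trace A t - trace A w) * lam A s X = 0.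
Proof. by move=> w0 s0 t0; rewrite !lamE //; ring. Qed.

(** A pair x, A/x contributes lam_x(1)/lam_x(X) with X = q^n, so the three terms cancel by the
    linear dependence of the factors. *)
Lemma usum_cocycle A w s t : A != 0 -> gpar A w -> gpar A s -> gpar A t ->
  (trace A w - trace A s) * lam A t 1 * usum A [:: w; A / w; s; A / s] q
  + (trace A s - trace A t) * lam A w 1 * usum A [:: s; A / s; t; A / t] q
  + (trace A t - trace A w) * lam A s 1 * usum A [:: t; A / t; w; A / w] q = 0.
Proof.
move=> A0 hw hs ht; have q1 : cabs q < 1 by have /andP[] := base_cabs q01.
have S x y : gpar A x -> gpar A y -> tends (series (uterm q A [:: x; A / x; y; A / y] q))
    (usum A [:: x; A / x; y; A / y] q).
  move=> hx hy; apply: (tends_usum_generic q01 q1).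
  by repeat (split; [first [assumption | exact: gpar_dual]|]).
have [w0 _ _] := hw; have [s0 _ _] := hs; have [t0 _ _] := ht.
apply: tends_unique (tends_seriesD (tends_seriesD (tends_seriesZ _ (S _ _ hw hs))
  (tends_seriesZ _ (S _ _ hs ht))) (tends_seriesZ _ (S _ _ ht hw))) _.
apply: eq_tends (tends_cst 0) _ => n; rewrite /series /= big1 // => k _.
rewrite /uterm !big_cons !big_nil.
exact: (cocycle_step _ _ (lam_neq0 k hw) (lam_neq0 k hs) (lam_neq0 k ht)
  (trace_cocycle A (q ^+ k) w0 s0 t0) (ratio_pair q01 k A0 hw)
  (ratio_pair q01 k A0 hs) (ratio_pair q01 k A0 ht)).
Qed.

Lemma bilateral_cocycle (K : fieldType) (A tw ts tt lw ls lt U1 U2 U3 V1 V2 V3 : K) :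
  A != 0 -> (tw - ts) * lt + (ts - tt) * lw + (tt - tw) * ls = 0 ->
  (tw - ts) * lt * U1 + (ts - tt) * lw * U2 + (tt - tw) * ls * U3 = 0 ->
  (tw / A - ts / A) * (lt / A) * V1 + (ts / A - tt / A) * (lw / A) * V2
    + (tt / A - tw / A) * (ls / A) * V3 = 0 ->
  (tw - ts) * (U1 - A * V1 + A - 1) * lt + (ts - tt) * (U2 - A * V2 + A - 1) * lw
    + (tt - tw) * (U3 - A * V3 + A - 1) * ls = 0.
Proof.
move=> A0 e0 e1 e2.
transitivity ((tw - ts) * lt * U1 + (ts - tt) * lw * U2 + (tt - tw) * ls * U3 -
  A ^+ 3 * ((tw / A - ts / A) * (lt / A) * V1 + (ts / A - tt / A) * (lw / A) * V2
    + (tt / A - tw / A) * (ls / A) * V3)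
  + (A - 1) * ((tw - ts) * lt + (ts - tt) * lw + (tt - tw) * ls)); first by field.
by rewrite e0 e1 e2; ring.
Qed.

Lemma vsum_cocycle A w s t : A != 0 -> gpar A w -> gpar A s -> gpar A t ->
  (trace A w - trace A s) * vsum A [:: w; A / w; s; A / s] q * lam A t 1
  + (trace A s - trace A t) * vsum A [:: s; A / s; t; A / t] q * lam A w 1
  + (trace A t - trace A w) * vsum A [:: t; A / t; w; A / w] q * lam A s 1 = 0.
Proof.
move=> A0 hw hs ht; have e1 := usum_cocycle A0 hw hs ht.
have A0' : A^-1 != 0 by rewrite invr_neq0.
have e2 := usum_cocycle A0' (gpar_mirror A0 hw) (gpar_mirror A0 hs) (gpar_mirror A0 ht).
have [w0 _ _] := hw; have [s0 _ _] := hs; have [t0 _ _] := ht.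
rewrite !(trace_mirror A0) // !(lam_mirror A0) // in e2.
have ez x : x != 0 -> A^-1 / (x / A) = A / x / A by move=> x0; field; rewrite A0 x0.
rewrite (ez _ w0) (ez _ s0) (ez _ t0) in e2.
exact: (bilateral_cocycle A0 (trace_cocycle A 1 w0 s0 t0) e1 e2).
Qed.

Lemma theta_quotient_step (K : fieldType)
    (A w s F Q W1 W2 W3 W4 S1 S2 S3 S4 D1 D2 D3 D4 V : K) :
  w != 0 -> s != 0 -> Q != 0 ->
  Q * (W1 * W2 * S1 * S2) * (W3 * W4 * S3 * S4) * V =
    F * Q * (Q * D1 * D2 * D3 * D4 * Q) ->
  (trace A w - trace A s) * V *
    (((1 - w) * W4 * W1) * ((1 - A / w) * W3 * W2) *
     (((1 - s) * S4 * S1) * ((1 - A / s) * S3 * S2))) =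
  F * Q ^+ 2 * lam A w 1 * lam A s 1 *
  (w * (((1 - A / (w * s)) * D1 * D4) * ((1 - s / w) * D2 * D3))).
Proof.
move=> w0 s0 Q0 e.
have {}e : (W1 * W2 * S1 * S2) * (W3 * W4 * S3 * S4) * V =
    F * Q ^+ 2 * (D1 * D2 * D3 * D4).
  by apply: (mulfI Q0); rewrite !mulrA in e *; rewrite e; ring.
transitivity ((trace A w - trace A s) * ((1 - w) * (1 - A / w) * (1 - s) * (1 - A / s)) *
  ((W1 * W2 * S1 * S2) * (W3 * W4 * S3 * S4) * V)).
  by move: (trace A w - trace A s) (1 - A / w) (1 - A / s) => *; ring.
by rewrite e /trace /lam; field; rewrite w0 s0.
Qed.

(** With parameters w, A/w, s, A/s the argument of Bailey's sum is q, and its products combine in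
    pairs into theta functions. *)
Lemma vsum_theta A w s : A != 0 -> generic A -> gpar A w -> gpar A s ->
  (trace A w - trace A s) * vsum A [:: w; A / w; s; A / s] q *
    (theta w * theta (A / w) * (theta s * theta (A / s))) =
  (qinf q A * qinf q (q / A)) * qinf q q ^+ 2 * lam A w 1 * lam A s 1 *
  (w * (theta (A / (w * s)) * theta (s / w))).
Proof.
move=> A0 gA hw hs; have q1 : cabs q < 1 by have /andP[] := base_cabs q01.
have q0 := base_neq0 q01.
have hw' := gpar_dual A0 hw; have hs' := gpar_dual A0 hs.
have [w0 gw _] := hw; have [s0 gs _] := hs.
have P x : gpar A x -> [/\ x != 0, qinf q (A * q / x) != 0 & qinf q (q / x) != 0].
  move=> hx; have [x0 gx _] := hx; split=> //.
    by apply/(qinf_neq0P q01) => n; exact: gpar_qfac.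
  by apply/(qinf_neq0P q01); exact: generic_reverse.
have hl : eachP (fun x => [/\ x != 0, qinf q (A * q / x) != 0 & qinf q (q / x) != 0])
    [:: w; A / w; s; A / s] by repeat (split; [exact: P|]).
have eZ : A ^+ 2 * q / (w * (A / w) * s * (A / s)) = q by field; rewrite A0 w0 s0.
have := vsum4 q01 A0 (generic_qinf q01 (genericM q01 gA))
  ((qinf_neq0P q01 _).2 (generic_reverse q01 gA)) hl.
rewrite /= eZ => /(_ q1).
have -> : A * q / (w * (A / w)) = q by field; rewrite A0 w0.
have -> : A * q / (s * (A / s)) = q by field; rewrite A0 s0.
have -> : A * q / (w * (A / s)) = s / w * q by field; rewrite A0 w0 s0.
have -> : A * q / (A / w * s) = q / (s / w) by field; rewrite A0 w0 s0.
have -> : A * q / (A / w * (A / s)) = q / (A / (w * s)) by field; rewrite A0 w0 s0.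
have -> : A * q / (A / w) = w * q by field; rewrite A0 w0.
have -> : A * q / (A / s) = s * q by field; rewrite A0 s0.
have -> : A * q / w = A / w * q by rewrite mulrAC.
have -> : A * q / s = A / s * q by rewrite mulrAC.
have -> : A * q / (w * s) = A / (w * s) * q by rewrite mulrAC.
rewrite !thetaE => e.
exact: (theta_quotient_step A w0 s0 (qinf_q_neq0 q01) e).
Qed.

Lemma weierstrass_step (K : fieldType) (F tw ts tt lw ls lt V1 V2 V3 Tw Ts Tt E1 E2 E3 : K) :
  F != 0 -> lw != 0 -> ls != 0 -> lt != 0 ->
  (tw - ts) * V1 * lt + (ts - tt) * V2 * lw + (tt - tw) * V3 * ls = 0 ->
  (tw - ts) * V1 * (Tw * Ts) = F * lw * ls * E1 ->
  (ts - tt) * V2 * (Ts * Tt) = F * ls * lt * E2 ->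
  (tt - tw) * V3 * (Tt * Tw) = F * lt * lw * E3 ->
  E1 * Tt + E2 * Tw + E3 * Ts = 0.
Proof.
move=> F0 lw0 ls0 lt0 e e1 e2 e3.
have n0 : F * lw * ls * lt != 0 by rewrite !mulf_neq0.
apply: (mulfI n0); rewrite mulr0.
transitivity ((F * lw * ls * E1) * lt * Tt + (F * ls * lt * E2) * lw * Tw
  + (F * lt * lw * E3) * ls * Ts); first by ring.
rewrite -e1 -e2 -e3.
transitivity (Tw * Ts * Tt * ((tw - ts) * V1 * lt + (ts - tt) * V2 * lw
  + (tt - tw) * V3 * ls)); first by ring.
by rewrite e mulr0.
Qed.

(* Since (trace w - trace s) X / (lam_w lam_s) = 1/lam_s - 1/lam_w up to sign, the
   6psi6 sums with parameters w, A/w, s, A/s form an additive cocycle. *)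
Lemma weierstrass A w s t : A != 0 -> generic A -> gpar A w -> gpar A s -> gpar A t ->
  w * (theta (A / (w * s)) * theta (s / w)) * (theta t * theta (A / t))
  + s * (theta (A / (s * t)) * theta (t / s)) * (theta w * theta (A / w))
  + t * (theta (A / (t * w)) * theta (w / t)) * (theta s * theta (A / s)) = 0.
Proof.
move=> A0 gA hw hs ht.
have F0 : qinf q A * qinf q (q / A) * qinf q q ^+ 2 != 0.
  apply: mulf_neq0; last by rewrite expf_neq0 // qinf_q_neq0.
  exact: theta_neq0.
exact: (weierstrass_step F0 (lam1_neq0 hw) (lam1_neq0 hs) (lam1_neq0 ht)
  (vsum_cocycle A0 hw hs ht) (vsum_theta A0 gA hw hs) (vsum_theta A0 gA hs ht)
  (vsum_theta A0 gA ht hw)).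
Qed.

Lemma theta_collect (K : fieldType) (c d z E Dz Cz M Te Td Tc N DE Tz CD CE : K) :
  c != 0 -> d != 0 -> z != 0 ->
  c * (E * Dz) * (Cz * M) + c * d / z * (Te * (- Td / d)) * (Tc * N)
    + c / z * (DE * Tz) * (CD * CE) = 0 ->
  Dz * E * M * Cz = - Tz / z * DE * CE * CD + z^-1 * Tc * Td * Te * N.
Proof.
move=> c0 d0 z0 h; apply: (mulfI c0); apply/eqP; rewrite -subr_eq0; apply/eqP.
by rewrite -[RHS]h; field; rewrite d0 z0.
Qed.

(** Weierstrass' relation at w = c, s = c d/z, t = c/z, with A chosen so that A/(w s), A/(s t), A/(t
    w) are e/z, e, d e/z. *)
Lemma theta_three_term c d e z : c != 0 -> d != 0 -> e != 0 -> z != 0 ->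
  let A := c ^+ 2 * d * e / z ^+ 2 in
  generic A -> gpar A c -> gpar A (c * d / z) -> gpar A (c / z) ->
  theta (d / z) * theta (e / z) * theta (c * d * e / z) * theta (c / z) =
  theta z^-1 * theta (d * e / z) * theta (c * e / z) * theta (c * d / z)
  + z^-1 * theta c * theta d * theta e * theta (c * d * e / z ^+ 2).
Proof.
move=> c0 d0 e0 z0 A gA hw hs ht.
have A0 : A != 0 by rewrite /A !mulf_neq0 ?invr_neq0 ?expf_neq0.
have := weierstrass A0 gA hw hs ht.
have -> : A / (c * (c * d / z)) = e / z by rewrite /A; field; rewrite c0 d0 z0.
have -> : c * d / z / c = d / z by field; rewrite c0 z0.
have -> : A / (c / z) = c * d * e / z by rewrite /A; field; rewrite c0 z0.
have -> : A / (c * d / z * (c / z)) = e by rewrite /A; field; rewrite c0 d0 z0.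
have -> : c / z / (c * d / z) = d^-1 by field; rewrite c0 d0 z0.
have -> : A / c = c * d * e / z ^+ 2 by rewrite /A; field; rewrite c0 z0.
have -> : A / (c / z * c) = d * e / z by rewrite /A; field; rewrite c0 z0.
have -> : c / (c / z) = z by field; rewrite c0 z0.
have -> : A / (c * d / z) = c * e / z by rewrite /A; field; rewrite c0 d0 z0.
rewrite (thetaV d0) (thetaV z0).
exact: (theta_collect c0 d0 z0).
Qed.

End Theta.

(** * The defect of the identity *)

Section Coefficients.
Variable K : fieldType.
Implicit Types a b c d e z : K.

(** The factor that carries the contiguous relation of the 8W7, at base 1/z, into that of the 8psi8,
    at base a. The next three lemmas compare the coefficients of the two shifted sums and the
    boundary term. *)
Definition mult a b c z := z * a / ((1 - c / z) * (1 - b / z) * (1 - z / (b * c))).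

Lemma mult_left a b c d e z :
  a != 0 -> b != 0 -> c != 0 -> d != 0 -> e != 0 -> z != 0 ->
  b * c * d * e = a * z -> 1 - a / b != 0 -> 1 - b / z != 0 -> 1 - c / z != 0 ->
  1 - z / (b * c) != 0 ->
  (trace a c - trace a z) * lam a b 1 *
    ((1 - a / (b * d)) * (1 - a / (b * e)) / ((1 - a / b) * (1 - c / z)))
  = mult a b c z * (kap z^-1 (c / z) (b / z) (d / z) (e / z) (z / a)
     * lam z^-1 (b / z) 1).
Proof.
move=> a0 b0 c0 d0 e0 z0 he n1 n2 n3 n4.
have ez : e = a * z / (b * c * d) by rewrite -he; field; rewrite b0 c0 d0.
have m1 : b - a != 0 by apply: contra n1; rewrite !subr_eq0 => /eqP <-; rewrite divff.
have m2 : z - b != 0 by apply: contra n2; rewrite !subr_eq0 => /eqP <-; rewrite divff.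
have m3 : z - c != 0 by apply: contra n3; rewrite !subr_eq0 => /eqP <-; rewrite divff.
have m4 : b * c - z != 0.
  by apply: contra n4; rewrite !subr_eq0 => /eqP ->; rewrite divff.
rewrite /trace /lam /kap /mult ez; field.
by rewrite a0 b0 c0 d0 z0 m1 m2 m3 m4.
Qed.

Lemma mult_right a b c d e z :
  a != 0 -> b != 0 -> c != 0 -> d != 0 -> e != 0 -> z != 0 ->
  b * c * d * e = a * z -> 1 - a / c != 0 -> 1 - b / z != 0 -> 1 - c / z != 0 ->
  1 - z / (b * c) != 0 ->
  (trace a z - trace a b) * lam a c 1 *
    ((1 - a / (c * d)) * (1 - a / (c * e)) / ((1 - a / c) * (1 - b / z)))
  = - (mult a b c z * (kap z^-1 (b / z) (c / z) (d / z) (e / z) (z / a)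
     * lam z^-1 (c / z) 1)).
Proof.
move=> a0 b0 c0 d0 e0 z0 he n1 n2 n3 n4.
rewrite -opprB mulNr mulNr; congr (- _).
have := mult_left a0 c0 b0 d0 e0 z0; rewrite [c * b]mulrC => h.
rewrite (h he n1 n3 n2 n4) /mult; congr (_ / _ * _).
by rewrite [c * b]mulrC [(1 - b / z) * _]mulrC.
Qed.

Lemma mult_trace a b c z : a != 0 -> b != 0 -> c != 0 -> z != 0 ->
  1 - b / z != 0 -> 1 - c / z != 0 -> 1 - z / (b * c) != 0 ->
  (1 - a / (b * c)) * mult a b c z * (trace z^-1 (c / z) - trace z^-1 (b / z)) *
    ((1 - z^-1) * (1 - b / z) * (1 - c / z) * (1 - z / a))
  = lam a z 1 * (trace a c - trace a b).
Proof.
move=> a0 b0 c0 z0 n2 n3 n4.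
have m2 : z - b != 0 by apply: contra n2; rewrite !subr_eq0 => /eqP <-; rewrite divff.
have m3 : z - c != 0 by apply: contra n3; rewrite !subr_eq0 => /eqP <-; rewrite divff.
have m4 : b * c - z != 0.
  by apply: contra n4; rewrite !subr_eq0 => /eqP ->; rewrite divff.
rewrite /trace /lam /mult; field.
by rewrite a0 b0 c0 z0 m2 m3 m4.
Qed.

(** Infinite products are variables here. The premise on U and U' is the telescoped relation of the
    8W7, the one on J is Bailey's sum, and those with m come from [mult]; after a common factor is
    taken out, the boundary term of the 8W7 is [lzt] times the 6psi6 J. *)
Lemma first_coefficient_step (tl tr lzt m kg kf sbc sbd sbe scd sce sb sc vb vc sz sza
    f1 Q q1 qa Za Zq Y N2 E B1 B2 B3 B4 DE Ab Ac Ad Ae Zb Zc Zd Ze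
    qb qc qd qe U U' J X : K) :
  Q != 0 -> Za != 0 -> Zq != 0 -> Y != 0 -> N2 != 0 -> Ab != 0 -> Ac != 0 -> Ad != 0 ->
  Ae != 0 -> Zb != 0 -> Zc != 0 -> Zd != 0 -> Ze != 0 -> qb != 0 -> qc != 0 ->
  qd != 0 -> qe != 0 -> sb != 0 -> sc != 0 -> vb != 0 -> vc != 0 ->
  tl * (sbd * sbe / (sb * vc)) = m * kg ->
  tr * (scd * sce / (sc * vb)) = - (m * kf) ->
  sbc * m * X * (sz * vb * vc * sza) = lzt ->
  kg * U' - kf * U = X * (sz * Zq / Q * (vb * Zb / qb) * (vc * Zc / qc) * (Zd / qd)
    * (Ze / qe) * (sza * Za / N2)) ->
  Y * (qb * qc * qd * qe) * (Ab * Ac * Ad * Ae) * J =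
    f1 * q1 * qa * Q * (E * B1 * B2 * B3 * B4 * DE) ->
  tl * (f1 * Q ^+ 2 * q1 * qa / (Za * Zq * Y) *
     (N2 * ((sbc * E) * (sbd * B1) * (sbe * B2) * B3 * B4 * DE) /
      ((sb * Ab) * Ac * Ad * Ae * (Zb * (vc * Zc) * Zd * Ze))) * U')
  + tr * (f1 * Q ^+ 2 * q1 * qa / (Za * Zq * Y) *
     (N2 * ((sbc * E) * B1 * B2 * (scd * B3) * (sce * B4) * DE) /
      (Ab * (sc * Ac) * Ad * Ae * ((vb * Zb) * Zc * Zd * Ze))) * U)
  = lzt * J.
Proof.
move=> Q0 Za0 Zq0 Y0 N20 Ab0 Ac0 Ad0 Ae0 Zb0 Zc0 Zd0 Ze0 qb0 qc0 qd0 qe0 sb0 sc0 vb0 vc0.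
move=> h1 h2 h3 hU hJ.
have JE : J = f1 * q1 * qa * Q * (E * B1 * B2 * B3 * B4 * DE) /
    (Y * (qb * qc * qd * qe) * (Ab * Ac * Ad * Ae)).
  by rewrite -hJ; field; rewrite Y0 qb0 qc0 qd0 qe0 Ab0 Ac0 Ad0 Ae0.
set M := f1 * Q ^+ 2 * q1 * qa / (Za * Zq * Y) * N2 * (sbc * E * B1 * B2 * B3 * B4 * DE)
  / (Ab * Ac * Ad * Ae * (Zb * Zc * Zd * Ze)).
transitivity (M * (tl * (sbd * sbe / (sb * vc)) * U' + tr * (scd * sce / (sc * vb)) * U)).
  rewrite /M; field.
  by rewrite Ze0 Zd0 Zc0 Zb0 Ae0 Ad0 Ac0 Ab0 Y0 Zq0 Za0 sb0 sc0 vb0 vc0.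
rewrite h1 h2.
transitivity (M * m * (kg * U' - kf * U)); first by ring.
rewrite hU -h3 JE /M; field.
by rewrite Ze0 Zd0 Zc0 Zb0 Ae0 Ad0 Ac0 Ab0 Y0 Zq0 Za0 qb0 qc0 qd0 qe0 N20 Q0.
Qed.

(** Only rational factors change under the two shifts; they cancel because trace a x - trace a y =
    (x - y) (1 - a/(x y)). *)
Lemma second_coefficient_step a b c z
    (k b1 c1 d1 e1 G1 G2 G3 G4 Ab Ac Ad Ae Zb Zc Zd Ze : K) :
  a != 0 -> b != 0 -> c != 0 -> z != 0 -> 1 - a / b != 0 -> 1 - a / c != 0 ->
  1 - b / z != 0 -> 1 - c / z != 0 ->
  Ab != 0 -> Ac != 0 -> Ad != 0 -> Ae != 0 -> Zb != 0 -> Zc != 0 -> Zd != 0 -> Ze != 0 ->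
  (trace a c - trace a z) * lam a b 1 *
   (k * (b1 * ((1 - c) * c1) * d1 * e1 * (((1 - a / (z * b)) * G1) * G2 * G3 * G4) /
     (((1 - a / b) * Ab) * Ac * Ad * Ae * (Zb * ((1 - c / z) * Zc) * Zd * Ze))))
  + (trace a z - trace a b) * lam a c 1 *
   (k * (((1 - b) * b1) * c1 * d1 * e1 * (G1 * ((1 - a / (z * c)) * G2) * G3 * G4) /
     (Ab * ((1 - a / c) * Ac) * Ad * Ae * (((1 - b / z) * Zb) * Zc * Zd * Ze))))
  = 0.
Proof.
move=> a0 b0 c0 z0 n1 n1' n2 n3 Ab0 Ac0 Ad0 Ae0 Zb0 Zc0 Zd0 Ze0.
have m1 : b - a != 0 by apply: contra n1; rewrite !subr_eq0 => /eqP <-; rewrite divff.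
have m1' : c - a != 0 by apply: contra n1'; rewrite !subr_eq0 => /eqP <-; rewrite divff.
have m2 : z - b != 0 by apply: contra n2; rewrite !subr_eq0 => /eqP <-; rewrite divff.
have m3 : z - c != 0 by apply: contra n3; rewrite !subr_eq0 => /eqP <-; rewrite divff.
rewrite /trace /lam; field.
by rewrite b0 c0 z0 m1 m1' m2 m3 Ab0 Ac0 Ad0 Ae0 Zb0 Zc0 Zd0 Ze0.
Qed.

End Coefficients.

(** * The two sides of the identity and their common contiguous relation *)

Section Defect.
Local Open Scope classical_set_scope.
Variables (R : realType) (q : R[i]).
Hypothesis q01 : 0 < `|q| < 1.
Local Notation C := (R[i]).
Implicit Types (x y A Z a b c d e z w s t : C).
Local Notation usum := (usum q).
Local Notation vsum := (vsum q).
Local Notation generic := (generic q).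
Local Notation gpar := (gpar q).
Local Notation qinf := (qinf q).

Definition pairs6 a b c d e := qinf (a * q / (b * c)) * qinf (a * q / (b * d)) *
  qinf (a * q / (b * e)) * qinf (a * q / (c * d)) * qinf (a * q / (c * e)) *
  qinf (a * q / (d * e)).

Definition denom8 a b c d e z :=
  qinf (a * q / b) * qinf (a * q / c) * qinf (a * q / d) * qinf (a * q / e) *
  (qinf (b / z) * qinf (c / z) * qinf (d / z) * qinf (e / z)).

(** The identity is multiplied by 1 - a throughout, and the prefactor 1 - 1/z of the 8W7 cancels
    against the normalisation left out of [usum]. *)
Definition wcoef a b c d e z :=
  (1 - a) * qinf q ^+ 2 * qinf (a * q) * qinf (q / a) /
    (qinf (z * q / a) * qinf (q / z) * qinf (a * q / z)) *
  (qinf (a * q / z ^+ 2) * pairs6 a b c d e / denom8 a b c d e z).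

Definition pcoef a b c d e z :=
  z^-1 * ((1 - a) * qinf q ^+ 2 * qinf (a * q) * qinf (q / a) /
    (qinf (q / z) * qinf (z * q / a) * qinf (z * q) * qinf (a * q / z))) *
  (qinf b * qinf c * qinf d * qinf e *
   (qinf (a * q / (z * b)) * qinf (a * q / (z * c)) * qinf (a * q / (z * d)) *
    qinf (a * q / (z * e))) / denom8 a b c d e z).

(** For balanced parameters, the 8psi8 times 1 - a; the 6 counts the listed parameters, as in
    [w6]. *)
Definition psi6 a b c d e z := vsum a [:: b; c; d; e; a / z; z] (a * q / z).

Definition w6 a b c d e z :=
  usum z^-1 [:: z^-1; b / z; c / z; d / z; e / z; z / a] q.

Definition defect a b c d e z :=
  psi6 a b c d e z - wcoef a b c d e z * w6 a b c d e z - pcoef a b c d e z.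

(** One list for each base: a for the 8psi8, 1/z for the 8W7. *)
Definition general_position a b c d e z :=
  [/\ a != 0, z != 0, generic a, eachP (gpar a) [:: b; c; d; e; z] &
   eachP (gpar z^-1) [:: b / z; c / z; d / z; e / z; z / a]].

Lemma qinf_div x y : qinf (x / y) = (1 - x / y) * qinf (x * q / y).
Proof. by rewrite (qinfS q01) mulrAC. Qed.

Lemma divMqq a b : a * q / (b * q) = a / b.
Proof. by rewrite -mulf_div mulfV ?mulr1 // base_neq0. Qed.

(** Factors are split off so that the shifts of b and of c involve the same infinite products, in
    the shape expected by [first_coefficient_step]. *)
Lemma wcoef_shift_left a b c d e z : wcoef a (b * q) c d e z =
  (1 - a) * qinf q ^+ 2 * qinf (a * q) * qinf (q / a) /
    (qinf (z * q / a) * qinf (q / z) * qinf (a * q / z)) *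
  (qinf (a * q / z ^+ 2) *
   (((1 - a / (b * c)) * qinf (a * q / (b * c))) *
    ((1 - a / (b * d)) * qinf (a * q / (b * d))) *
    ((1 - a / (b * e)) * qinf (a * q / (b * e))) * qinf (a * q / (c * d)) *
    qinf (a * q / (c * e)) * qinf (a * q / (d * e))) /
   (((1 - a / b) * qinf (a * q / b)) * qinf (a * q / c) * qinf (a * q / d) *
    qinf (a * q / e) *
    (qinf (b * q / z) * ((1 - c / z) * qinf (c * q / z)) * qinf (d / z) * qinf (e / z)))).
Proof.
have e1 x : a * q / (b * q * x) = a / (b * x) by rewrite [b * q * x]mulrAC divMqq.
rewrite /wcoef /pairs6 /denom8 !e1 divMqq (qinf_div a (b * c)) (qinf_div a (b * d)).
by rewrite (qinf_div a (b * e)) (qinf_div a b) (qinf_div c z).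
Qed.

Lemma wcoef_shift_right a b c d e z : wcoef a b (c * q) d e z =
  (1 - a) * qinf q ^+ 2 * qinf (a * q) * qinf (q / a) /
    (qinf (z * q / a) * qinf (q / z) * qinf (a * q / z)) *
  (qinf (a * q / z ^+ 2) *
   (((1 - a / (b * c)) * qinf (a * q / (b * c))) *
    qinf (a * q / (b * d)) * qinf (a * q / (b * e)) *
    ((1 - a / (c * d)) * qinf (a * q / (c * d))) *
    ((1 - a / (c * e)) * qinf (a * q / (c * e))) * qinf (a * q / (d * e))) /
   (qinf (a * q / b) * ((1 - a / c) * qinf (a * q / c)) * qinf (a * q / d) *
    qinf (a * q / e) *
    (((1 - b / z) * qinf (b * q / z)) * qinf (c * q / z) * qinf (d / z) * qinf (e / z)))).
Proof.
have e1 x : a * q / (c * q * x) = a / (c * x) by rewrite [c * q * x]mulrAC divMqq.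
have e2 : a * q / (b * (c * q)) = a / (b * c) by rewrite mulrA divMqq.
rewrite /wcoef /pairs6 /denom8 !e1 e2 divMqq (qinf_div a (b * c)) (qinf_div a (c * d)).
by rewrite (qinf_div a (c * e)) (qinf_div a c) (qinf_div b z).
Qed.

Lemma pcoef_shift_left a b c d e z : pcoef a (b * q) c d e z =
  z^-1 * ((1 - a) * qinf q ^+ 2 * qinf (a * q) * qinf (q / a) /
    (qinf (q / z) * qinf (z * q / a) * qinf (z * q) * qinf (a * q / z))) *
  (qinf (b * q) * ((1 - c) * qinf (c * q)) * qinf d * qinf e *
   (((1 - a / (z * b)) * qinf (a * q / (z * b))) * qinf (a * q / (z * c)) *
    qinf (a * q / (z * d)) * qinf (a * q / (z * e))) /
   (((1 - a / b) * qinf (a * q / b)) * qinf (a * q / c) * qinf (a * q / d) *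
    qinf (a * q / e) *
    (qinf (b * q / z) * ((1 - c / z) * qinf (c * q / z)) * qinf (d / z) * qinf (e / z)))).
Proof.
have e2 : a * q / (z * (b * q)) = a / (z * b) by rewrite mulrA divMqq.
rewrite /pcoef /denom8 e2 divMqq (qinf_div a (z * b)) (qinf_div a b) (qinf_div c z).
by rewrite (qinfS q01 c).
Qed.

Lemma pcoef_shift_right a b c d e z : pcoef a b (c * q) d e z =
  z^-1 * ((1 - a) * qinf q ^+ 2 * qinf (a * q) * qinf (q / a) /
    (qinf (q / z) * qinf (z * q / a) * qinf (z * q) * qinf (a * q / z))) *
  (((1 - b) * qinf (b * q)) * qinf (c * q) * qinf d * qinf e *
   (qinf (a * q / (z * b)) * ((1 - a / (z * c)) * qinf (a * q / (z * c))) *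
    qinf (a * q / (z * d)) * qinf (a * q / (z * e))) /
   (qinf (a * q / b) * ((1 - a / c) * qinf (a * q / c)) * qinf (a * q / d) *
    qinf (a * q / e) *
    (((1 - b / z) * qinf (b * q / z)) * qinf (c * q / z) * qinf (d / z) * qinf (e / z)))).
Proof.
have e2 : a * q / (z * (c * q)) = a / (z * c) by rewrite mulrA divMqq.
rewrite /pcoef /denom8 e2 divMqq (qinf_div a (z * c)) (qinf_div a c) (qinf_div b z).
by rewrite (qinfS q01 b).
Qed.

Lemma defect_combination (K : fieldType)
   (tl tr P1 P2 c1 c2 k1 k2 W1 W2 r : K) :
  tl * P1 + tr * P2 = r -> tl * (c1 * W1) + tr * (c2 * W2) = r ->
  tl * k1 + tr * k2 = 0 ->
  tl * (P1 - c1 * W1 - k1) + tr * (P2 - c2 * W2 - k2) = 0.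
Proof.
move=> h1 h2 h3.
transitivity ((tl * P1 + tr * P2) - (tl * (c1 * W1) + tr * (c2 * W2))
  - (tl * k1 + tr * k2)); first by ring.
by rewrite h1 h2 h3; ring.
Qed.

(** The balance lacks a factor q, so that (b q, c) and (b, c q) satisfy it. At (b, c) the pair a/z,
    z drops out, leaving a 6psi6 whose argument a^2 q/(b c d e) is again a q/z; it is the
    inhomogeneous term on both sides and cancels. *)
Lemma defect_contiguity a b c d e z : b * c * d * e = a * z ->
  cabs (a * q / z) < 1 -> general_position a b c d e z -> generic (z / (b * c)) ->
  (trace a c - trace a z) * lam a b 1 * defect a (b * q) c d e z
  + (trace a z - trace a b) * lam a c 1 * defect a b (c * q) d e z = 0.
Proof.
move=> he Z1 [a0 z0 ga hp hw] gbc.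
have e1 := vsum_contiguity q01 a0 Z1 hp.
have [hb [hc [hd [h'e [hz _]]]]] := hp.
have [fb [fc [fd [fe [fa _]]]]] := hw.
have [b0 gb gba] := hb; have [c0 gc gca] := hc; have [d0 gd gda] := hd.
have [e0 ge gea] := h'e; have [_ gz gza] := hz.
have [_ gbz _] := fb; have [_ gcz _] := fc; have [_ gdz _] := fd.
have [_ gez _] := fe; have [_ gzA gzz] := fa.
have q0 := base_neq0 q01; have qq0 := qinf_q_neq0 q01.
have zi0 : z^-1 != 0 by rewrite invr_neq0.
have hprod : b / z * (c / z) * (d / z) * (e / z) * (z / a) = z^-1 ^+ 2.
  transitivity (b * c * d * e / (z ^+ 3 * a)); first by field; rewrite a0 z0.
  by rewrite he; field; rewrite a0 z0.
have e2 := usum6_contiguity q01 zi0 hprod hw.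
have ezz : z^-1 * q / (z / a) = a * q / z ^+ 2 by field; rewrite a0 z0.
have ezx x : x != 0 -> z^-1 * q / (x / z) = q / x by move=> x0; field; rewrite x0 z0.
rewrite ezz (ezx _ b0) (ezx _ c0) (ezx _ d0) (ezx _ e0) in e2.
rewrite (qinfS q01 z^-1) [z^-1 * q]mulrC (qinf_div b z) (qinf_div c z) (qinf_div z a) in e2.
rewrite [b / z * q]mulrAC [c / z * q]mulrAC in e2.
have R1 x : gpar a x -> qinf (a * q / x) != 0.
  by move=> hx; apply/(qinf_neq0P q01) => n; exact: gpar_qfac.
have R2 x : generic x -> qinf (q / x) != 0.
  by move=> hx; apply/(qinf_neq0P q01); exact: generic_reverse.
have hl : eachP (fun x => [/\ x != 0, qinf (a * q / x) != 0 & qinf (q / x) != 0])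
    [:: b; c; d; e].
  have P x : gpar a x -> [/\ x != 0, qinf (a * q / x) != 0 & qinf (q / x) != 0].
    by move=> hx; have [x0 gx _] := hx; split; [exact: x0|exact: R1|exact: R2].
  by repeat (split; [exact: P|]).
have eZ : a ^+ 2 * q / (b * c * d * e) = a * q / z.
  by rewrite he; field; rewrite a0 z0.
have e3 := vsum4 q01 a0 (generic_qinf q01 (genericM q01 ga)) (R2 _ ga) hl.
rewrite /= eZ (qinfS q01 a) in e3.
have {}e3 := e3 Z1.
rewrite /defect wcoef_shift_left wcoef_shift_right pcoef_shift_left pcoef_shift_right.
have n1 := generic_neq1 (generic_div gba).
have n2 := generic_neq1 (generic_div gca).
have n3 := generic_neq1 gbz; have n4 := generic_neq1 gcz; have n5 := generic_neq1 gbc.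
have Q1 : qinf (z * q / a) != 0.
  by apply: generic_qinf => //; exact: genericMq.
have Q2 : qinf (q / z) != 0 by exact: R2.
have Q3 : qinf (a * q / z) != 0 by exact: R1.
have Q4 : qinf (a * q / z ^+ 2) != 0.
  by rewrite -ezz; apply/(qinf_neq0P q01) => n; exact: gpar_qfac fa.
have Q5 : qinf (b * q / z) != 0 by apply: generic_qinf => //; exact: genericMq.
have Q6 : qinf (c * q / z) != 0 by apply: generic_qinf => //; exact: genericMq.
have Q7 : qinf (d / z) != 0 by exact: (generic_qinf q01).
have Q8 : qinf (e / z) != 0 by exact: (generic_qinf q01).
apply: (defect_combination e1); last first.
  exact: (second_coefficient_step _ _ _ _ _ _ _ _ _ a0 b0 c0 z0 n1 n2 n3 n4
    (R1 _ hb) (R1 _ hc) (R1 _ hd) (R1 _ h'e) Q5 Q6 Q7 Q8).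
have r1 := mult_left a0 b0 c0 d0 e0 z0 he n1 n3 n4 n5.
have r2 := mult_right a0 b0 c0 d0 e0 z0 he n2 n3 n4 n5.
have r3 := mult_trace a0 b0 c0 z0 n3 n4 n5.
exact: (first_coefficient_step qq0 Q1 Q2 Q3 Q4 (R1 _ hb) (R1 _ hc) (R1 _ hd) (R1 _ h'e)
  Q5 Q6 Q7 Q8 (R2 _ gb) (R2 _ gc) (R2 _ gd) (R2 _ ge) n1 n2 n3 n4 r1 r2 r3 e2 e3).
Qed.

End Defect.

(** * Vanishing for generic parameters *)

Section Vanishing.
Local Open Scope classical_set_scope.
Variables (R : realType) (q : R[i]).
Hypothesis q01 : 0 < `|q| < 1.
Local Notation C := (R[i]).
Implicit Types (x y A Z a b c d e z w s t : C).
Local Notation usum := (usum q).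
Local Notation vsum := (vsum q).
Local Notation generic := (generic q).
Local Notation gpar := (gpar q).
Local Notation qinf := (qinf q).
Local Notation defect := (defect q).
Local Notation general_position := (general_position q).

Lemma generic_expV x k : generic x -> generic (x * q ^- k).
Proof.
move=> h; rewrite -[x * _]invrK; apply: genericV; rewrite invfM invrK.
by apply: (genericMX q01); exact: genericV.
Qed.

Lemma gparX A x k : gpar A x -> gpar A (x * q ^+ k).
Proof.
move=> [x0 h1 h2]; split; first by rewrite mulf_neq0 // expf_neq0 // base_neq0.
  exact: genericMX.
by rewrite mulrAC; exact: genericMX.
Qed.

Lemma gparXV A x k : gpar A x -> gpar A (x * q ^- k).
Proof.
move=> [x0 h1 h2]; split.
- by rewrite mulf_neq0 // invr_neq0 // expf_neq0 // base_neq0.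
- exact: generic_expV.
- by rewrite mulrAC; exact: generic_expV.
Qed.

Lemma general_position_shift a b c d e z m n : general_position a b c d e z ->
  general_position a (b * q ^+ m) (c * q ^- n) d e z.
Proof.
move=> [a0 z0 ga hp hw]; split=> //.
  move: hp => /= [h1 [h2 h3]]; split; first exact: gparX.
  by split; [exact: gparXV|].
move: hw => /= [h1 [h2 h3]]; split; first by rewrite mulrAC; exact: gparX.
by split; [rewrite mulrAC; exact: gparXV|].
Qed.

(** Both coefficients split into linear factors by trace a x - trace a y = (x - y) (1 - a/(x y));
    monomials are arranged so that along the orbit every factor has the form 1 - y q^N. *)
Lemma step_normalize (K : fieldType) (a b c z D D' : K) :
  a != 0 -> b != 0 -> c != 0 -> z != 0 ->
  (trace a c - trace a z) * lam a b 1 * D' + (trace a z - trace a b) * lam a c 1 * D = 0 ->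
  D * ((1 - b / z) * (1 - z * b / a) * (1 - c^-1) * (1 - a / c)) =
  (1 - z / c) * (1 - a / (z * c)) * (1 - b) * (1 - b / a) * D'.
Proof.
move=> a0 b0 c0 z0 h.
have n0 : a * c / b != 0 by rewrite !mulf_neq0 ?invr_neq0.
apply: (mulfI n0); apply/eqP; rewrite -subr_eq0; apply/eqP.
by rewrite -[RHS]h /trace /lam; field; rewrite a0 b0 c0 z0.
Qed.

Lemma product_step (K : fieldType) (D0 D1 D2 A1 A2 A3 A4 B1 B2 B3 B4 a1 a2 a3 a4 b1 b2
    b3 b4 : K) :
  D0 * (A1 * A2 * A3 * A4) = B1 * B2 * B3 * B4 * D1 ->
  D1 * (a1 * a2 * a3 * a4) = b1 * b2 * b3 * b4 * D2 ->
  D0 * ((A1 * a1) * (A2 * a2) * (A3 * a3) * (A4 * a4)) =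
  (B1 * b1) * (B2 * b2) * (B3 * b3) * (B4 * b4) * D2.
Proof.
move=> h1 h2.
transitivity (D0 * (A1 * A2 * A3 * A4) * (a1 * a2 * a3 * a4)); first by ring.
rewrite h1; transitivity (B1 * B2 * B3 * B4 * (D1 * (a1 * a2 * a3 * a4))); first by ring.
by rewrite h2; ring.
Qed.

Lemma defect_iter a b c d e z N : b * c * d * e = a * q * z ->
  cabs (a * q / z) < 1 -> general_position a b c d e z -> generic (z / (b * c)) ->
  defect a b c d e z * (qfac q (b / z) N * qfac q (z * b / a) N *
    qfac q (q / c) N * qfac q (a * q / c) N) =
  qfac q (z * q / c) N * qfac q (a * q / (z * c)) N * qfac q b N * qfac q (b / a) N *
    defect a (b * q ^+ N) (c * q ^- N) d e z.
Proof.
move=> he Z1 hg gbc; have q0 := base_neq0 q01.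
elim: N => [|N IH].
  by rewrite !qfac0 expr0 invr1 [b * 1]mulr1 [c * 1]mulr1 mulrC.
have [a0 z0 _ hp _] := hg.
have [b0 _ _] := hp.1; have [c0 _ _] := hp.2.1.
have qN := expf_neq0 N q0.
(* The base point is (b q^N, c q^-(N+1)): its coordinates times d e give a z, and its neighbours are
   the points N and N + 1 of the orbit. *)
have hN := general_position_shift N N.+1 hg.
have heN : b * q ^+ N * (c * q ^- N.+1) * d * e = a * z.
  transitivity (b * c * d * e / q); first by rewrite exprS; field; rewrite q0 qN.
  by rewrite he; field.
have gN : generic (z / (b * q ^+ N * (c * q ^- N.+1))).
  have -> : z / (b * q ^+ N * (c * q ^- N.+1)) = z / (b * c) * q.
    by rewrite exprS; field; rewrite b0 c0 q0 qN.
  exact: (genericM q01).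
have := defect_contiguity q01 heN Z1 hN gN.
have -> : b * q ^+ N * q = b * q ^+ N.+1 by rewrite exprSr mulrA.
have -> : c * q ^- N.+1 * q = c * q ^- N by rewrite exprS; field; rewrite q0 qN.
have bN0 : b * q ^+ N != 0 by rewrite mulf_neq0.
have cN0 : c * q ^- N.+1 != 0 by rewrite mulf_neq0 ?invr_neq0 ?expf_neq0.
move=> /(step_normalize a0 bN0 cN0 z0) st.
have e1 : b * q ^+ N / z = b / z * q ^+ N by rewrite mulrAC.
have e2 : z * (b * q ^+ N) / a = z * b / a * q ^+ N by field.
have e3 : (c * q ^- N.+1)^-1 = q / c * q ^+ N.
  by rewrite exprS; field; rewrite q0 c0 qN.
have e4 : a / (c * q ^- N.+1) = a * q / c * q ^+ N.
  by rewrite exprS; field; rewrite q0 c0 qN.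
have e5 : z / (c * q ^- N.+1) = z * q / c * q ^+ N.
  by rewrite exprS; field; rewrite q0 c0 qN.
have e6 : a / (z * (c * q ^- N.+1)) = a * q / (z * c) * q ^+ N.
  by rewrite exprS; field; rewrite q0 c0 qN z0.
have e7 : b * q ^+ N / a = b / a * q ^+ N by rewrite mulrAC.
rewrite e1 e2 e4 e5 e6 e7 e3 in st.
rewrite !qfacS.
exact: (product_step IH st).
Qed.

Lemma usum_perm A (s s' : seq C) Z : perm_eq s s' -> usum A s Z = usum A s' Z.
Proof. by move=> h; apply: eq_csum => n; rewrite /uterm (perm_big _ h). Qed.

Lemma qinf_shiftV x N : x != 0 -> qinf (x * q ^- N) =
  (- x) ^+ N * (\prod_(0 <= k < N) q ^- k.+1) * (qfac q (q / x) N * qinf x).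
Proof.
move=> x0; have e : x * q ^- N * q ^+ N = x by rewrite divfK ?expf_neq0 ?base_neq0.
by rewrite (qinfE q01 _ N) (qfac_reverse q01 _ x0) e [RHS]mulrA.
Qed.

Lemma quad_ratio (K : fieldType) (y1 y2 y3 y4 P f1 f2 f3 f4 u1 u2 u3 u4 : K) (N : nat) :
  y1 * y2 = y3 * y4 -> y3 != 0 -> y4 != 0 -> P != 0 ->
  f1 * u1 * (f2 * u2) / (f3 * u3 * (f4 * u4)) =
  ((- y1) ^+ N * P * (f1 * u1)) * ((- y2) ^+ N * P * (f2 * u2)) /
  (((- y3) ^+ N * P * (f3 * u3)) * ((- y4) ^+ N * P * (f4 * u4))).
Proof.
move=> hy y30 y40 P0.
have e : (- y1) ^+ N * (- y2) ^+ N = (- y3) ^+ N * (- y4) ^+ N.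
  by rewrite -!exprMn !mulrNN hy.
have X0 : (- y3) ^+ N * (- y4) ^+ N != 0 by rewrite mulf_neq0 // expf_neq0 // oppr_eq0.
move: e X0; move: ((- y1) ^+ N) ((- y2) ^+ N) ((- y3) ^+ N) ((- y4) ^+ N).
move=> x1 x2 x3 x4 e X0.
have -> : x1 * P * (f1 * u1) * (x2 * P * (f2 * u2)) =
  x1 * x2 * (P * P) * (f1 * u1 * (f2 * u2)) by ring.
have -> : x3 * P * (f3 * u3) * (x4 * P * (f4 * u4)) =
  x3 * x4 * (P * P) * (f3 * u3 * (f4 * u4)) by ring.
rewrite e; have X1 := mulf_neq0 X0 (mulf_neq0 P0 P0).
by rewrite -[RHS]mulf_div (mulfV X1) mul1r.
Qed.

(** Each product carries a factor (-y)^N q^(-N(N+1)/2); since y1 y2 = y3 y4 these cancel in the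
    quotient, and theta functions remain. *)
Lemma tends_quad y1 y2 y3 y4 : y1 != 0 -> y2 != 0 -> y3 != 0 -> y4 != 0 ->
  y1 * y2 = y3 * y4 -> generic y3 -> generic y4 ->
  tends (fun N => qinf (y1 * q ^- N) * qinf (y2 * q ^- N) /
      (qinf (y3 * q ^- N) * qinf (y4 * q ^- N)))
    (theta q y1 * theta q y2 / (theta q y3 * theta q y4)).
Proof.
move=> y10 y20 y30 y40 hy g3 g4.
have t y : tends (fun N => qfac q (q / y) N * qinf y) (theta q y).
  by rewrite /theta [qinf y * _]mulrC; exact: tendsM (tends_qfac_qinf q01 _) (tends_cst _).
have n0 : theta q y3 * theta q y4 != 0 by rewrite mulf_neq0 // theta_neq0.
apply: eq_tends (tendsM (tendsM (t y1) (t y2)) (tendsV n0 (tendsM (t y3) (t y4)))) _ => N.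
rewrite !qinf_shiftV //; apply: quad_ratio => //.
by rewrite prodf_seq_neq0; apply/allP => k _ /=; rewrite invr_neq0 ?expf_neq0 ?base_neq0.
Qed.

Lemma tends_shift1 x : tends (fun N => qinf (x * q ^+ N)) 1.
Proof.
rewrite -(qinf0 q01); apply: (tends_qinf q01); rewrite -(mulr0 x).
exact: tendsM (tends_cst _) (tends_expr0 q01).
Qed.

(** Grouped by behaviour in the limit: factors independent of N, a quotient of four with arguments
    of order q^-N, and those with arguments of order q^N, which tend to 1. *)
Lemma wcoef_regroup (K : fieldType) (F N2 g1 g2 g3 g4 g5 g6 h1 h2 h3 h4 k1 k2 k3 k4 : K) :
  F * (N2 * (g1 * g2 * g3 * g4 * g5 * g6) / (h1 * h2 * h3 * h4 * (k1 * k2 * k3 * k4)))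
  = F * N2 * g1 * g6 * (g2 * g3 / (h1 * k2)) * (g4 * g5) * (h2 * k1)^-1
    * (h3 * h4 * (k3 * k4))^-1.
Proof. by rewrite !invfM; ring. Qed.

Lemma tends_wcoef a b c d e z : general_position a b c d e z ->
  b * c * d * e = a * q * z ->
  tends (fun N => wcoef q a (b * q ^+ N) (c * q ^- N) d e z)
    ((1 - a) * qinf q ^+ 2 * qinf (a * q) * qinf (q / a) /
      (qinf (z * q / a) * qinf (q / z) * qinf (a * q / z)) * qinf (a * q / z ^+ 2) *
     qinf (d * e / z) * qinf (a * q / (d * e)) *
     (theta q (c * e / z) * theta q (c * d / z) /
       (theta q (c * d * e / z) * theta q (c / z))) * (1 * 1) * (1 * 1)^-1 *
     (qinf (a * q / d) * qinf (a * q / e) * (qinf (d / z) * qinf (e / z)))^-1).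
Proof.
move=> [a0 z0 ga hp hw] he; have q0 := base_neq0 q01.
move: hp => /= [hb [hc [hd [h'e [hz _]]]]].
move: hw => /= [fb [fc [fd [fe [fa _]]]]].
have [b0 gb gba] := hb; have [c0 gc gca] := hc; have [d0 gd gda] := hd.
have [e0 ge gea] := h'e; have [_ gcz _] := fc.
have aE : a = b * c * d * e / (q * z) by rewrite he; field; rewrite q0 z0.
have E1 : a * q / (b * e) = c * d / z by rewrite aE; field; rewrite b0 e0 q0 z0.
have E2 : a * q / (b * d) = c * e / z by rewrite aE; field; rewrite b0 d0 q0 z0.
have E3 : a * q / b = c * d * e / z by rewrite aE; field; rewrite b0 q0 z0.
have E4 : a * q / (b * c) = d * e / z by rewrite aE; field; rewrite b0 c0 q0 z0.
have g3 : generic (c * d * e / z).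
  by rewrite -E3; apply: (genericMq q01); exact: generic_div.
have prod : c * e / z * (c * d / z) = c * d * e / z * (c / z) by field.
have n1 : c * e / z != 0 by rewrite !mulf_neq0 ?invr_neq0.
have n2 : c * d / z != 0 by rewrite !mulf_neq0 ?invr_neq0.
have n3 : c * d * e / z != 0 by rewrite !mulf_neq0 ?invr_neq0.
have n4 : c / z != 0 by rewrite !mulf_neq0 ?invr_neq0.
have tq := tends_quad n1 n2 n3 n4 prod g3 gcz.
have t1 := tends_shift1; have cst := @tends_cst R.
have o1 : (1 : C) * 1 != 0 by rewrite mulr1 oner_neq0.
apply: eq_tends (tendsM (tendsM (tendsM (tendsM (cst _) tq)
  (tendsM (t1 (a * q / (c * d))) (t1 (a * q / (c * e)))))
  (tendsV o1 (tendsM (t1 (a * q / c)) (t1 (b / z))))) (cst _)) _ => N.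
have qN := expf_neq0 N q0.
rewrite -wcoef_regroup /wcoef /pairs6 /denom8.
have -> : a * q / (b * q ^+ N * (c * q ^- N)) = d * e / z.
  by rewrite -E4; field; rewrite b0 c0 qN.
have -> : a * q / (b * q ^+ N * d) = c * e / z * q ^- N.
  by rewrite -E2; field; rewrite b0 d0 qN.
have -> : a * q / (b * q ^+ N * e) = c * d / z * q ^- N.
  by rewrite -E1; field; rewrite b0 e0 qN.
have -> : a * q / (c * q ^- N * d) = a * q / (c * d) * q ^+ N.
  by field; rewrite c0 d0 qN.
have -> : a * q / (c * q ^- N * e) = a * q / (c * e) * q ^+ N.
  by field; rewrite c0 e0 qN.
have -> : a * q / (b * q ^+ N) = c * d * e / z * q ^- N.
  by rewrite -E3; field; rewrite b0 qN.
have -> : a * q / (c * q ^- N) = a * q / c * q ^+ N by field; rewrite c0 qN.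
have -> : b * q ^+ N / z = b / z * q ^+ N by rewrite mulrAC.
by have -> : c * q ^- N / z = c / z * q ^- N by rewrite mulrAC.
Qed.

Lemma pcoef_regroup (K : fieldType) (F b c d e g1 g2 g3 g4 h1 h2 h3 h4 k1 k2 k3 k4 : K) :
  F * (b * c * d * e * (g1 * g2 * g3 * g4) / (h1 * h2 * h3 * h4 * (k1 * k2 * k3 * k4)))
  = F * (d * e) * (g3 * g4) * (c * g1 / (h1 * k2)) * (b * g2) * (h2 * k1)^-1
    * (h3 * h4 * (k3 * k4))^-1.
Proof. by rewrite !invfM; ring. Qed.

Lemma tends_pcoef a b c d e z : general_position a b c d e z ->
  b * c * d * e = a * q * z ->
  tends (fun N => pcoef q a (b * q ^+ N) (c * q ^- N) d e z)
    (z^-1 * ((1 - a) * qinf q ^+ 2 * qinf (a * q) * qinf (q / a) /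
      (qinf (q / z) * qinf (z * q / a) * qinf (z * q) * qinf (a * q / z))) *
     (qinf d * qinf e) * (qinf (a * q / (z * d)) * qinf (a * q / (z * e))) *
     (theta q c * theta q (c * d * e / z ^+ 2) /
       (theta q (c * d * e / z) * theta q (c / z))) * (1 * 1) * (1 * 1)^-1 *
     (qinf (a * q / d) * qinf (a * q / e) * (qinf (d / z) * qinf (e / z)))^-1).
Proof.
move=> [a0 z0 ga hp hw] he; have q0 := base_neq0 q01.
move: hp => /= [hb [hc [hd [h'e [hz _]]]]].
move: hw => /= [fb [fc [fd [fe [fa _]]]]].
have [b0 gb gba] := hb; have [c0 gc gca] := hc; have [d0 gd gda] := hd.
have [e0 ge gea] := h'e; have [_ gcz _] := fc.
have aE : a = b * c * d * e / (q * z) by rewrite he; field; rewrite q0 z0.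
have E3 : a * q / b = c * d * e / z by rewrite aE; field; rewrite b0 q0 z0.
have E4 : a * q / (z * b) = c * d * e / z ^+ 2 by rewrite aE; field; rewrite b0 q0 z0.
have g3 : generic (c * d * e / z).
  by rewrite -E3; apply: (genericMq q01); exact: generic_div.
have prod : c * (c * d * e / z ^+ 2) = c * d * e / z * (c / z) by field.
have n2 : c * d * e / z ^+ 2 != 0 by rewrite !mulf_neq0 ?invr_neq0 ?expf_neq0.
have n3 : c * d * e / z != 0 by rewrite !mulf_neq0 ?invr_neq0.
have n4 : c / z != 0 by rewrite !mulf_neq0 ?invr_neq0.
have tq := tends_quad c0 n2 n3 n4 prod g3 gcz.
have t1 := tends_shift1; have cst := @tends_cst R.
have o1 : (1 : C) * 1 != 0 by rewrite mulr1 oner_neq0.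
apply: eq_tends (tendsM (tendsM (tendsM (tendsM (cst _) tq)
  (tendsM (t1 b) (t1 (a * q / (z * c)))))
  (tendsV o1 (tendsM (t1 (a * q / c)) (t1 (b / z))))) (cst _)) _ => N.
have qN := expf_neq0 N q0.
rewrite -pcoef_regroup /pcoef /denom8.
have -> : a * q / (z * (b * q ^+ N)) = c * d * e / z ^+ 2 * q ^- N.
  by rewrite -E4; field; rewrite b0 z0 qN.
have -> : a * q / (z * (c * q ^- N)) = a * q / (z * c) * q ^+ N.
  by field; rewrite c0 z0 qN.
have -> : a * q / (b * q ^+ N) = c * d * e / z * q ^- N.
  by rewrite -E3; field; rewrite b0 qN.
have -> : a * q / (c * q ^- N) = a * q / c * q ^+ N by field; rewrite c0 qN.
have -> : b * q ^+ N / z = b / z * q ^+ N by rewrite mulrAC.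
by have -> : c * q ^- N / z = c / z * q ^- N by rewrite mulrAC.
Qed.

Lemma eachP_regular A (s : seq C) : eachP (gpar A) s ->
  eachP (fun x => x != 0 /\ forall n, qfac q (A * q / x) n != 0) s.
Proof.
apply: eachP_imply => x hx; split=> [|n]; first by case: hx.
exact: gpar_qfac.
Qed.

(** In both halves the pair (b, c) leaves a factor in the argument which, by the balance, changes a
    q/z into a q/(d e). *)
Lemma tends_psi6 a b c d e z : general_position a b c d e z ->
  b * c * d * e = a * q * z -> cabs (a * q / z) < 1 -> cabs (a * q / (d * e)) < 1 ->
  tends (fun N => psi6 q a (b * q ^+ N) (c * q ^- N) d e z)
    (vsum a [:: d; e; a / z; z] (a * q / (d * e))).
Proof.
move=> [a0 z0 ga hp hw] he Z1 W1; have q0 := base_neq0 q01.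
move: hp => /= [hb [hc [hd [h'e [hz _]]]]].
have [b0 _ _] := hb; have [c0 _ _] := hc; have [d0 _ _] := hd; have [e0 _ _] := h'e.
have a0' : a^-1 != 0 by rewrite invr_neq0.
have eW : a * q / z * (b * c / (a * q)) = a * q / (d * e).
  have -> : b * c = a * q * z / (d * e) by rewrite -he; field; rewrite d0 e0.
  by field; rewrite a0 q0 z0 d0 e0.
have eW' : a * q / z * (b / a * (c / a) / (a^-1 * q)) = a * q / (d * e).
  by rewrite -eW; field; rewrite a0 q0 z0.
have s1 : eachP (gpar a) [:: d; e; a / z; z].
  by repeat (split; [first [assumption|exact: gpar_dual]|]).
have s2 : eachP (gpar a^-1) [:: d / a; e / a; a / z / a; z / a].
  by repeat (split; [apply: gpar_mirror => //; exact: gpar_dual|]).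
have t1 := tends_usum_pair q01 a0 hb hc (eachP_regular s1) Z1.
have t2 := tends_usum_pair q01 a0' (gpar_mirror a0 hb) (gpar_mirror a0 hc)
  (eachP_regular s2) Z1.
rewrite eW in t1; rewrite eW' in t2.
apply: tendsB (tends_cst 1); apply: tendsD (tends_cst a).
apply: tendsB (t1 W1) _; apply: tendsM (tends_cst a) _.
apply: eq_tends (t2 W1) _ => N /=.
by rewrite [b / a * _]mulrAC [c / a * _]mulrAC.
Qed.

Lemma tends_w6 a b c d e z : general_position a b c d e z ->
  b * c * d * e = a * q * z -> cabs (a * q / (d * e)) < 1 ->
  tends (fun N => w6 q a (b * q ^+ N) (c * q ^- N) d e z)
    (usum z^-1 [:: z^-1; d / z; e / z; z / a] (a * q / (d * e))).
Proof.
move=> [a0 z0 ga hp hw] he W1; have q0 := base_neq0 q01.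
have q1 : cabs q < 1 by have /andP[] := base_cabs q01.
move: hp => /= [hb [hc [hd [h'e [hz _]]]]].
move: hw => /= [fb [fc [fd [fe [fa _]]]]].
have [b0 _ _] := hb; have [c0 _ _] := hc; have [d0 _ _] := hd; have [e0 _ _] := h'e.
have z0' : z^-1 != 0 by rewrite invr_neq0.
have eW : q * (b / z * (c / z) / (z^-1 * q)) = a * q / (d * e).
  have -> : b / z * (c / z) = a * q / (d * e) / z.
    have -> : a = b * c * d * e / (q * z) by rewrite he; field; rewrite q0 z0.
    by field; rewrite q0 z0 d0 e0.
  by field; rewrite q0 z0 d0 e0.
have s1 : eachP (fun x => x != 0 /\ forall n, qfac q (z^-1 * q / x) n != 0)
    [:: z^-1; d / z; e / z; z / a].
  split.
    split=> // n; rewrite mulrAC mulfV // mul1r; move: n.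
    by apply/(qinf_neq0P q01); exact: qinf_q_neq0.
  by apply: eachP_regular; repeat (split; [assumption|]).
have t1 := tends_usum_pair q01 z0' fb fc s1 q1.
rewrite eW in t1.
apply: eq_tends (t1 W1) _ => N; rewrite /w6.
rewrite [b * _ / z]mulrAC [c * _ / z]mulrAC; apply: usum_perm.
by rewrite -[X in perm_eq X _]/([:: _; _] ++ [:: _] ++ _) perm_catCA.
Qed.

End Vanishing.

(** * The limit of the defect *)

Section GenericIdentity.
Local Open Scope classical_set_scope.
Variables (R : realType) (q : R[i]).
Hypothesis q01 : 0 < `|q| < 1.
Local Notation C := (R[i]).
Implicit Types (x y A Z a b c d e z w s t : C).
Local Notation usum := (usum q).
Local Notation vsum := (vsum q).
Local Notation generic := (generic q).
Local Notation gpar := (gpar q).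
Local Notation qinf := (qinf q).
Local Notation theta := (theta q).
Local Notation defect := (defect q).
Local Notation general_position := (general_position q).

(** Once the limiting 6psi6 [Psi] and 6phi5 [W] are evaluated, the limit of the defect is an
    explicit factor times the difference of the two sides of the theta relation, the last
    premise. *)
Lemma limit_step (K : fieldType) (z f1 q1 qa Q x0 qd qe Zq Za Ad Ae z1 Y md me gd ge N2 Zd Ze
    v1 wde E Td Te CE CD M Cz Tc N Psi W : K) :
  z != 0 -> Q != 0 -> x0 != 0 -> qd != 0 -> qe != 0 -> Zq != 0 -> Za != 0 -> Ad != 0 ->
  Ae != 0 -> z1 != 0 -> Y != 0 -> md != 0 -> me != 0 -> N2 != 0 -> Zd != 0 -> Ze != 0 ->
  M != 0 -> Cz != 0 ->
  x0 * (qd * qe * Za * Zq) * (Ad * Ae * z1 * Y) * Psi =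
    f1 * q1 * qa * Q * (x0 * md * gd * me * ge * Q) ->
  x0 * (z1 * md * me * Y) * (Q * qd * qe * N2) * W =
    v1 * z1 * Q * (md * me * Y * wde * gd * ge) ->
  (Zd * md) * (Ze * me) * M * Cz =
    (v1 * z1) * (E * wde) * CE * CD + z^-1 * Tc * (Td * qd) * (Te * qe) * N ->
  Psi - f1 * Q ^+ 2 * q1 * qa / (Za * Zq * Y) * N2 * E * x0 *
     (CE * CD / (M * Cz)) * (1 * 1) * (1 * 1)^-1 * (Ad * Ae * (Zd * Ze))^-1 * W
  - z^-1 * (f1 * Q ^+ 2 * q1 * qa / (Zq * Za * z1 * Y)) * (Td * Te) * (gd * ge) *
     (Tc * N / (M * Cz)) * (1 * 1) * (1 * 1)^-1 * (Ad * Ae * (Zd * Ze))^-1 = 0.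
Proof.
move=> z0 Q0 x00 qd0 qe0 Zq0 Za0 Ad0 Ae0 z10 Y0 md0 me0 N20 Zd0 Ze0 M0 Cz0 hP hW hT.
have PE : Psi = f1 * q1 * qa * Q * (x0 * md * gd * me * ge * Q) /
    (x0 * (qd * qe * Za * Zq) * (Ad * Ae * z1 * Y)).
  by rewrite -hP; field; rewrite x00 qd0 qe0 Za0 Zq0 Ad0 Ae0 z10 Y0.
have WE : W = v1 * z1 * Q * (md * me * Y * wde * gd * ge) /
    (x0 * (z1 * md * me * Y) * (Q * qd * qe * N2)).
  by rewrite -hW; field; rewrite x00 z10 md0 me0 Y0 Q0 qd0 qe0 N20.
set T := v1 * z1 * (E * wde) * CE * CD + z^-1 * Tc * (Td * qd) * (Te * qe) * N in hT.
transitivity (f1 * q1 * qa * Q ^+ 2 * gd * ge /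
  (qd * qe * Za * Zq * Ad * Ae * z1 * Y * (Zd * Ze * M * Cz)) *
  ((Zd * md) * (Ze * me) * M * Cz - T)).
  rewrite PE WE /T; field.
  by rewrite oner_neq0 z0 Q0 x00 qd0 qe0 Zq0 Za0 Ad0 Ae0 z10 Y0 md0 me0
    N20 Zd0 Ze0 M0 Cz0.
by rewrite hT subrr mulr0.
Qed.

Lemma usum_one A (s : seq C) Z : usum A (1 :: s) Z = 1 - A.
Proof.
apply: csum_tends; apply/tends_shift; apply: eq_tends (tends_cst _) _ => n.
rewrite /series /= big_nat_recl //= big1 ?addr0 => [|k _]; first by rewrite uterm0.
rewrite /uterm big_cons (_ : qfac q 1 k.+1 = 0) ?mul0r ?mulr0 ?mul0r //.
by rewrite qfacSl subrr mul0r.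
Qed.

(** The mirrored list contains A / A = 1, so the mirrored sum is its term n = 0 and cancels the
    correction. Bailey's formula thereby also sums the 6phi5. *)
Lemma vsum_unilateral A (s : seq C) Z : A != 0 -> vsum A (A :: s) Z = usum A (A :: s) Z.
Proof.
move=> A0; rewrite /vsum /= mulfV // usum_one.
by move: (usum A (A :: s) Z) => U; field.
Qed.

(** The extra genericity serves the iteration (z/(b c)), the nonvanishing of the product multiplying
    the defect (z b/a), and Weierstrass' relation (z b/a again, c a/(b z), b d/a, b e/a). *)
Lemma defect_limit a b c d e z : general_position a b c d e z ->
  b * c * d * e = a * q * z -> cabs (a * q / z) < 1 -> cabs (a * q / (d * e)) < 1 ->
  generic (z / (b * c)) -> generic (z * b / a) -> generic (c * a / (b * z)) ->
  generic (b * d / a) -> generic (b * e / a) -> defect a b c d e z = 0.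
Proof.
move=> hg he Z1 W1 gbc gzb gA gbd gbe; have q0 := base_neq0 q01.
have tD := tendsB (tendsB (tends_psi6 q01 hg he Z1 W1)
  (tendsM (tends_wcoef q01 hg he) (tends_w6 q01 hg he W1))) (tends_pcoef q01 hg he).
have [a0 z0 ga hp hw] := hg.
move: hp => /= [hb [hc [hd [h'e [hz _]]]]].
move: hw => /= [fb [fc [fd [fe [fa _]]]]].
have [b0 gb gba] := hb; have [c0 gc gca] := hc; have [d0 gd gda] := hd.
have [e0 ge gea] := h'e; have [_ gz gza] := hz.
have [_ gbz _] := fb; have [_ gcz _] := fc; have [_ gdz _] := fd.
have [_ gez _] := fe; have [_ gzA gzz] := fa.
have zi0 : z^-1 != 0 by rewrite invr_neq0.
have aE : a = b * c * d * e / (q * z) by rewrite he; field; rewrite q0 z0.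
have R1 x : gpar a x -> qinf (a * q / x) != 0.
  by move=> hx; apply/(qinf_neq0P q01) => n; exact: gpar_qfac.
have R2 x : generic x -> qinf (q / x) != 0.
  by move=> hx; apply/(qinf_neq0P q01); exact: generic_reverse.
have R3 x : generic x -> qinf (x * q) != 0.
  by move=> hx; apply: generic_qinf => //; exact: genericM.
have R4 x y : generic (x / y) -> qinf (x * q / y) != 0.
  by move=> hx; apply: generic_qinf => //; exact: genericMq.
have P x : gpar a x -> [/\ x != 0, qinf (a * q / x) != 0 & qinf (q / x) != 0].
  by move=> hx; have [x0 gx _] := hx; split; [exact: x0|exact: R1|exact: R2].
have hl : eachP (fun x => [/\ x != 0, qinf (a * q / x) != 0 & qinf (q / x) != 0])
    [:: d; e; a / z; z].
  by repeat (split; [apply: P; first [assumption|exact: gpar_dual]|]).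
have e1 := vsum4 q01 a0 (R3 _ ga) (R2 _ ga) hl.
have eZ : a ^+ 2 * q / (d * e * (a / z) * z) = a * q / (d * e).
  by field; rewrite a0 z0 d0 e0.
rewrite /= eZ (qinfS q01 a) in e1; have {}e1 := e1 W1.
have Ez : q / (a / z) = z * q / a by field; rewrite a0 z0.
have Ez2 : a * q / (a / z) = z * q by field; rewrite a0 z0.
have Ez3 : a * q / (a / z * z) = q by field; rewrite a0 z0.
have Ez4 x : x != 0 -> a * q / (x * (a / z)) = z * q / x.
  by move=> x0; field; rewrite a0 z0 x0.
rewrite Ez Ez2 Ez3 (Ez4 _ d0) (Ez4 _ e0) in e1.
have P2 x : gpar z^-1 x ->
    [/\ x != 0, qinf (z^-1 * q / x) != 0 & qinf (q / x) != 0].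
  move=> hx; have [x0 gx _] := hx; split; [exact: x0| |exact: R2].
  by apply/(qinf_neq0P q01) => n; exact: gpar_qfac.
have zz : z^-1 * q / z^-1 = q by field.
have hl2 : eachP (fun x => [/\ x != 0, qinf (z^-1 * q / x) != 0 & qinf (q / x) != 0])
    [:: z^-1; d / z; e / z; z / a].
  split; last by repeat (split; [apply: P2; assumption|]).
  split; first exact: zi0.
    by rewrite zz; exact: qinf_q_neq0.
  by apply: R2; exact: genericV.
have qzi : qinf (q / z^-1) != 0 by apply: R2; exact: genericV.
have e2 := vsum4 q01 zi0 (R3 _ (genericV gz)) qzi hl2.
have eZ2 : z^-1 ^+ 2 * q / (z^-1 * (d / z) * (e / z) * (z / a)) = a * q / (d * e).
  by field; rewrite a0 z0 d0 e0.
rewrite /= eZ2 (vsum_unilateral _ _ zi0) in e2; have {}e2 := e2 W1.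
have F1 : q / z^-1 = z * q by rewrite invrK mulrC.
have F2 x : x != 0 -> q / (x / z) = z * q / x by move=> x0; field; rewrite z0 x0.
have F3 x : x != 0 -> z^-1 * q / (x / z) = q / x by move=> x0; field; rewrite z0 x0.
have F4 : z^-1 * q / (z / a) = a * q / z ^+ 2 by field; rewrite a0 z0.
have F5 x : x != 0 -> z^-1 * q / (z^-1 * (x / z)) = z * q / x.
  by move=> x0; field; rewrite z0 x0.
have F6 : z^-1 * q / (z^-1 * (z / a)) = a * q / z by field; rewrite a0 z0.
have F7 : z^-1 * q / (d / z * (e / z)) = z * q / (d * e).
  by field; rewrite z0 d0 e0.
have F8 x : x != 0 -> z^-1 * q / (x / z * (z / a)) = a * q / (x * z).
  by move=> x0; field; rewrite z0 x0 a0.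
have F9 : q / (z / a) = a * q / z by field; rewrite a0 z0.
rewrite (F8 _ d0) (F8 _ e0) F7 F6 (F5 _ d0) (F5 _ e0) zz F4 (F3 _ d0) (F3 _ e0)
  F9 (F2 _ d0) (F2 _ e0) F1 in e2.
have AE : c ^+ 2 * d * e / z ^+ 2 = c * a / (b * z) * q.
  by rewrite aE; field; rewrite b0 q0 z0.
have gA' : generic (c ^+ 2 * d * e / z ^+ 2) by rewrite AE; exact: genericM.
have h1 : gpar (c ^+ 2 * d * e / z ^+ 2) c.
  split=> //; rewrite AE.
  have -> : c / (c * a / (b * z) * q) = ((z * b / a)^-1 * q)^-1.
    by field; rewrite a0 b0 c0 q0 z0.
  by apply: genericV; apply: (genericM q01); exact: genericV.
have h2 : gpar (c ^+ 2 * d * e / z ^+ 2) (c * d / z).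
  split; first by rewrite !mulf_neq0 ?invr_neq0.
    have -> : c * d / z = (b * e / a)^-1 * q.
      by rewrite aE; field; rewrite b0 c0 d0 e0 q0 z0.
    by apply: (genericM q01); exact: genericV.
  have -> : c * d / z / (c ^+ 2 * d * e / z ^+ 2) = ((b * d / a)^-1 * q)^-1.
    by rewrite aE; field; rewrite b0 c0 d0 e0 q0 z0.
  by apply: genericV; apply: (genericM q01); exact: genericV.
have h3 : gpar (c ^+ 2 * d * e / z ^+ 2) (c / z).
  split=> //; first by rewrite mulf_neq0.
  have -> : c / z / (c ^+ 2 * d * e / z ^+ 2) = ((b / a)^-1 * q)^-1.
    by rewrite aE; field; rewrite b0 c0 d0 e0 q0 z0.
  by apply: genericV; apply: (genericM q01); exact: genericV.
have e3 := theta_three_term q01 c0 d0 e0 z0 gA' h1 h2 h3.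
have e3' : (qinf (d / z) * qinf (z * q / d)) * (qinf (e / z) * qinf (z * q / e)) *
   theta (c * d * e / z) * theta (c / z) =
   (qinf z^-1 * qinf (z * q)) * (qinf (d * e / z) * qinf (z * q / (d * e))) *
     theta (c * e / z) * theta (c * d / z)
   + z^-1 * theta c * (qinf d * qinf (q / d)) * (qinf e * qinf (q / e)) *
     theta (c * d * e / z ^+ 2).
  have F10 : q / (d * e / z) = z * q / (d * e) by field; rewrite d0 e0 z0.
  by rewrite -(F2 _ d0) -(F2 _ e0) -F10 -F1; exact: e3.
have aE4 : d * e / z = a * q / (b * c) by rewrite aE; field; rewrite b0 c0 q0 z0.
have M0 : theta (c * d * e / z) != 0.
  have -> : c * d * e / z = (b / a)^-1 * q.
    by rewrite aE; field; rewrite b0 c0 d0 e0 q0 z0.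
  by apply: (theta_neq0 q01); apply: (genericM q01); exact: genericV.
have Cz0 : theta (c / z) != 0 by exact: (theta_neq0 q01).
have x00 : qinf (a * q / (d * e)) != 0 by exact: (qinf_neq0 q01).
have md0 : qinf (z * q / d) != 0 by apply: R4; exact: generic_div.
have me0 : qinf (z * q / e) != 0 by apply: R4; exact: generic_div.
have N20 : qinf (a * q / z ^+ 2) != 0.
  by rewrite -F4; apply/(qinf_neq0P q01) => n; exact: gpar_qfac fa.
have G1 : qinf (a * q / (d * z)) = qinf (a * q / (z * d)) by rewrite [d * z]mulrC.
have G2 : qinf (a * q / (e * z)) = qinf (a * q / (z * e)) by rewrite [e * z]mulrC.
rewrite G1 G2 in e1 e2.
have lim := limit_step z0 (qinf_q_neq0 q01) x00 (R2 _ gd) (R2 _ ge) (R2 _ gz)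
  (R4 _ _ gzA) (R1 _ hd) (R1 _ h'e) (R3 _ gz) (R1 _ hz) md0 me0 N20
  (generic_qinf q01 gdz) (generic_qinf q01 gez) M0 Cz0 e1 e2 e3'.
have {}tD := eq_ind _ (fun l => tends _ l) tD _ lim.
have t0 x := tends_qfac_qinf q01 x.
have tL := tendsM (tends_cst (defect a b c d e z)) (tendsM (tendsM (tendsM
  (t0 (b / z)) (t0 (z * b / a))) (t0 (q / c))) (t0 (a * q / c))).
have tR := tendsM (tendsM (tendsM (tendsM (t0 (z * q / c)) (t0 (a * q / (z * c))))
  (t0 b)) (t0 (b / a))) tD.
(* On the left of [defect_iter] the defect is multiplied by products with nonzero limits, while the
   right side tends to 0. *)
have := tends_unique tL (eq_tends tR (fun N => esym (defect_iter q01 N he Z1 hg gbc))).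
rewrite mulr0 => /eqP; rewrite mulf_eq0 => /orP[/eqP //|].
by rewrite !mulf_eq0 (negbTE (generic_qinf q01 gbz)) (negbTE (generic_qinf q01 gzb))
  (negbTE (R2 _ gc)) (negbTE (R1 _ hc)).
Qed.

End GenericIdentity.

(** * Removing the genericity assumption *)

Section Perturbation.
Local Open Scope classical_set_scope.
Variables (R : realType) (q : R[i]).
Hypothesis q01 : 0 < `|q| < 1.
Local Notation C := (R[i]).
Implicit Types (x y A Z a b c d e z w s : C).
Local Notation usum := (usum q).
Local Notation vsum := (vsum q).
Local Notation generic := (generic q).
Local Notation gpar := (gpar q).
Local Notation qinf := (qinf q).
Local Notation defect := (defect q).
Local Notation general_position := (general_position q).

Lemma swap_step (K : fieldType) (N2 F A B x1 x2 x3 x4 x5 x6 h1 h2 h3 h4 k1 k2 k3 k4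
   P W G b c d e g1 g2 g3 g4 : K) :
  P - F * (N2 * (x1 * x2 * x3 * x4 * x5 * x6) / (h1 * h2 * h3 * h4 * (k1 * k2 * k3 * k4)))
    * W - G * (b * c * d * e * (g1 * g2 * g3 * g4) /
      (h1 * h2 * h3 * h4 * (k1 * k2 * k3 * k4)))
  = P - F * (N2 * (x6 * x2 * x4 * x3 * x5 * x1) / (h3 * h4 * h1 * h2 * (k3 * k4 * k1 * k2)))
    * W - G * (d * e * b * c * (g3 * g4 * g1 * g2) /
      (h3 * h4 * h1 * h2 * (k3 * k4 * k1 * k2))).
Proof.
have -> : h3 * h4 * h1 * h2 * (k3 * k4 * k1 * k2) =
  h1 * h2 * h3 * h4 * (k1 * k2 * k3 * k4) by ring.
by ring.
Qed.

Lemma perm_pairs (T : eqType) (x1 x2 x3 x4 : T) (s : seq T) :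
  perm_eq [:: x1, x2, x3, x4 & s] [:: x3, x4, x1, x2 & s].
Proof. by rewrite (perm_catCA [:: x1; x2] [:: x3; x4] s). Qed.

Lemma defect_swap a b c d e z : defect a b c d e z = defect a d e b c z.
Proof.
rewrite /defect.
have -> : psi6 q a d e b c z = psi6 q a b c d e z.
  rewrite /psi6 /vsum /= (usum_perm q _ _ (perm_pairs d e b c _)).
  by rewrite (usum_perm q _ _ (perm_pairs (d / a) (e / a) (b / a) (c / a) _)).
have -> : w6 q a d e b c z = w6 q a b c d e z.
  by apply: usum_perm; rewrite perm_cons; exact: perm_pairs.
rewrite /wcoef /pcoef /denom8 /pairs6.
rewrite [d * b]mulrC [d * c]mulrC [e * b]mulrC [e * c]mulrC.
exact: swap_step.
Qed.

(** The genericity required by [defect_limit] for (b, c, d, e) and for the exchanged order (d, e, b,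
    c) at once. *)
Definition very_general a b c d e z :=
  [/\ general_position a b c d e z, generic (z / (b * c)) /\ generic (z / (d * e)),
   generic (z * b / a) /\ generic (z * d / a),
   generic (c * a / (b * z)) /\ generic (e * a / (d * z)) &
   [/\ generic (b * d / a), generic (b * e / a) & generic (c * d / a)]].

Lemma defect_generic a b c d e z : very_general a b c d e z ->
  b * c * d * e = a * q * z -> cabs (a * q / z) < 1 -> defect a b c d e z = 0.
Proof.
move=> [hg [g1 g1'] [g2 g2'] [g3 g3'] [g4 g5 g6]] he Z1.
have [W1|W1] := ltP (cabs (a * q / (d * e))) 1.
  exact: (defect_limit q01 hg he Z1 W1).
have [a0 z0 ga hp hw] := hg.
move: (hp) => /= [hb [hc [hd [h'e [hz _]]]]].
move: (hw) => /= [fb [fc [fd [fe [fa _]]]]].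
have [b0 _ _] := hb; have [c0 _ _] := hc; have [d0 _ _] := hd; have [e0 _ _] := h'e.
have q0 := base_neq0 q01.
have hg' : general_position a d e b c z.
  by split=> //; repeat (split; [assumption|]).
have he' : d * e * b * c = a * q * z by rewrite -he; ring.
have W' : cabs (a * q / (b * c)) < 1.
  have : cabs (a * q / (b * c)) * cabs (a * q / (d * e)) < 1.
    rewrite -cabsM (_ : _ * _ = a * q / z) //.
    have -> : z = b * c * d * e / (a * q) by rewrite he; field; rewrite a0 q0.
    by field; rewrite a0 q0 b0 c0 d0 e0.
  by apply: le_lt_trans; rewrite ler_peMr ?cabs_ge0.
have g4' : generic (d * b / a) by rewrite [d * b]mulrC.
have g6' : generic (d * c / a) by rewrite [d * c]mulrC.
by rewrite defect_swap; exact: (defect_limit q01 hg' he' Z1 W' g1' g2' g3' g4' g6').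
Qed.

Definition nudge (m : nat) : R := 1 + m.+1%:R^-1.

Lemma nudge_gt1 m : 1 < nudge m.
Proof. by rewrite /nudge ltrDl invr_gt0 ltr0n. Qed.

Lemma tends_nudge : tends (fun m => (nudge m)%:C%C) 1.
Proof.
apply/tendsP => e e0; have := cvg_harmonic (R := R).
move=> /cvgrPdist_lt/(_ e e0); apply: filterS => m; rewrite sub0r normrN => h.
have -> : 1 - (nudge m)%:C%C = - ((m.+1%:R^-1 : R)%:C%C).
  by rewrite /nudge rmorphD /= rmorph1; ring.
rewrite cabsN -ltcR -cabsE.
by rewrite normc_def /= expr0n /= addr0 sqrtr_sqr ltcR.
Qed.

(** With f the floor of -u, the point s - u lies strictly between f and f + 1 for 0 < s < f + 1 + u.
    Only points strictly to the left of u are excluded, so u may be an integer. *)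
Lemma left_gap_int (u : R) :
  exists2 e : R, 0 < e & forall s : R, 0 < s < e -> forall n : int, u - s != n%:~R.
Proof.
pose f := Num.floor (- u); have := floorD1_gt (- u); rewrite -/f => hf.
have := floor_le (- u); rewrite -/f => fu.
exists ((f + 1)%:~R + u); first by lra.
move=> s /andP[s0 s1] n; apply/eqP => e.
have h1 : (f%:~R : R) < (- n)%:~R by rewrite rmorphN /= -e; lra.
have h2 : ((- n)%:~R : R) < (f + 1)%:~R by rewrite rmorphN /= -e; lra.
rewrite ltr_int in h1; rewrite ltr_int ltzD1 in h2.
by have := lt_le_trans h1 h2; rewrite ltxx.
Qed.

Lemma ln_exprz (x : R) (n : int) : 0 < x -> ln (x ^ n) = ln x *~ n.
Proof.
move=> x0; case: n => n; first by rewrite -exprnP lnXn // -pmulrn.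
by rewrite NegzE -exprnN lnV ?posrE ?exprn_gt0 // lnXn.
Qed.

Lemma cabs_exprz (x : C) (n : int) : cabs (x ^ n) = cabs x ^ n.
Proof. by case: n => n; rewrite ?NegzE -?exprnN -?exprnP ?cabsV cabsX. Qed.

(** With t the nudge, y t^k q^n = 1 gives, by logarithms of moduli, u - s = - n with u = - ln |y| /
    la and s = k ln t / la. As t decreases to 1, the positive s falls below the gap to the left of
    u. *)
Lemma near_generic y k : y != 0 -> (0 < k)%N ->
  \forall m \near \oo, generic (y * (nudge m)%:C%C ^+ k).
Proof.
move=> y0 k0; have [r0 r1] := andP (base_cabs q01).
pose la := - ln (cabs q); have la0 : 0 < la.
  by rewrite oppr_gt0 ln_lt0 // r0.
have ny0 : 0 < cabs y by rewrite cabs_gt0.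
have [e e0 he] := left_gap_int (- (ln (cabs y) / la)).
have k0' : 0 < k%:R :> R by rewrite ltr0n.
have te : 0 < e * la / k%:R by rewrite divr_gt0 ?mulr_gt0.
have := cvg_harmonic (R := R) => /cvgrPdist_lt/(_ _ te).
apply: filterS => m; rewrite sub0r normrN /= ger0_norm ?invr_ge0 // => hm n.
have T1 := nudge_gt1 m; have T0 : 0 < nudge m := lt_trans ltr01 T1.
have lT : 0 < ln (nudge m) by rewrite ln_gt0.
have lT2 : ln (nudge m) <= m.+1%:R^-1.
  by apply: le_ln1Dx; apply: lt_le_trans (_ : 0 <= _); rewrite ?invr_ge0 // ltrN10.
apply/eqP => /(congr1 (@cabs R)); rewrite !cabsM cabsX cabs_exprz cabs1.
have -> : cabs (nudge m)%:C%C = nudge m.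
  by apply: (@complexI R); rewrite -cabsE normc_def /= expr0n /= addr0 sqrtr_sqr ger0_norm // ltW.
move=> /(congr1 (@ln R)); rewrite ln1 !lnM ?posrE ?mulr_gt0 ?exprz_gt0 ?exprn_gt0 //.
rewrite lnXn // ln_exprz // => h.
have hs : 0 < ln (nudge m) *+ k / la < e.
  apply/andP; split; first by rewrite divr_gt0 // -mulr_natr mulr_gt0.
  rewrite ltr_pdivrMr // -mulr_natr -ltr_pdivlMr //.
  exact: le_lt_trans lT2 hm.
have := he _ hs (- n); rewrite rmorphN /= => /eqP; apply.
have la0' : la != 0 by rewrite gt_eqF.
apply: (mulIf la0'); rewrite mulrBl mulNr !divfK //.
have {}h : ln (cabs y) + ln (nudge m) *+ k - n%:~R * la = 0.
  by rewrite /la mulrN opprK mulrzl.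
by lra.
Qed.

End Perturbation.

(** * Continuity in the parameters and the general identity *)

Section Continuity.
Local Open Scope classical_set_scope.
Variables (R : realType) (q : R[i]).
Hypothesis q01 : 0 < `|q| < 1.
Local Notation C := (R[i]).
Implicit Types (x y A Z a b c d e z w s : C).
Local Notation usum := (usum q).
Local Notation vsum := (vsum q).
Local Notation generic := (generic q).
Local Notation gpar := (gpar q).
Local Notation qinf := (qinf q).
Local Notation defect := (defect q).
Local Notation general_position := (general_position q).
Local Notation "'t_ m" := ((nudge R m)%:C%C) (at level 8, m at level 2).

Lemma nudge_neq0 m : 't_ m != 0.
Proof.
apply/eqP => /(@complexI R) h; have := nudge_gt1 R m; rewrite h; lra.
Qed.

Lemma near_generic_eq (u : nat -> C) y k : y != 0 -> (0 < k)%N ->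
  (forall m, u m = y * 't_ m ^+ k) -> \forall m \near \oo, generic (u m).
Proof.
by move=> y0 k0 uE; apply: filterS (near_generic q01 y0 k0) => m; rewrite uE.
Qed.

Lemma near_generic_inv (u : nat -> C) y k : y != 0 -> (0 < k)%N ->
  (forall m, (u m)^-1 = y * 't_ m ^+ k) -> \forall m \near \oo, generic (u m).
Proof.
move=> y0 k0 uE; apply: filterS (near_generic q01 y0 k0) => m.
by rewrite -uE => /genericV; rewrite invrK.
Qed.

Lemma near_gpar (a u : nat -> C) : (forall m, u m != 0) ->
  (\forall m \near \oo, generic (u m)) -> (\forall m \near \oo, generic (u m / a m)) ->
  \forall m \near \oo, gpar (a m) (u m).
Proof.
move=> u0 h1 h2; near=> m; split; first exact: u0.
  by near: m.
by near: m.
Unshelve. all: by end_near. Qed.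

(* The exponents are chosen so that none of the monomials that have to avoid
   the powers of q is constant in t. *)
Lemma near_very_general a b c d e z :
  a != 0 -> b != 0 -> c != 0 -> d != 0 -> e != 0 -> z != 0 ->
  \forall m \near \oo, very_general q (a * 't_ m) (b * 't_ m ^+ 2) (c * 't_ m ^+ 2)
    (d * 't_ m ^+ 2) (e * 't_ m ^+ 2) (z * 't_ m ^+ 7).
Proof.
move=> a0 b0 c0 d0 e0 z0; have t0 := nudge_neq0.
have pa x : x != 0 -> \forall m \near \oo, gpar (a * 't_ m) (x * 't_ m ^+ 2).
  move=> x0; apply: near_gpar => [m||].
  - by rewrite mulf_neq0 // expf_neq0.
  - exact: (near_generic_eq (y := x) (k := 2)).
  - apply: (near_generic_eq (y := x / a) (k := 1)) => //.
      by rewrite mulf_neq0 ?invr_neq0.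
    by move=> m; field; rewrite a0 t0.
have pz x : x != 0 ->
    \forall m \near \oo, gpar (z * 't_ m ^+ 7)^-1 (x * 't_ m ^+ 2 / (z * 't_ m ^+ 7)).
  move=> x0; apply: near_gpar => [m||].
  - by rewrite !(mulf_neq0, invr_neq0, expf_neq0).
  - apply: (near_generic_inv (y := z / x) (k := 5)) => //.
      by rewrite mulf_neq0 ?invr_neq0.
    by move=> m; field; rewrite x0 z0 t0.
  - apply: (near_generic_eq (y := x) (k := 2)) => //.
    by move=> m; field; rewrite z0 t0.
have gz : \forall m \near \oo, gpar (a * 't_ m) (z * 't_ m ^+ 7).
  apply: near_gpar => [m||].
  - by rewrite mulf_neq0 // expf_neq0.
  - exact: (near_generic_eq (y := z) (k := 7)).
  - apply: (near_generic_eq (y := z / a) (k := 6)) => //.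
      by rewrite mulf_neq0 ?invr_neq0.
    by move=> m; field; rewrite a0 t0.
have gza : \forall m \near \oo, gpar (z * 't_ m ^+ 7)^-1 (z * 't_ m ^+ 7 / (a * 't_ m)).
  apply: near_gpar => [m||].
  - by rewrite !(mulf_neq0, invr_neq0, expf_neq0).
  - apply: (near_generic_eq (y := z / a) (k := 6)) => //.
      by rewrite mulf_neq0 ?invr_neq0.
    by move=> m; field; rewrite a0 t0.
  - apply: (near_generic_eq (y := z ^+ 2 / a) (k := 13)) => //.
      by rewrite mulf_neq0 ?invr_neq0 ?expf_neq0.
    by move=> m; field; rewrite a0 z0 t0.
have ga : \forall m \near \oo, generic (a * 't_ m).
  exact: (near_generic_eq (y := a) (k := 1)).
have zxy x y : x != 0 -> y != 0 -> \forall m \near \oo,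
    generic (z * 't_ m ^+ 7 / (x * 't_ m ^+ 2 * (y * 't_ m ^+ 2))).
  move=> x0 y0; apply: (near_generic_eq (y := z / (x * y)) (k := 3)) => //.
    by rewrite !(mulf_neq0, invr_neq0).
  by move=> m; field; rewrite x0 y0 t0.
have zxa x : x != 0 -> \forall m \near \oo,
    generic (z * 't_ m ^+ 7 * (x * 't_ m ^+ 2) / (a * 't_ m)).
  move=> x0; apply: (near_generic_eq (y := z * x / a) (k := 8)) => //.
    by rewrite !(mulf_neq0, invr_neq0).
  by move=> m; field; rewrite a0 t0.
have xyza x y : x != 0 -> y != 0 -> \forall m \near \oo,
    generic (y * 't_ m ^+ 2 * (a * 't_ m) / (x * 't_ m ^+ 2 * (z * 't_ m ^+ 7))).
  move=> x0 y0; apply: (near_generic_inv (y := x * z / (y * a)) (k := 6)) => //.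
    by rewrite !(mulf_neq0, invr_neq0).
  by move=> m; field; rewrite x0 y0 z0 a0 t0.
have xya x y : x != 0 -> y != 0 -> \forall m \near \oo,
    generic (x * 't_ m ^+ 2 * (y * 't_ m ^+ 2) / (a * 't_ m)).
  move=> x0 y0; apply: (near_generic_eq (y := x * y / a) (k := 3)) => //.
    by rewrite !(mulf_neq0, invr_neq0).
  by move=> m; field; rewrite a0 t0.
near=> m; split.
- split.
  + by rewrite mulf_neq0.
  + by rewrite mulf_neq0 // expf_neq0.
  + by near: m.
  + split; first by near: m; exact: pa.
    split; first by near: m; exact: pa.
    split; first by near: m; exact: pa.
    split; first by near: m; exact: pa.
    by split; [near: m|].
  + split; first by near: m; exact: pz.
    split; first by near: m; exact: pz.
    split; first by near: m; exact: pz.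
    split; first by near: m; exact: pz.
    by split; [near: m|].
- by split; near: m; exact: zxy.
- by split; near: m; exact: zxa.
- by split; near: m; exact: xyza.
- by split; near: m; exact: xya.
Unshelve. all: by end_near. Qed.

Ltac tends_tac := repeat first
  [ assumption | exact: tends_cst | apply: tendsM | apply: (tends_qinf q01)
  | apply: tendsX | apply: tendsB | apply: tendsV ].

Section Sequences.
Variables (a_ b_ c_ d_ e_ z_ : nat -> C) (a b c d e z : C).
Hypotheses (ta : tends a_ a) (tb : tends b_ b) (tc : tends c_ c) (td : tends d_ d)
  (te : tends e_ e) (tz : tends z_ z).
Hypotheses (a0 : a != 0) (b0 : b != 0) (c0 : c != 0) (d0 : d != 0) (e0 : e != 0)
  (z0 : z != 0).

Lemma tends_psi6_seq : cabs (a * q / z) < 1 ->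
  (forall x, x \in [:: b; c; d; e; a / z; z] -> forall n,
     qfac q (a * q / x) n != 0 /\ qfac q (q / x) n != 0) ->
  tends (fun m => psi6 q (a_ m) (b_ m) (c_ m) (d_ m) (e_ m) (z_ m)) (psi6 q a b c d e z).
Proof.
move=> Z1 hn.
have tZ : tends (fun m => a_ m * q / z_ m) (a * q / z).
  by apply: tendsM (tendsV z0 tz); apply: tendsM ta (tends_cst q).
have taz : tends (fun m => a_ m / z_ m) (a / z) by exact: tendsM ta (tendsV z0 tz).
have tV := tendsV a0 ta.
have n1 x : x \in [:: b; c; d; e; a / z; z] -> forall n, qfac q (a * q / x) n != 0.
  by move=> xs n; case: (hn x xs n).
have n2 x : x != 0 -> x \in [:: b; c; d; e; a / z; z] ->
    forall n, qfac q (a^-1 * q / (x / a)) n != 0.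
  move=> x0 xs n; have -> : a^-1 * q / (x / a) = q / x by field; rewrite a0 x0.
  by case: (hn x xs n).
have az0 : a / z != 0 by rewrite mulf_neq0 ?invr_neq0.
have dv (u : nat -> C) x : tends u x -> tends (fun m => u m / a_ m) (x / a).
  by move=> h; exact: tendsM h tV.
have d0' x : x != 0 -> x / a != 0 by move=> x0; rewrite mulf_neq0 ?invr_neq0.
apply: tendsB (tends_cst 1); apply: tendsD ta; apply: tendsB; last apply: tendsM ta _.
- apply: (@tends_usum R q q01 a_ _ a _ [:: (b_, b); (c_, c); (d_, d); (e_, e);
    (fun m => a_ m / z_ m, a / z); (z_, z)] ta tZ Z1).
  by repeat (split; [split=> //; apply: n1; rewrite !inE eqxx ?orbT|]).
- apply: (@tends_usum R q q01 _ _ a^-1 _ [:: (fun m => b_ m / a_ m, b / a);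
    (fun m => c_ m / a_ m, c / a); (fun m => d_ m / a_ m, d / a);
    (fun m => e_ m / a_ m, e / a); (fun m => a_ m / z_ m / a_ m, a / z / a);
    (fun m => z_ m / a_ m, z / a)] tV tZ Z1).
  by repeat (split; [split; [exact: dv|exact: d0'|
    apply: n2 => //; rewrite !inE eqxx ?orbT //]|]).
Qed.

Lemma tends_w6_seq :
  (forall x, x \in [:: b / z; c / z; d / z; e / z; z / a] -> forall n,
     qfac q (z^-1 * q / x) n != 0) ->
  tends (fun m => w6 q (a_ m) (b_ m) (c_ m) (d_ m) (e_ m) (z_ m)) (w6 q a b c d e z).
Proof.
move=> hn; have tV := tendsV z0 tz.
have q1 : cabs q < 1 by have /andP[] := base_cabs q01.
have dv (u : nat -> C) x : tends u x -> tends (fun m => u m / z_ m) (x / z).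
  by move=> h; exact: tendsM h tV.
have d0' x : x != 0 -> x / z != 0 by move=> x0; rewrite mulf_neq0 ?invr_neq0.
apply: (@tends_usum R q q01 _ _ z^-1 _ [:: (fun m => (z_ m)^-1, z^-1);
  (fun m => b_ m / z_ m, b / z); (fun m => c_ m / z_ m, c / z);
  (fun m => d_ m / z_ m, d / z); (fun m => e_ m / z_ m, e / z);
  (fun m => z_ m / a_ m, z / a)] tV (tends_cst q) q1).
split.
  split=> //=; first by rewrite invr_neq0.
  move=> n; rewrite mulrAC mulfV ?invr_neq0 // mul1r; move: n.
  by apply/(qinf_neq0P q01); exact: qinf_q_neq0.
do 4!(split; first by split; [exact: dv|exact: d0'|
  move=> n; apply: hn; rewrite !inE eqxx ?orbT]).
split=> //; split; first exact: tendsM tz (tendsV a0 ta).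
  by rewrite mulf_neq0 ?invr_neq0.
by move=> n; apply: hn; rewrite !inE eqxx ?orbT.
Qed.

Lemma tends_wcoef_seq : qinf (z * q / a) * qinf (q / z) * qinf (a * q / z) != 0 ->
  denom8 q a b c d e z != 0 ->
  tends (fun m => wcoef q (a_ m) (b_ m) (c_ m) (d_ m) (e_ m) (z_ m))
    (wcoef q a b c d e z).
Proof.
move=> h1 h2; rewrite /wcoef /denom8 in h2 *; rewrite /pairs6.
by tends_tac; rewrite ?mulf_neq0 ?expf_neq0.
Qed.

Lemma tends_pcoef_seq :
  qinf (q / z) * qinf (z * q / a) * qinf (z * q) * qinf (a * q / z) != 0 ->
  denom8 q a b c d e z != 0 ->
  tends (fun m => pcoef q (a_ m) (b_ m) (c_ m) (d_ m) (e_ m) (z_ m))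
    (pcoef q a b c d e z).
Proof.
move=> h1 h2; rewrite /pcoef /denom8 in h2 *.
by tends_tac; rewrite ?mulf_neq0 ?expf_neq0.
Qed.

End Sequences.

End Continuity.

(** Translates a vanishing defect into the stated form; the trailing ones come from unfolding
    products over explicit lists. *)
Lemma closed_form_step (K : fieldType) (f1 zi Q q1 qa Za Zq Y z1 N2 x1 x2 x3 x4 x5 x6
    A1 A2 A3 A4 Z1 Z2 Z3 Z4 B1 B2 B3 B4 G1 G2 G3 G4 U W : K) :
  f1 != 0 -> 1 - zi != 0 ->
  U - f1 * Q ^+ 2 * q1 * qa / (Za * Zq * Y) *
      (N2 * (x1 * x2 * x3 * x4 * x5 * x6) / (A1 * A2 * A3 * A4 * (Z1 * Z2 * Z3 * Z4))) * W
    - zi * (f1 * Q ^+ 2 * q1 * qa / (Zq * Za * z1 * Y)) *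
      (B1 * B2 * B3 * B4 * (G1 * G2 * G3 * G4) / (A1 * A2 * A3 * A4 * (Z1 * Z2 * Z3 * Z4)))
    = 0 ->
  U / f1 =
  (1 - zi) * (Q * (Q * (q1 * (qa * 1))) / (Za * (Zq * (Y * 1)))) *
    (x1 * (x2 * (x3 * (x4 * (x5 * (x6 * (N2 * 1)))))) * 1 /
     (A1 * (A2 * (A3 * (A4 * 1))) * 1 * (Z1 * (Z2 * (Z3 * (Z4 * 1))) * 1))) *
    (W / (1 - zi)) +
  zi * (Q * (Q * (q1 * (qa * (B1 * (B2 * (B3 * (B4 * 1))))))) /
     (Zq * (Za * (z1 * (Y * 1))))) *
    (G1 * (G2 * (G3 * (G4 * 1))) * 1 /
     (A1 * (A2 * (A3 * (A4 * 1))) * 1 * (Z1 * (Z2 * (Z3 * (Z4 * 1))) * 1))).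
Proof.
move=> f0 n0 h; rewrite !mulr1 !mulrA in h *.
rewrite -[LHS]subr0 -[X in _ - X](mul0r f1^-1) -h.
move: (A1 * A2 * A3 * A4 * Z1 * Z2 * Z3 * Z4)^-1 (Za * Zq * Y)^-1
  (Zq * Za * z1 * Y)^-1 => D D1 D2.
by field; rewrite f0 n0.
Qed.

Lemma nested_neq0 (K : fieldType) (x1 x2 x3 x4 y1 y2 y3 y4 : K) :
  (x1 * (x2 * (x3 * (x4 * 1))) * 1) * (y1 * (y2 * (y3 * (y4 * 1))) * 1) != 0 ->
  x1 * x2 * x3 * x4 * (y1 * y2 * y3 * y4) != 0.
Proof. by rewrite !mulr1 !mulrA. Qed.

Lemma nested3_neq0 (K : fieldType) (x1 x2 x3 : K) :
  x1 * (x2 * (x3 * 1)) != 0 -> x1 * x2 * x3 != 0.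
Proof. by rewrite mulr1 mulrA. Qed.

Lemma nested4_neq0 (K : fieldType) (x1 x2 x3 x4 : K) :
  x1 * (x2 * (x3 * (x4 * 1))) != 0 -> x1 * x2 * x3 * x4 != 0.
Proof. by rewrite mulr1 !mulrA. Qed.

Lemma defect_eq0 (R : realType) (q a b c d e z : R[i]) : 0 < `|q| < 1 ->
  a != 0 -> b != 0 -> c != 0 -> d != 0 -> e != 0 -> z != 0 ->
  b * c * d * e = a * q * z -> cabs (a * q / z) < 1 ->
  (forall x, x \in [:: b; c; d; e; a / z; z] -> forall n,
     qfac q (a * q / x) n != 0 /\ qfac q (q / x) n != 0) ->
  (forall x, x \in [:: b / z; c / z; d / z; e / z; z / a] -> forall n,
     qfac q (z^-1 * q / x) n != 0) ->
  qinf q (z * q / a) * qinf q (q / z) * qinf q (a * q / z) != 0 ->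
  qinf q (q / z) * qinf q (z * q / a) * qinf q (z * q) * qinf q (a * q / z) != 0 ->
  denom8 q a b c d e z != 0 ->
  defect q a b c d e z = 0.
Proof.
move=> q01 a0 b0 c0 d0 e0 z0 he Z1 hn1 hn2 h1 h2 h3.
have tt := tends_nudge R.
have tX x k : tends (fun m => x * (nudge R m)%:C%C ^+ k) x.
  rewrite -[X in tends _ X](mulr1 x) -(expr1n _ k).
  exact: tendsM (tends_cst _) (tendsX _ tt).
have ta : tends (fun m => a * (nudge R m)%:C%C) a := tX a 1%N.
(* The weights keep b c d e = a q z, as 2 + 2 + 2 + 2 = 1 + 7. *)
have [tb tc td te tz] := And5 (tX b 2%N) (tX c 2%N) (tX d 2%N) (tX e 2%N) (tX z 7%N).
have tD := tendsB (tendsB (tends_psi6_seq q01 ta tb tc td te tz a0 b0 c0 d0 e0 z0 Z1 hn1)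
  (tendsM (tends_wcoef_seq q01 ta tb tc td te tz a0 b0 c0 d0 e0 z0 h1 h3)
    (tends_w6_seq q01 ta tb tc td te tz a0 b0 c0 d0 e0 z0 hn2)))
  (tends_pcoef_seq q01 ta tb tc td te tz a0 b0 c0 d0 e0 z0 h2 h3).
have tZ := tendsM (tendsM ta (tends_cst q)) (tendsV z0 tz).
apply: (tends_unique tD); apply/tendsP => eps eps0.
have r0 : 0 < 1 - cabs (a * q / z) by rewrite subr_gt0.
near=> m.
have W1 : cabs (a * (nudge R m)%:C%C * q / (z * (nudge R m)%:C%C ^+ 7)) < 1.
  have : cabs (a * q / z - a * (nudge R m)%:C%C * q / (z * (nudge R m)%:C%C ^+ 7))
      < 1 - cabs (a * q / z) by near: m; move/tendsP : tZ; apply.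
  set x := a * q / z; set y := a * _ * q / _.
  have := cabsB x (x - y); have -> : x - (x - y) = y by ring.
  lra.
have gm : very_general q (a * (nudge R m)%:C%C) (b * (nudge R m)%:C%C ^+ 2)
    (c * (nudge R m)%:C%C ^+ 2) (d * (nudge R m)%:C%C ^+ 2)
    (e * (nudge R m)%:C%C ^+ 2) (z * (nudge R m)%:C%C ^+ 7).
  by near: m; exact: near_very_general.
have hm : b * (nudge R m)%:C%C ^+ 2 * (c * (nudge R m)%:C%C ^+ 2) *
   (d * (nudge R m)%:C%C ^+ 2) * (e * (nudge R m)%:C%C ^+ 2) =
   a * (nudge R m)%:C%C * q * (z * (nudge R m)%:C%C ^+ 7).
  move: (nudge R m)%:C%C => t.
  by transitivity (b * c * d * e * t ^+ 8); [ring|rewrite he; ring].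
have := defect_generic q01 gm hm W1; rewrite /defect => ->.
by rewrite subrr cabs0.
Unshelve. all: by end_near. Qed.

Unset Implicit Arguments.
Set Strict Implicit.

Theorem theorem4p3 (R : realType) (q a b c d e z : R[i])
  (hq : 0 < `|q| < 1)
  (ha : a != 0) (hb : b != 0) (hc : c != 0) (hd : d != 0) (he : e != 0)
  (hz : z = b * c * d * e / (a * q))
  (hconv : `|a * q / z| < 1)
  (* no vanishing denominator in the terms of the two series *)
  (hpsi : vwp_psi_defined q a [:: b; c; d; e; a / z; z])
  (hW : vwp_W_defined q z^-1 [:: b / z; c / z; d / z; e / z; z / a])
  (* no vanishing denominator in the coefficients *)
  (hden1 : qinfs q [:: z * q / a; q / z; a * q / z] != 0)
  (hden2 : qinfs q [:: q / z; z * q / a; z * q; a * q / z] != 0)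
  (hden3 : Omega q [:: a * q] [:: b; c; d; e] *
           Omega q [:: z^-1] [:: b^-1; c^-1; d^-1; e^-1] != 0) :
  psi88 q a b c d e (a / z) z (a * q / z) =
    (1 - z^-1) *
    (qinfs q [:: q; q; a * q; q / a] /
     qinfs q [:: z * q / a; q / z; a * q / z]) *
    (Omega q [:: a * q]
       [:: b * c; b * d; b * e; c * d; c * e; d * e; z ^+ 2] /
     (Omega q [:: a * q] [:: b; c; d; e] *
      Omega q [:: z^-1] [:: b^-1; c^-1; d^-1; e^-1])) *
    W87 q z^-1 (b / z) (c / z) (d / z) (e / z) (z / a) q
    +
    z^-1 *
    (qinfs q [:: q; q; a * q; q / a; b; c; d; e] /
     qinfs q [:: q / z; z * q / a; z * q; a * q / z]) *
    (Omega q [:: a * q / z] [:: b; c; d; e] /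
     (Omega q [:: a * q] [:: b; c; d; e] *
      Omega q [:: z^-1] [:: b^-1; c^-1; d^-1; e^-1])).
Proof.
have q0 := base_neq0 hq.
have z0 : z != 0 by rewrite hz !(mulf_neq0, invr_neq0).
have zi0 : z^-1 != 0 by rewrite invr_neq0.
have hprod : b * c * d * e = a * q * z by rewrite hz; field; rewrite ha q0.
have Z1 : cabs (a * q / z) < 1 by move: hconv; rewrite cabsE ltcR.
have q1 : cabs q < 1 by have /andP[] := base_cabs hq.
have [a1 hx] := hpsi; have [z1 hw] := hW.
have nz x : x \in [:: b; c; d; e; a / z; z] -> x != 0.
  by rewrite !inE => /or4P[|||/or3P[||]] /eqP ->; rewrite ?mulf_neq0.
have hn1 x : x \in [:: b; c; d; e; a / z; z] -> forall n,
    qfac q (a * q / x) n != 0 /\ qfac q (q / x) n != 0.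
  move=> xs n; have [h1 h2] := hx x xs n; split; first exact: h1.
  (* By reversal, the condition on (x q^-n;q)_n gives the nonvanishing of (q/x;q)_n, the denominator
     in the mirrored series. *)
  by move: h2; rewrite (qfac_reverse hq n (nz x xs)) mulf_eq0 negb_or => /andP[].
have nzw x : x \in [:: b / z; c / z; d / z; e / z; z / a] -> x != 0.
  by rewrite !inE => /or4P[|||/orP[]] /eqP ->; rewrite mulf_neq0 ?invr_neq0.
have OmE x y : qinf q (x^-1 / y^-1) = qinf q (y / x) by rewrite invrK mulrC.
have OmE2 x : qinf q (a * q / z / x) = qinf q (a * q / (z * x)).
  by rewrite invfM mulrA.
rewrite (psi88E hq ha hb hc hd he hz Z1 hpsi).
have hl : eachP (fun x => x != 0 /\ forall n, qfac q (z^-1 * q / x) n != 0)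
    [:: z^-1; b / z; c / z; d / z; e / z; z / a].
  split; last by apply: eachP_mem => x xs; split; [exact: nzw|exact: hw].
  split=> // n; rewrite mulrAC mulfV // mul1r; move: n.
  by apply/(qinf_neq0P hq); exact: qinf_q_neq0.
rewrite (W87E hq zi0 q1 hl).
move: hden1 hden2 hden3; rewrite /qinfs /Omega !big_cons !big_nil.
rewrite (OmE z b) (OmE z c) (OmE z d) (OmE z e) (OmE2 b) (OmE2 c) (OmE2 d) (OmE2 e).
move=> hden1 hden2 hden3.
apply: closed_form_step a1 z1 _.
apply: (defect_eq0 hq ha hb hc hd he z0 hprod Z1 hn1 hw).
- exact: nested3_neq0 hden1.
- exact: nested4_neq0 hden2.
- exact: nested_neq0 hden3.
Qed.
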